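(* Let $\phi$ be an N-function and let $V_h$ be a discrete space. For $v_h\in V_h$ and $\tau\in L^1(\Omega;\mathbb{R}^d)$ let $$\mathcal{J}(v_h)=\int_\Omega \phi(|\nabla_h v_h|)\,dx-\int_\Omega f v_h\,dx,\qquad \mathcal{J}^*(\tau)=\int_\Omega \phi^*(|\tau|)\,dx .$$ Then $$\min_{v_h\in V_h}\mathcal{J}(v_h)=-\min_{\substack{\tau\in L^1(\Omega;\mathbb{R}^d)\\ -\operatorname{div}_h\tau=f\text{ in }V_h^*}}\mathcal{J}^*(\tau).$$ There exist minimizers $u_h\in V_h$ and $\sigma_h\in L^1(\Omega;\mathbb{R}^d)$ to the corresponding minimization problems; that is, $$u_h=\operatorname*{arg\,min}_{v_h\in V_h}\mathcal{J}(v_h)\qquad\text{and}\qquad \sigma_h=\operatorname*{arg\,min}_{\substack{\tau\in L^1(\Omega;\mathbb{R}^d)\\ -\operatorname{div}_h\tau=f\text{ in }V_h^*}}\mathcal{J}^*(\tau).$$ Minimizers are related via the identities $$\sigma_h=\frac{\phi'(|\nabla_h u_h|)}{|\nabla_h u_h|}\nabla_h u_h\qquad\text{and}\qquad \nabla_h u_h=\frac{(\phi^* )'(|\sigma_h|)}{|\sigma_h|}\sigma_h .$$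
   Context: $\Omega\subset\mathbb{R}^d$ is a bounded Lipschitz domain and $\mathcal{T}$ is a regular triangulation of $\Omega$. $\mathbb{P}_k(\mathcal{T})$ denotes the functions in $L^1(\Omega)$ whose restriction to each $T\in\mathcal{T}$ is a polynomial of degree at most $k$. The broken gradient $\nabla_h$ is defined by $(\nabla_h v)|_T:=\nabla (v|_T)$ for all $T\in\mathcal{T}$. Discrete space: $V_h$ is a finite-dimensional (finite element) space such as (i) the Lagrange space $\mathcal{L}^1_{k,0}(\mathcal{T})=\mathbb{P}_k(\mathcal{T})\cap W^{1,1}_0(\Omega)$ of order $k\in\mathbb{N}$; (ii) the Crouzeix–Raviart space $\mathrm{CR}^1_0(\mathcal{T})$ of all $v_h\in\mathbb{P}_1(\mathcal{T})$ that are continuous at the midpoints of interior faces of $\mathcal{T}$ and vanish at the barycenters of faces on $\partial\Omega$; (iii) spaces of discretely divergence-free functions, such as the Taylor–Hood element $\{v_h\in\mathcal{L}^1_{2,0}(\mathcal{T})^d:\int_\Omega p_h\operatorname{div}v_h\,dx=0$ for all continuous $p_h\in\mathbb{P}_1(\mathcal{T})\}$, the Crouzeix–Raviart element $\{v_h\in\mathrm{CR}^1_0(\mathcal{T})^d:\sum_{T\in\mathcal{T}}\int_T p_h\operatorname{div}v_h\,dx=0$ for all $p_h\in\mathbb{P}_0(\mathcal{T})\}$, or, for $d=2$, the Kouhia–Stenberg element, defined as the preceding one with $\mathrm{CR}^1_0(\mathcal{T})^d$ replaced by $\mathcal{L}^1_{1,0}(\mathcal{T})\times\mathrm{CR}^1_0(\mathcal{T})$.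 The notation is the one for scalar-valued functions; for vector-valued spaces $\mathbb{R}^d$ is replaced by $\mathbb{R}^{d\times d}$. Right-hand side: $f$ is a given right-hand side; for rough functionals $f$ the integral $\int_\Omega f v_h\,dx$ is replaced by the duality pairing. N-function: $\phi:\mathbb{R}_{\ge0}\to\mathbb{R}_{\ge0}$ is an N-function if it is continuous and convex and there is a right-continuous, non-decreasing function $\phi':\mathbb{R}_{\ge0}\to\mathbb{R}_{\ge0}$ with $\phi(t)=\int_0^t\phi'(s)\,ds$, $\lim_{t\to\infty}\phi'(t)=\infty$, $\phi'(0)=0$, and $\phi'(t)>0$ for all $t>0$. Its convex conjugate is $\phi^*(r):=\sup_{s\ge0}(rs-\phi(s))$ for $r\ge0$; its derivative is the right-continuous inverse $(\phi^* )'(t)=\sup\{r\ge0:\phi'(r)\le t\}$. For $\tau\in L^1(\Omega;\mathbb{R}^d)$, ''$-\operatorname{div}_h\tau=f$ in $V_h^*$'' means $\int_\Omega\tau\cdot\nabla_h v_h\,dx=\int_\Omega f v_h\,dx$ for all $v_h\in V_h$. Expressions $\frac{\phi'(|a|)}{|a|}a$ and $\frac{(\phi^* )'(|a|)}{|a|}a$ are read as $0$ if $a=0$.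
   Formalization: The identities for σ_h, ∇_h u_h hold a.e. where φ', resp. (φ* )', is continuous at |∇_h u_h|, resp. |σ_h|, and elsewhere with a subgradient of φ, φ* in its place, as they can fail at jumps; V_h other than the listed spaces must satisfy: ∇_h v_h=0 implies v_h=0. *)

(* Defs.v *)
From HB Require Import structures.
From mathcomp Require Import all_boot all_order all_algebra.
From mathcomp Require Import all_classical all_reals all_analysis.
Set Implicit Arguments. Unset Strict Implicit. Unset Printing Implicit Defensive.
Import Order.TTheory GRing.Theory Num.Theory numFieldNormedType.Exports.
Local Open Scope classical_set_scope. Local Open Scope ring_scope.

Definition row_display : measure_display.
Proof. exact: default_measure_display. Qed.

Section row_measurable.
Context (R : realType) (n : nat).

Let coord (i : 'I_n) (x : 'rV[R]_n) : measurableTypeR R := x ord0 i.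

Let row0 : g_sigma_preimage coord set0.
Proof. exact: sigma_algebra0. Qed.

Let rowC A : g_sigma_preimage coord A -> g_sigma_preimage coord (~` A).
Proof. exact: sigma_algebraC. Qed.

Let row_bigcup (F : _^nat) : (forall i, g_sigma_preimage coord (F i)) ->
  g_sigma_preimage coord (\bigcup_i (F i)).
Proof. exact: sigma_algebra_bigcup. Qed.

HB.instance Definition _ := @isMeasurable.Build row_display
  'rV[R]_n (g_sigma_preimage coord) row0 rowC row_bigcup.

Lemma measurable_coord (i : 'I_n) :
  measurable_fun setT (fun x : 'rV[R]_n => x ord0 i : measurableTypeR R).
Proof.
move=> _ B mB; rewrite setTI; apply: sub_sigma_algebra => /=.
rewrite -bigcup_seq/=; exists i => /=; first by rewrite mem_index_enum.
by exists B => //; rewrite setTI.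
Qed.

Lemma measurable_fun_row d (T : measurableType d) (f : T -> 'rV[R]_n) :
  (forall i, measurable_fun setT (fun t => f t ord0 i : measurableTypeR R)) ->
  measurable_fun setT f.
Proof.
move=> mf _ B mB; rewrite setTI.
suff: [set A | measurable (f @^-1` A)] B by [].
move: mB; apply: smallest_sub.
  split => /= [|A mA|F mF]; first by rewrite preimage_set0.
    by rewrite setTD preimage_setC; exact: measurableC.
  by rewrite preimage_bigcup; exact: bigcup_measurable.
move=> A; rewrite -bigcup_seq/= => -[i _ [C mC <-]].
by rewrite /= setTI; have := mf i measurableT C mC; rewrite setTI.
Qed.

End row_measurable.

Section row_cons.
Context (R : realType) (n : nat).

Definition row_cons (p : measurableTypeR R * 'rV[R]_n) : 'rV[R]_n.+1 :=
  \row_i (if unlift ord0 i is Some j then p.2 ord0 j else p.1).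

Lemma measurable_row_cons : measurable_fun setT row_cons.
Proof.
apply: measurable_fun_row => i; rewrite /row_cons.
under eq_fun do rewrite mxE.
case: unliftP => [j _|_]; last exact: measurable_fst.
exact: (measurableT_comp (measurable_coord j) measurable_snd).
Qed.

Context (m : {sigma_finite_measure set 'rV[R]_n -> \bar R}).

Definition leb_cons : set 'rV[R]_n.+1 -> \bar R :=
  pushforward (lebesgue_measure \x m)%E row_cons.

Let leb_cons0 : leb_cons set0 = 0%E.
Proof. by rewrite /leb_cons /pushforward preimage_set0 measure0. Qed.

Let leb_cons_ge0 A : (0 <= leb_cons A)%E.
Proof.
rewrite /leb_cons /pushforward.
pose P : {measure set _ -> \bar R} := (lebesgue_measure \x m)%E.
exact: (@measure_ge0 _ _ _ P).
Qed.

Let leb_cons_sigma_additive : semi_sigma_additive leb_cons.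
Proof.
move=> F mF tF mUF; rewrite /leb_cons /pushforward preimage_bigcup.
pose P : {measure set _ -> \bar R} := (lebesgue_measure \x m)%E.
have mpre A : measurable A -> measurable (row_cons @^-1` A).
  by move=> mA; rewrite -[X in measurable X]setTI; exact: measurable_row_cons.
apply: (@measure_semi_sigma_additive _ _ _ P (fun k => row_cons @^-1` F k)).
- by move=> k; exact: mpre (mF k).
- apply/trivIsetP => /= i j _ _ ij; rewrite -preimage_setI.
  by move/trivIsetP : tF => /(_ _ _ _ _ ij) ->//; rewrite preimage_set0.
- by rewrite -preimage_bigcup; exact: mpre.
Qed.

HB.instance Definition _ := isMeasure.Build _ _ _ leb_cons
  leb_cons0 leb_cons_ge0 leb_cons_sigma_additive.

Let leb_cons_sigma_finite : sigma_finite setT leb_cons.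
Proof.
pose uncons (x : 'rV[R]_n.+1) : measurableTypeR R * 'rV[R]_n :=
  (x ord0 ord0, \row_j x ord0 (lift ord0 j)).
have muncons : measurable_fun setT uncons.
  apply: measurable_fun_pair; first exact: measurable_coord.
  apply: measurable_fun_row => i; under eq_fun do rewrite mxE.
  exact: measurable_coord.
have consK : cancel row_cons uncons.
  move=> [a x]; rewrite /uncons /row_cons /= mxE unlift_none; congr (_, _).
  by apply/rowP => j; rewrite !mxE liftK.
have mpre A : measurable A -> measurable (uncons @^-1` A).
  by move=> mA; rewrite -[X in measurable X]setTI; exact: muncons.
have preK A : row_cons @^-1` (uncons @^-1` A) = A.
  by rewrite -comp_preimage (_ : _ \o _ = id)//; apply/funext => p; exact: consK.
have /sigma_finiteP[F [TF ndF Foo]] :=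
  sigma_finiteT (@lebesgue_measure R : {sigma_finite_measure set _ -> \bar R}).
have /sigma_finiteP[G [TG ndG Goo]] := sigma_finiteT m.
exists (fun k => uncons @^-1` (F k `*` G k)).
  rewrite -preimage_bigcup (_ : \bigcup_k _ = setT) ?preimage_setT//.
  rewrite -setXTT TF TG predeqE => -[x y]; split.
    by move=> [k _ []/= ? ?]; split; exists k.
  move=> [/= [k _ Fkx] [l _ Gly]]; exists (maxn k l) => //; split.
  - by move: x Fkx; exact/subsetPset/ndF/leq_maxl.
  - by move: y Gly; exact/subsetPset/ndG/leq_maxr.
move=> k; have [? ?] := Foo k; have [? ?] := Goo k.
split; first by apply: mpre; exact: measurableX.
rewrite /leb_cons /pushforward preK product_measure1E//.
by rewrite lte_mul_pinfty// ge0_fin_numE.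
Qed.

HB.instance Definition _ := Measure_isSigmaFinite.Build _ _ _ leb_cons
  leb_cons_sigma_finite.

End row_cons.

(* The Lebesgue measure on R^n, as an iterated product. *)
Fixpoint leb (R : realType) n : {sigma_finite_measure set 'rV[R]_n -> \bar R} :=
  match n with
  | 0 => dirac (0 : 'rV[R]_0)
  | n'.+1 => leb_cons (leb R n')
  end.

Section linear_algebra.
Context (R : realType).

(* Euclidean (Frobenius) inner product and norm; the library norm on matrices
   is the max norm. *)
Definition mxdot m d (A B : 'M[R]_(m, d)) : R :=
  \sum_(a < m) \sum_(b < d) A a b * B a b.

Definition frob m d (A : 'M[R]_(m, d)) : R := Num.sqrt (mxdot A A).

(* Convex hull of the rows A_j with j in S. *)
Definition hull k d (A : 'M[R]_(k, d)) (S : pred 'I_k) : set 'rV[R]_d :=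
  [set x | exists l : 'rV[R]_k, [/\ forall j, 0 <= l ord0 j,
    forall j, ~~ S j -> l ord0 j = 0, \sum_j l ord0 j = 1 & x = l *m A]].

End linear_algebra.

Section nfunction.
Context (R : realType).

(* phi and dphi are only ever evaluated on [0, +oo[. *)
Record nfunction (phi dphi : R -> R) : Prop := NFunction {
  nfun_ge0 : forall t, 0 <= t -> 0 <= phi t;
  nfun_cont : {within `[0, +oo[, continuous phi};
  nfun_convex : forall s t l, 0 <= s -> 0 <= t -> 0 <= l <= 1 ->
    phi (l * s + (1 - l) * t) <= l * phi s + (1 - l) * phi t;
  nfun_dge0 : forall t, 0 <= t -> 0 <= dphi t;
  nfun_drcont : forall t, 0 <= t -> dphi s @[s --> t^'+] --> dphi t;
  nfun_dhomo : forall s t, 0 <= s -> s <= t -> dphi s <= dphi t;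
  nfun_int : forall t, 0 <= t ->
    (phi t)%:E = (\int[lebesgue_measure]_(s in `[0%R, t]) (dphi s)%:E)%E;
  nfun_dlim : dphi t @[t --> +oo] --> +oo;
  nfun_d0 : dphi 0 = 0;
  nfun_dgt0 : forall t, 0 < t -> 0 < dphi t }.

Definition conjugate (phi : R -> R) (r : R) : \bar R :=
  ereal_sup [set (r * s - phi s)%:E | s in [set s | 0 <= s]].

Definition dconjugate (dphi : R -> R) (t : R) : R :=
  sup [set r | 0 <= r /\ dphi r <= t].

Definition subgradient (g : R -> \bar R) (t s : R) : Prop :=
  forall r, 0 <= r -> (g t + (s * (r - t))%:E <= g r)%E.

(* For right-continuous h on [0, +oo[, this is continuity at t >= 0. *)
Definition leftcont (h : R -> R) (t : R) : Prop :=
  0 < t -> h s @[s --> t^'-] --> h t.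

End nfunction.

Section domain.
Context (R : realType) (d : nat) (Omega : set 'rV[R]_d).

Definition bdry : set 'rV[R]_d := closure Omega `\` Omega.

Definition unit_row (b : 'I_d) : 'rV[R]_d := delta_mx ord0 b.

Definition L1 (w : 'rV[R]_d -> R) : Prop :=
  (leb R d).-integrable Omega (EFin \o w).

Fixpoint Cn (k : nat) (psi : 'rV[R]_d -> R) : Prop :=
  match k with
  | 0 => continuous psi
  | k'.+1 => continuous psi /\ forall b,
      (forall x, derivable psi x (unit_row b)) /\
      Cn k' (fun x => 'D_(unit_row b) psi x)
  end.

(* C_c^oo(Omega) *)
Definition test_function (psi : 'rV[R]_d -> R) : Prop :=
  (forall k, Cn k psi) /\
  exists2 K, compact K /\ K `<=` Omega & forall x, ~ K x -> psi x = 0.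

Definition weak_gradient (w : 'rV[R]_d -> R) (g : 'I_d -> 'rV[R]_d -> R) :=
  forall psi b, test_function psi ->
    \int[leb R d]_(x in Omega) (w x * 'D_(unit_row b) psi x) =
    - \int[leb R d]_(x in Omega) (g b x * psi x).

(* Closure of C_c^oo(Omega) in W^{1,1}(Omega). *)
Definition W110 (w : 'rV[R]_d -> R) : Prop :=
  L1 w /\ exists g, [/\ forall b, L1 (g b), weak_gradient w g &
    exists psi : nat -> 'rV[R]_d -> R, [/\ forall l, test_function (psi l),
      (\int[leb R d]_(x in Omega) `|psi l x - w x|%:E @[l --> \oo] --> 0)%E &
      forall b, (\int[leb R d]_(x in Omega)
        `|'D_(unit_row b) (psi l) x - g b x|%:E @[l --> \oo] --> 0)%E]].

End domain.

(* Near each boundary point, after an orthogonal change of coordinates, Omega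
   is the strict epigraph of a Lipschitz function of the last n coordinates. *)
Record lipschitz_domain (R : realType) n (Omega : set 'rV[R]_n.+1) : Prop :=
  LipschitzDomain {
  dom_nonempty : Omega !=set0;
  dom_open : open Omega;
  dom_connected : connected Omega;
  dom_bounded : bounded_set Omega;
  dom_lipschitz : forall x, bdry Omega x ->
    exists (Q : 'M[R]_n.+1) (r : R) (gamma : 'rV[R]_n -> R),
      [/\ Q *m Q^T = 1%:M, 0 < r, lipschitz gamma &
        forall y, ball x r y ->
          (Omega y <-> gamma (col' ord0 (y *m Q)) < (y *m Q) ord0 ord0)] }.

Section mesh.
Context (R : realType) (n : nat).
Notation d := n.+1.
Context (Omega : set 'rV[R]_d) (N : nat) (tri : 'I_N -> 'M[R]_(d.+1, d)).

(* The rows of tri i are the vertices of the i-th simplex. *)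
Definition simplex i : set 'rV[R]_d := hull (tri i) xpredT.

(* Face of the i-th simplex opposite to its k-th vertex, and its barycenter. *)
Definition face i k : set 'rV[R]_d := hull (tri i) (predC1 k).

Definition bary i k : 'rV[R]_d := d%:R^-1 *: \sum_(j | j != k) row j (tri i).

(* The last condition says that two simplices are disjoint or intersect in the
   subsimplex spanned by their common vertices. *)
Record triangulation : Prop := Triangulation {
  tri_nondegenerate : forall i (c : 'rV[R]_d.+1),
    \sum_j c ord0 j = 0 -> c *m tri i = 0 -> c = 0;
  tri_distinct : forall i j, simplex i = simplex j -> i = j;
  tri_cover : \bigcup_i simplex i = closure Omega;
  tri_conforming : forall i j, simplex i `&` simplex j =
    hull (tri i) [pred k | [exists l, row k (tri i) == row l (tri j)]] }.

(* The function equal to w i on the i-th simplex. On the intersections, which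
   are null sets, one of the values is picked. *)
Definition piecewise (w : 'I_N -> 'rV[R]_d -> R) (x : 'rV[R]_d) : R :=
  if [pick i | x \in simplex i] is Some i then w i x else 0.

(* An R^m-valued piecewise polynomial v is represented by its pieces: v i a is
   the polynomial function on R^d that coincides with the component a of v on
   the i-th simplex. Since simplices have interior points, each element of
   P_k(T)^m has exactly one such representation. *)
Definition broken m := 'I_N -> 'I_m -> 'rV[R]_d -> R^o.

Definition polynomial_fun k (p : 'rV[R]_d -> R) : Prop :=
  exists c : {ffun 'I_d -> 'I_k.+1} -> R, forall x,
    p x = \sum_(e : {ffun 'I_d -> 'I_k.+1} | (\sum_b e b <= k)%N)
            c e * \prod_b x ord0 b ^+ e b.

Definition Pk k m : set (broken m) :=
  [set v | forall i a, polynomial_fun k (v i a)].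

Definition dpiece m (v : broken m) i a b (x : 'rV[R]_d) : R :=
  'D_(unit_row R b) (v i a) x.

Definition gradh m (v : broken m) (x : 'rV[R]_d) : 'M[R]_(m, d) :=
  \matrix_(a, b) piecewise (fun i => dpiece v i a b) x.

Definition lagrange_comp (w : 'I_N -> 'rV[R]_d -> R) : Prop :=
  W110 Omega (piecewise w).

Definition cr_comp (w : 'I_N -> 'rV[R]_d -> R) : Prop :=
  (forall i j k l, face i k = face j l -> ~ face i k `<=` bdry Omega ->
     w i (bary i k) = w j (bary j l)) /\
  (forall i k, face i k `<=` bdry Omega -> w i (bary i k) = 0).

Definition lagrange k m : set (broken m) :=
  [set v | Pk k v /\ forall a, lagrange_comp (fun i => v i a)].

Definition crouzeix_raviart m : set (broken m) :=
  [set v | Pk 1 v /\ forall a, cr_comp (fun i => v i a)].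

(* sum_T int_T p_h div v_h dx = 0 for all p_h in P_0(T) *)
Definition divh_free (v : broken d) : Prop :=
  forall p : broken 1, Pk 0 p ->
    \sum_i \int[leb R d]_(x in simplex i)
      (p i ord0 x * \sum_a dpiece v i a a x) = 0.

Definition taylor_hood : set (broken d) :=
  [set v | lagrange 2 v /\ forall p : broken 1, Pk 1 p ->
    {within Omega, continuous (piecewise (fun i => p i ord0))} ->
    \int[leb R d]_(x in Omega)
      (piecewise (fun i => p i ord0) x * \tr (gradh v x)) = 0].

Definition crouzeix_raviart_div : set (broken d) :=
  [set v | crouzeix_raviart v /\ divh_free v].

Definition kouhia_stenberg : set (broken d) :=
  [set v | [/\ Pk 1 v,
    forall a, if a == ord0 then lagrange_comp (fun i => v i a)
              else cr_comp (fun i => v i a) & divh_free v]].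

Definition subspace m (V : set (broken m)) : Prop :=
  V 0 /\ forall c u v, V u -> V v -> V (c *: u + v).

(* Besides the named elements, any space of piecewise polynomials on which
   |nabla_h .| is a norm is admitted. *)
Inductive discrete_space : forall m, set (broken m) -> Prop :=
| DLagrange k m : discrete_space (@lagrange k m)
| DCrouzeixRaviart m : discrete_space (@crouzeix_raviart m)
| DTaylorHood : discrete_space taylor_hood
| DCrouzeixRaviartDiv : discrete_space crouzeix_raviart_div
| DKouhiaStenberg : d = 2%N -> discrete_space kouhia_stenberg
| DOther k m (V : set (broken m)) : subspace V -> V `<=` @Pk k m ->
    (forall v, V v -> {ae leb R d, forall x, Omega x -> gradh v x = 0} ->
       v = 0) ->
    discrete_space V.

Section energies.
Context (m : nat) (V : set (broken m)) (f : broken m -> R) (phi : R -> R).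

(* f in V_h^*; a function f acts by v_h |-> int_Omega f v_h dx *)
Definition functional_on : Prop :=
  forall c u v, V u -> V v -> f (c *: u + v) = c * f u + f v.

Definition primal (v : broken m) : \bar R :=
  (\int[leb R d]_(x in Omega) (phi (frob (gradh v x)))%:E - (f v)%:E)%E.

Definition dual (tau : 'rV[R]_d -> 'M[R]_(m, d)) : \bar R :=
  (\int[leb R d]_(x in Omega) conjugate phi (frob (tau x)))%E.

(* tau in L^1 with - div_h tau = f in V_h^* *)
Definition equilibrated : set ('rV[R]_d -> 'M[R]_(m, d)) :=
  [set tau : 'rV[R]_d -> 'M[R]_(m, d) | (forall a b, L1 Omega (fun x => tau x a b)) /\
    forall v, V v ->
      \int[leb R d]_(x in Omega) mxdot (tau x) (gradh v x) = f v].

End energies.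
End mesh.

Definition argmin (R : realType) (T : Type) (A : set T) (F : T -> \bar R)
    (u : T) : Prop :=
  A u /\ forall v, A v -> (F u <= F v)%E.

(* Main.v *)
(* A discrete space has a finite basis, so the primal functional is a continuous
   function of finitely many coefficients. It is coercive because the broken
   gradient is a norm: a function with vanishing broken gradient is piecewise
   constant; in the Crouzeix-Raviart case a signed volume count over the simplices
   where it does not vanish excludes nonzero values, and in the Lagrange case a
   W^{1,1}_0 function with finitely many values vanishes.

   phi may fail to be differentiable, so the stress of a minimizer u is obtained
   from approximate subgradients of phi(|.|) along nabla_h u: the set of their
   residuals in V_h^* comes arbitrarily close to 0, by separation and minimality,
   and those of almost minimal L^2 norm converge to an equilibrated exact
   subgradient sigma. For every admissible pair, the energies add up to the
   integral of phi(|nabla_h v|) + phi^*(|tau|) - tau . nabla_h v >= 0. This vanishes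
   for (u, sigma), hence for all pairs of minimizers, and the equality cases of
   the Cauchy-Schwarz and Young inequalities give the relations. *)
Require Import Defs.
From HB Require Import structures.
From mathcomp Require Import all_boot all_order all_algebra.
From mathcomp Require Import all_classical all_reals all_analysis.
From mathcomp Require Import perm.
From mathcomp Require Import ring lra.
From mathcomp Require Import measurable_realfun lebesgue_integral.
Set Implicit Arguments. Unset Strict Implicit. Unset Printing Implicit Defensive.
Import Order.TTheory GRing.Theory Num.Theory numFieldNormedType.Exports.
Local Open Scope classical_set_scope. Local Open Scope ring_scope.

(** * Lebesgue measure on row vectors *)

Section leb_theory.
Context {R : realType}.

(** At a kink of [phi] the right derivative yields one subgradient, in general not the one that
    balances the load, so the stress is searched for in a convex set instead of being given by a
    formula. That set carries a tolerance because the descent argument uses the stress of a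
    perturbed point [u + t w], which is a subgradient there and only approximately one at [u].
    Piecewise polynomials on a bounded domain have bounded broken gradients, and the stresses near
    [u] are bounded as well; the minimization therefore takes place among bounded fields on a set of
    finite measure, where L^2 geometry is available whatever the growth of [phi]. Admissible dual
    fields are merely in L^1 and may have infinite dual energy; they meet only bounded gradients. On
    the mesh side, the signed volume count rests on a geometric fact to be derived from covering and
    conformity: a face inside the domain has a second simplex on its other side, and this pairing is
    injective. For W^{1,1}_0 no traces are used: a bounded cutoff flattens the finitely many values,
    and a Poincare inequality on lines does the rest. *)

Definition cube n (c : 'rV[R]_n) (r : R) : set 'rV[R]_n :=
  [set x | forall i, `|c ord0 i - x ord0 i| < r].

Lemma ballE_cube n (c : 'rV[R]_n) (r : R) : 0 < r -> ball c r = cube c r.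
Proof.
move=> r0; apply/seteqP; split => x.
  by move=> [_ h] i; exact: h.
by move=> h; split => // i j; rewrite (ord1 i); exact: h.
Qed.

Lemma measurable_cube n (c : 'rV[R]_n) (r : R) : measurable (cube c r).
Proof.
rewrite (_ : cube c r = \bigcap_(i in [set: 'I_n])
    ((fun x : 'rV[R]_n => x ord0 i : measurableTypeR R) @^-1` ball (c ord0 i) r)).
  apply: fin_bigcap_measurable => // i _; rewrite -[X in measurable X]setTI.
  apply: measurable_coord => //; exact: measurable_ball.
apply/seteqP; split => x h i; first by move=> _; exact: h.
exact: h.
Qed.

(** The sigma-algebra is generated by the coordinates, not by the open sets. An open set is the
    union of the countably many cubes of rational centre and radius [1 / (k + 1)] that it
    contains. *)
Lemma open_measurable_row n (U : set 'rV[R]_n) : open U -> measurable U.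
Proof.
move=> oU.
pose Q (p : 'rV[rat]_n * nat) := map_mx (@ratr R) p.1.
pose F p := if `[< cube (Q p) p.2.+1%:R^-1 `<=` U >]
            then cube (Q p) p.2.+1%:R^-1 else set0.
rewrite (_ : U = \bigcup_p F p).
  apply: countable_bigcupT_measurable => // p; rewrite /F.
  by case: ifP => _ //; exact: measurable_cube.
apply/seteqP; split => [x Ux|x [p _]]; last first.
  by rewrite /F; case: ifPn => // /asboolP; apply.
have /nbhs_ballP[e /= e0] : nbhs x U by exact: open_nbhs_nbhs.
rewrite ballE_cube// => eU.
have [k ke] : exists k : nat, k.+1%:R^-1 < e / 2 :> R.
  have e2 : 0 < e / 2 by rewrite divr_gt0.
  have [k _ /(_ k (leqnn k))] := near_infty_natSinv_lt (PosNum e2).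
  by exists k.
have /choice[q hq] : forall i : 'I_n, exists q : rat, `|ratr q - x ord0 i| < k.+1%:R^-1 :> R.
  move=> i.
  have xk : x ord0 i - k.+1%:R^-1 < x ord0 i + k.+1%:R^-1 :> R.
    by rewrite ltrBlDr -addrA ltrDl addr_gt0// invr_gt0.
  have [q] := rat_in_itvoo xk.
  by rewrite in_itv/= => /andP[h1 h2]; exists q; rewrite ltr_norml ltrBlDl h2 andbT ltrBrDr addrC.
exists (\row_i q i, k) => //; rewrite /F ifT.
  by move=> i; rewrite /Q/= !mxE; exact: hq.
apply/asboolP => y hy; apply: eU => i.
have := hy i; have := hq i; rewrite /Q/= !mxE => h1 h2.
rewrite (_ : x ord0 i - _ = (ratr (q i) - y ord0 i) - (ratr (q i) - x ord0 i)); last by ring.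
by rewrite (le_lt_trans (ler_normB _ _))// [e]splitr ltrD// (lt_trans _ ke).
Qed.

Lemma closed_measurable_row n (U : set 'rV[R]_n) : closed U -> measurable U.
Proof.
move=> cU; rewrite -[U]setCK; apply: measurableC; apply: open_measurable_row.
exact: closed_openC.
Qed.

Lemma continuous_measurable_row n (f : 'rV[R]_n -> R) :
  continuous f -> measurable_fun setT (f : _ -> measurableTypeR R).
Proof.
move=> /continuousP cf.
apply: (measurability _ (RGenOpens.measurableE R)).
move=> _ [_ [a [b ->]] <-]; rewrite setTI.
by apply: open_measurable_row; exact/cf/interval_open.
Qed.

Lemma leb_cube n (c : 'rV[R]_n) (r : R) : 0 < r ->
  leb R n (cube c r) = ((r *+ 2) ^+ n)%:E.
Proof.
move=> r0; elim: n c => [|n IH] c.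
  by rewrite /= diracE mem_set// => -[].
rewrite /= /leb_cons /pushforward.
pose c' := \row_j c ord0 (lift ord0 j).
rewrite (_ : _ @^-1` _ = (ball (c ord0 ord0) r `*` cube c' r)); last first.
  apply/seteqP; split => -[t y]; rewrite /cube /row_cons /=.
    move=> h; split.
      by have := h ord0; rewrite mxE unlift_none.
    by move=> i; have := h (lift ord0 i); rewrite !mxE liftK.
  move=> [h1 h2] i; rewrite mxE; case: unliftP => [j ->|->] //.
  by have := h2 j; rewrite mxE.
rewrite product_measure1E; [|exact: measurable_ball|exact: measurable_cube].
rewrite IH exprS EFinM; congr (_ * _)%E.
exact: lebesgue_measure_ball (ltW r0).
Qed.

Lemma coord_le_norm n (x : 'rV[R]_n) i : `|x ord0 i| <= `|x|.
Proof.
rewrite -[`|x|]/(mx_norm x) mx_normrE.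
exact: (@le_bigmax _ _ _ 0 (fun ij => `|x ij.1 ij.2|) (ord0, i)).
Qed.

Lemma leb_bounded n (A : set 'rV[R]_n) : measurable A -> bounded_set A ->
  (leb R n A < +oo)%E.
Proof.
move=> mA [M [Mr hM]]; have r0 : 0 < `|M| + 2 by have := normr_ge0 M; lra.
(* [bounded_set] bounds by every number above [M], which may be negative: [|M| + 1] is such a
   number, and the strict inequality in [cube] takes one more. *)
apply: (@le_lt_trans _ _ (leb R n (cube 0 (`|M| + 2)))).
  apply: le_measure; rewrite ?inE//; first exact: measurable_cube.
  move=> x Ax i; rewrite mxE sub0r normrN.
  have := hM (`|M| + 1) _ x Ax; have := ler_norm M.
  move=> h /(_ ltac:(lra)) /= h2.
  have : `|x ord0 i| <= `|x|.
    exact: coord_le_norm.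
  by move=> h3; rewrite (le_lt_trans (le_trans h3 h2))// ltrD2l ltr1n.
by rewrite leb_cube// ltry.
Qed.

Lemma leb_open_gt0 n (U : set 'rV[R]_n) : open U -> U !=set0 ->
  (0 < leb R n U)%E.
Proof.
move=> oU [x Ux].
have /nbhs_ballP[e /= e0] : nbhs x U by exact: open_nbhs_nbhs.
rewrite ballE_cube// => eU.
apply: (@lt_le_trans _ _ (leb R n (cube x e))).
  by rewrite leb_cube// lte_fin exprn_gt0// mulrn_wgt0.
by apply: le_measure; rewrite ?inE//; [exact: measurable_cube|exact: open_measurable_row].
Qed.

(** Tonelli in the first coordinate, which the recursive definition of [leb] splits off; the
    Poincare inequality integrates along these lines. *)
Lemma ge0_integral_leb n (f : 'rV[R]_n.+1 -> \bar R) :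
  measurable_fun setT f -> (forall x, 0 <= f x)%E ->
  (\int[leb R n.+1]_x f x =
   \int[leb R n]_y \int[lebesgue_measure]_t f (row_cons (t, y)))%E.
Proof.
move=> mf f0.
transitivity (\int[lebesgue_measure \x leb R n]_p (f (row_cons p)))%E.
  exact: (@ge0_integral_pushforward _ _ _ _ R _ (@measurable_row_cons R n)).
rewrite fubini_tonelli2//=.
exact: measurableT_comp mf (@measurable_row_cons R n).
Qed.

End leb_theory.

(** * Polynomials *)

Section poly_on_lines.
Context {R : realType}.

(** The points [e / (i + 2)] lie strictly inside the interval, and [size q] of them are more roots
    than a nonzero [q] can have. *)
Lemma poly_eq0_interval (q : {poly R}) (e : R) : 0 < e ->
  (forall s, 0 < s < e -> q.[s] = 0) -> q = 0.
Proof.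
move=> e0 h; apply/eqP; apply: contraT => q0.
pose f (i : nat) : R := e / i.+2%:R.
have f_inj : injective f.
  move=> i j /(mulfI (lt0r_neq0 e0))/invr_inj/eqP.
  by rewrite eqr_nat => /eqP[].
have := max_poly_roots (rs := map f (iota 0 (size q))) q0.
rewrite size_map size_iota ltnn map_inj_uniq// iota_uniq => -> //.
apply/allP => _ /mapP[i _ ->]; rewrite /root h//; apply/andP; split.
  by rewrite divr_gt0.
by rewrite ltr_pdivrMr// ltr_pMr// ltr1n.
Qed.

Lemma deriv_eq0_const (q : {poly R}) : q^`() = 0 -> forall s, q.[s] = q.[0].
Proof.
move=> q0; rewrite (_ : q = (q`_0)%:P); first by move=> s; rewrite !hornerC.
apply/polyP => -[|i]; rewrite coefC//=.
have := coef_deriv q i; rewrite q0 coef0 => /esym/eqP.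
by rewrite mulrn_eq0/= => /eqP.
Qed.

Lemma derive_on_line (V : normedModType R) (p : V -> R) (x v : V) (q : {poly R}) :
  (forall t, p (x + t *: v) = q.[t]) -> forall s,
  derivable p (x + s *: v) v /\ 'D_v p (x + s *: v) = q^`().[s].
Proof.
move=> pq s.
have E : (fun h : R => h^-1 *: ((p \o shift (x + s *: v)) (h *: v) - p (x + s *: v)))
  = (fun h : R => h^-1 *: (((horner q) \o shift s) (h *: 1) - (horner q) s)).
  apply/funext => h; rewrite /= pq (_ : h *: v + (x + s *: v) = x + (h + s) *: v).
    by rewrite pq /GRing.scale/= mulr1.
  by rewrite scalerDl addrCA.
have [dq dqE] := is_derive_poly q s.
by rewrite /derivable /derive E; split => //; rewrite -dqE.
Qed.

Context {n : nat}.
Notation d := n.+1.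
Implicit Types p : 'rV[R]_d -> R.

Lemma polynomial_fun_line k p : polynomial_fun k p ->
  forall x y, exists q : {poly R}, forall t, p (x + t *: y) = q.[t].
Proof.
move=> [c pE] x y.
exists (\sum_(e : {ffun 'I_d -> 'I_k.+1} | (\sum_b e b <= k)%N)
   c e *: \prod_b ((x ord0 b)%:P + y ord0 b *: 'X) ^+ e b) => t.
rewrite pE horner_sum; apply: eq_bigr => e _.
rewrite hornerZ horner_prod; congr (_ * _); apply: eq_bigr => b _.
by rewrite horner_exp !hornerE !mxE mulrC.
Qed.

Lemma polynomial_fun_lin k p1 p2 c : polynomial_fun k p1 -> polynomial_fun k p2 ->
  polynomial_fun k (fun x => c * p1 x + p2 x).
Proof.
move=> [c1 h1] [c2 h2]; exists (fun e => c * c1 e + c2 e) => x.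
rewrite h1 h2 mulr_sumr -big_split/=; apply: eq_bigr => e _.
by rewrite mulrDl mulrA.
Qed.

Lemma Cn1_cst (c : R) : @Cn R d 1 (fun _ => c).
Proof.
split; first exact: cst_continuous.
move=> b; split => /= [x|]; first exact: derivable_cst.
under eq_fun do rewrite derive_cst.
exact: cst_continuous.
Qed.

Lemma derive_coord (i : 'I_d) (x v : 'rV[R]_d) :
  is_derive x v (fun x : 'rV[R]_d => x ord0 i) (v ord0 i).
Proof.
have : (fun h : R => h^-1 *: (((fun x : 'rV[R]_d => x ord0 i) \o shift x) (h *: v)
   - x ord0 i)) @ 0^' --> v ord0 i.
  apply: (@cvg_trans _ ((fun=> v ord0 i) @ 0^')); last exact: cvg_cst.
  apply: near_eq_cvg; near=> h; rewrite /= !mxE addrK.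
  by rewrite /GRing.scale/= mulrA mulVf ?mul1r//; near: h; exact: nbhs_dnbhs_neq.
move=> hl; split; first by apply/cvg_ex; exists (v ord0 i).
exact: cvg_lim.
Unshelve. all: by end_near. Qed.

Lemma continuous_coord (i : 'I_d) : continuous (fun x : 'rV[R]_d => x ord0 i).
Proof. by move=> x; exact: coord_continuous. Qed.

Lemma Cn1_coord (i : 'I_d) : @Cn R d 1 (fun x => x ord0 i).
Proof.
split; first exact: continuous_coord.
move=> b; split => /= [x|]; first by have [] := derive_coord i x (unit_row R b).
under eq_fun do rewrite (@derive_val _ _ _ _ _ _ _ (derive_coord i _ (unit_row R b))).
exact: cst_continuous.
Qed.

Lemma Cn1_add p1 p2 : Cn 1 p1 -> Cn 1 p2 -> Cn 1 (fun x => p1 x + p2 x).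
Proof.
move=> [c1 h1] [c2 h2]; split; first by move=> x; exact: (cvgD (c1 x) (c2 x)).
move=> b; have [d1 e1] := h1 b; have [d2 e2] := h2 b; split => [x|].
  exact: derivableD (d1 x) (d2 x).
move=> /=; under eq_fun do rewrite (deriveD (d1 _) (d2 _)).
by move=> x; exact: (cvgD (e1 x) (e2 x)).
Qed.

Lemma Cn1_mul p1 p2 : Cn 1 p1 -> Cn 1 p2 -> Cn 1 (fun x => p1 x * p2 x).
Proof.
move=> [c1 h1] [c2 h2]; split; first by move=> x; exact: (cvgM (c1 x) (c2 x)).
move=> b; have [d1 e1] := h1 b; have [d2 e2] := h2 b; split => [x|].
  exact: derivableM (d1 x) (d2 x).
move=> /=; under eq_fun do rewrite (deriveM (d1 _) (d2 _)).
by move=> x; exact: (cvgD (cvgM (c1 x) (e2 x)) (cvgM (c2 x) (e1 x))).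
Qed.

Lemma Cn1_sum I (r : seq I) (P : pred I) (F : I -> 'rV[R]_d -> R) :
  (forall i, P i -> Cn 1 (F i)) -> Cn 1 (fun x => \sum_(i <- r | P i) F i x).
Proof.
move=> h; elim: r => [|i r IH].
  by under eq_fun do rewrite big_nil; exact: Cn1_cst.
case: (boolP (P i)) => Pi; under eq_fun do rewrite big_cons ?Pi ?(negbTE Pi) //.
  exact: Cn1_add (h _ Pi) IH.
exact: IH.
Qed.

Lemma Cn1_prod I (r : seq I) (F : I -> 'rV[R]_d -> R) :
  (forall i, Cn 1 (F i)) -> Cn 1 (fun x => \prod_(i <- r) F i x).
Proof.
move=> h; elim: r => [|i r IH].
  by under eq_fun do rewrite big_nil; exact: Cn1_cst.
under eq_fun do rewrite big_cons; exact: Cn1_mul (h _) IH.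
Qed.

Lemma Cn1_exp p e : Cn 1 p -> Cn 1 (fun x => p x ^+ e).
Proof.
move=> h; elim: e => [|e IH]; first by under eq_fun do rewrite expr0; exact: Cn1_cst.
by under eq_fun do rewrite exprS; exact: Cn1_mul.
Qed.

Lemma polynomial_fun_Cn1 k p : polynomial_fun k p -> Cn 1 p.
Proof.
move=> [c /funext->]; apply: Cn1_sum => e _; apply: Cn1_mul; first exact: Cn1_cst.
by apply: Cn1_prod => b; apply: Cn1_exp; exact: Cn1_coord.
Qed.

(** In a cube contained in [U], [p] does not change when a single coordinate moves, so it is
    constant there. Along any line through the centre [x0] it is then a polynomial that is constant
    on an interval, which settles all points, also outside [U]. *)
Lemma polynomial_fun_const k p (U : set 'rV[R]_d) : polynomial_fun k p ->
  open U -> U !=set0 ->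
  (forall b x, U x -> 'D_(unit_row R b) p x = 0) -> exists c, forall x, p x = c.
Proof.
move=> pp oU [x0 Ux0] h.
have /nbhs_ballP[e /= e0] : nbhs x0 U by exact: open_nbhs_nbhs.
rewrite ballE_cube// => eU.
have step (b : 'I_d) x : cube x0 e x -> forall t, p (x + t *: unit_row R b) = p x.
  move=> cx t; have [q qE] := polynomial_fun_line pp x (unit_row R b).
  have xb : `|x0 ord0 b - x ord0 b| < e by exact: cx.
  rewrite -[in RHS](addr0 x) -[in RHS](scale0r (unit_row R b)) !qE.
  apply: deriv_eq0_const; apply: (@poly_eq0_interval _ (e - `|x0 ord0 b - x ord0 b|)).
    by rewrite subr_gt0.
  move=> s /andP[s0 se].
  have [_ <-] := derive_on_line qE s; apply: h; apply: eU => i.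
  rewrite !mxE eqxx/=; case: eqVneq => [->|_]; last by rewrite mulr0 addr0; exact: cx.
  rewrite mulr1 opprD addrA (le_lt_trans (ler_normB _ _))//.
  by rewrite (gtr0_norm s0) -ltrBrDl.
have pc y : cube x0 e y -> p y = p x0.
  (* The points from [g 0 = x0] to [g d = y] change one coordinate at a time and stay in the
     cube. *)
  move=> cy; pose g (k : nat) := \row_j (if (j < k)%N then y ord0 j else x0 ord0 j).
  have cg j : cube x0 e (g j).
    by move=> i; rewrite mxE; case: ifPn => _; [exact: cy|rewrite subrr normr0].
  have gE j : (j <= d)%N -> p (g j) = p x0.
    elim: j => [|k' IH] kd; first by congr p; apply/rowP => i; rewrite mxE.
    rewrite -IH ?(ltnW kd)//.
    rewrite -(step (Ordinal kd) (g k') (cg k') (y ord0 (Ordinal kd) - x0 ord0 (Ordinal kd))).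
    congr p; apply/rowP => i; rewrite !mxE eqxx/= ltnS leq_eqVlt -val_eqE/=.
    case: (ltngtP i k') => [ik|ik|ik]/=; rewrite ?mulr0 ?addr0// mulr1.
    have -> : i = Ordinal kd by exact: val_inj.
    by rewrite addrC subrK.
  rewrite -(gE d)//; congr p; apply/rowP => i; rewrite mxE; by rewrite ltn_ord.
exists (p x0) => y; have [q qE] := polynomial_fun_line pp x0 (y - x0).
have -> : p y = q.[1] by rewrite -qE scale1r addrC subrK.
suff : q - (p x0)%:P = 0 by move=> /eqP; rewrite subr_eq0 => /eqP ->; rewrite hornerC.
have yn := normr_ge0 (y - x0).
have y0 : 0 < `|y - x0| + 1 by rewrite ltr_wpDl.
apply: (@poly_eq0_interval _ (e / (`|y - x0| + 1))); first by rewrite divr_gt0.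
move=> s /andP[s0 se]; rewrite !hornerE -qE pc ?subrr// => i.
rewrite [X in `|_ - X|]mxE opprD addrA subrr add0r normrN mxE normrM (gtr0_norm s0).
have := coord_le_norm (y - x0) i => yi.
rewrite ltr_pdivlMr// in se; rewrite (le_lt_trans _ se)// ler_wpM2l ?(ltW s0)//.
by rewrite (le_trans yi)// lerDl.
Qed.

Lemma continuous_bounded_on (f : 'rV[R]_d -> R) (A : set 'rV[R]_d) :
  continuous f -> bounded_set A -> exists M, forall x, A x -> `|f x| <= M.
Proof.
move=> cf [M [Mr hM]].
pose K := [set v : 'rV[R]_d | forall i, v ord0 i \in `[- (M + 1), M + 1]].
have cK : compact K.
  apply: (@rV_compact _  _ (fun=> `[- (M + 1), M + 1]%classic)).
  by move=> _; exact: segment_compact.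
have cfK : compact (f @` K).
  by apply: continuous_compact => //; exact: continuous_subspaceT.
have [B [Br hB]] := compact_bounded cfK.
exists (B + 1) => x Ax; apply: (hB (B + 1)); first by rewrite ltrDl.
exists x => // i; rewrite in_itv/= -ler_norml (le_trans (coord_le_norm _ _))//.
by apply: (hM (M + 1)) => //; rewrite ltrDl.
Qed.

End poly_on_lines.

(** * Frobenius inner product *)

Section frobenius.
Context {R : realType} {m d : nat}.
Implicit Types A B C : 'M[R]_(m, d).

Lemma mxdotC A B : mxdot A B = mxdot B A.
Proof. by apply: eq_bigr => a _; apply: eq_bigr => b _; rewrite mulrC. Qed.

Lemma mxdotDr A B C : mxdot A (B + C) = mxdot A B + mxdot A C.
Proof.
rewrite /mxdot -big_split/=; apply: eq_bigr => a _.
by rewrite -big_split/=; apply: eq_bigr => b _; rewrite mxE mulrDr.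
Qed.

Lemma mxdotZr A B c : mxdot A (c *: B) = c * mxdot A B.
Proof.
rewrite /mxdot mulr_sumr; apply: eq_bigr => a _.
by rewrite mulr_sumr; apply: eq_bigr => b _; rewrite mxE mulrCA.
Qed.

Lemma mxdotDl A B C : mxdot (A + B) C = mxdot A C + mxdot B C.
Proof. by rewrite !(mxdotC _ C) mxdotDr. Qed.

Lemma mxdotZl A B c : mxdot (c *: A) B = c * mxdot A B.
Proof. by rewrite !(mxdotC _ B) mxdotZr. Qed.

Lemma mxdotNr A B : mxdot A (- B) = - mxdot A B.
Proof. by rewrite -scaleN1r mxdotZr mulN1r. Qed.

Lemma mxdotNl A B : mxdot (- A) B = - mxdot A B.
Proof. by rewrite mxdotC mxdotNr mxdotC. Qed.

Lemma mxdot0r A : mxdot A 0 = 0.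
Proof. by rewrite -(scale0r A) mxdotZr mul0r. Qed.

Lemma mxdot_sumr A I (r : seq I) (F : I -> 'M[R]_(m, d)) :
  mxdot A (\sum_(i <- r) F i) = \sum_(i <- r) mxdot A (F i).
Proof.
elim: r => [|i r IH]; first by rewrite !big_nil mxdot0r.
by rewrite !big_cons mxdotDr IH.
Qed.

Lemma mxdot_ge0 A : 0 <= mxdot A A.
Proof. by apply: sumr_ge0 => a _; apply: sumr_ge0 => b _; exact: sqr_ge0. Qed.

Lemma frob_ge0 A : 0 <= frob A.
Proof. exact: sqrtr_ge0. Qed.

Lemma frob_sqr A : frob A ^+ 2 = mxdot A A.
Proof. by rewrite sqr_sqrtr// mxdot_ge0. Qed.

Lemma coord_le_frob A a b : `|A a b| <= frob A.
Proof.
rewrite -(@ler_pXn2r _ 2)// ?nnegrE ?frob_ge0// frob_sqr real_normK ?num_real//.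
rewrite /mxdot (bigD1 a)//= (bigD1 b)//= -addrA lerDl addr_ge0//.
  by apply: sumr_ge0 => j _; exact: sqr_ge0.
by apply: sumr_ge0 => i _; apply: sumr_ge0 => j _; exact: sqr_ge0.
Qed.

Lemma frob_eq0 A : frob A = 0 -> A = 0.
Proof.
move=> A0; apply/matrixP => a b; rewrite mxE; apply/eqP.
by rewrite -normr_eq0 eq_le normr_ge0 andbT -A0 coord_le_frob.
Qed.

Lemma frob0 : frob (0 : 'M[R]_(m, d)) = 0.
Proof. by rewrite /frob mxdot0r sqrtr0. Qed.

Lemma frobZ c A : frob (c *: A) = `|c| * frob A.
Proof.
by rewrite /frob mxdotZl mxdotZr mulrA -expr2 sqrtrM ?sqr_ge0// sqrtr_sqr.
Qed.

Lemma frobN A : frob (- A) = frob A.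
Proof. by rewrite -scaleN1r frobZ normrN1 mul1r. Qed.

Lemma mxdot_sub_sqr A B : mxdot (A - B) (A - B) = mxdot A A - 2 * mxdot A B + mxdot B B.
Proof.
by rewrite mxdotDl !mxdotDr !mxdotNl !mxdotNr (mxdotC B A); ring.
Qed.

(** Cauchy-Schwarz, from the nonnegative square of [frob B *: A - frob A *: B]; in the equality case
    of [mxdot_eq_frob] this square vanishes. *)
Lemma mxdot_le_frob A B : mxdot A B <= frob A * frob B.
Proof.
have [->|A0] := eqVneq A 0; first by rewrite mxdotC mxdot0r frob0 mul0r.
have [->|B0] := eqVneq B 0; first by rewrite mxdot0r frob0 mulr0.
have a0 : 0 < frob A by rewrite lt_def frob_ge0 andbT; apply: contraNneq A0 => /frob_eq0->.
have b0 : 0 < frob B by rewrite lt_def frob_ge0 andbT; apply: contraNneq B0 => /frob_eq0->.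
have := mxdot_ge0 (frob B *: A - frob A *: B).
rewrite mxdot_sub_sqr !mxdotZl !mxdotZr -!frob_sqr => h.
rewrite -(ler_pM2l (mulr_gt0 a0 b0)).
move: h; set a := frob A; set b := frob B; set c := mxdot A B => h.
have E : b * (b * a ^+ 2) - 2 * (b * (a * c)) + a * (a * b ^+ 2)
   = 2 * (a * b * (a * b) - a * b * c) by ring.
by rewrite E pmulr_rge0// subr_ge0 in h.
Qed.

Lemma normr_mxdot_le A B : `|mxdot A B| <= frob A * frob B.
Proof.
rewrite ler_norml mxdot_le_frob andbT lerNl -mxdotNr.
by rewrite (le_trans (mxdot_le_frob _ _))// frobN.
Qed.

Lemma mxdot_eq_frob A B : mxdot A B = frob A * frob B ->
  frob B *: A = frob A *: B.
Proof.
move=> E; apply/eqP; rewrite -subr_eq0; apply/eqP/frob_eq0.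
apply/eqP; rewrite -sqrf_eq0 frob_sqr mxdot_sub_sqr !mxdotZl !mxdotZr -!frob_sqr E.
by apply/eqP; ring.
Qed.

Lemma frobD A B : frob (A + B) <= frob A + frob B.
Proof.
rewrite -(@ler_pXn2r _ 2)// ?nnegrE ?addr_ge0 ?frob_ge0// frob_sqr.
rewrite !mxdotDl !mxdotDr (mxdotC B A) sqrrD !frob_sqr mulr2n.
have := mxdot_le_frob A B; lra.
Qed.

Lemma frob_sum I (r : seq I) (F : I -> 'M[R]_(m, d)) :
  frob (\sum_(i <- r) F i) <= \sum_(i <- r) frob (F i).
Proof.
elim: r => [|i r IH]; first by rewrite !big_nil frob0.
by rewrite !big_cons (le_trans (frobD _ _))// lerD2l.
Qed.

Lemma frob_dist A B : `|frob A - frob B| <= frob (A - B).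
Proof.
rewrite ler_norml; apply/andP; split.
  have := frobD (B - A) A; rewrite subrK -(frobN (B - A)) opprB; lra.
by have := frobD (A - B) B; rewrite subrK; lra.
Qed.

Lemma frob_le_sum A : frob A <= \sum_a \sum_b `|A a b|.
Proof.
rewrite [X in frob X]matrix_sum_delta (le_trans (frob_sum _ _))//.
apply: ler_sum => a _; rewrite (le_trans (frob_sum _ _))//; apply: ler_sum => b _.
rewrite frobZ ler_piMr// /frob /mxdot (bigD1 a)//= (bigD1 b)//= !mxE !eqxx mulr1.
rewrite !big1 ?addr0 ?sqrtr1// => [i /negPf ia|i /negPf ib].
  by rewrite big1// => j _; rewrite mxE ia mul0r.
by rewrite mxE ib andbF mul0r.
Qed.

End frobenius.

Lemma mxdot_row {R : realType} d (u v : 'rV[R]_d) :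
  mxdot u v = \sum_j u ord0 j * v ord0 j.
Proof. by rewrite /mxdot big_ord1. Qed.

(** * N-functions and their conjugates *)

Section nfunction_theory.
Context {R : realType} (phi dphi : R -> R) (H : nfunction phi dphi).
Let mu := @lebesgue_measure R.

(** [phi r - phi t] is the integral of the nondecreasing [dphi] over []t, r]], bounded by the length
    of the interval times the values at its ends. *)
Lemma nfun_incr (t r : R) : 0 <= t -> t <= r ->
  dphi t * (r - t) <= phi r - phi t <= dphi r * (r - t).
Proof.
move=> t0 tr; have r0 := le_trans t0 tr.
(* [dphi] is controlled only on nonnegative arguments; freezing it at [dphi 0] on the negative axis
   gives a monotone, hence measurable, function on the line. *)
pose g (s : R) := dphi (Num.max 0 s).
have gnd : nondecreasing_fun g.
  move=> x y xy; apply: (nfun_dhomo H); first by rewrite le_max lexx.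
  by rewrite ge_max le_max lexx/= le_max xy orbT.
have mg D : measurable D -> measurable_fun D (fun s => (g s)%:E).
  by move=> mD; apply/measurable_EFinP; exact: nondecreasing_measurable.
have g0 s : (0 <= (g s)%:E)%E.
  by rewrite lee_fin; apply: (nfun_dge0 H); rewrite le_max lexx.
have phiE (s : R) : 0 <= s -> (phi s)%:E = (\int[mu]_(x in `[0%R, s]) (g x)%:E)%E.
  move=> s0; rewrite (nfun_int H s0); apply: eq_integral => x; rewrite inE/= in_itv/=.
  by move=> /andP[x0 _]; rewrite /g max_r.
have : (phi r)%:E = ((phi t)%:E + \int[mu]_(x in `]t, r]) (g x)%:E)%E.
  rewrite !phiE// (@itv_bndbnd_setU _ _ _ (BRight t))//.
  rewrite ge0_integral_setU//; first by apply: mg; exact: measurableU.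
  apply/disj_setPS => x [/=]; rewrite !in_itv/= => /andP[_ h1] /andP[h2 _].
  by move: (lt_le_trans h2 h1); rewrite ltxx.
have mtr : mu `]t, r] = (r - t)%:E.
  rewrite /mu lebesgue_measure_itv/= lte_fin; case: ltP => // rt.
  by rewrite (_ : r = t) ?subrr//; apply/eqP; rewrite eq_le rt tr.
have lo : ((dphi t * (r - t))%:E <= \int[mu]_(x in `]t, r]) (g x)%:E)%E.
  rewrite EFinM -mtr -integral_cst//; apply: ge0_le_integral => //.
  - by move=> x _; rewrite lee_fin; exact: (nfun_dge0 H).
  - exact: mg.
  - move=> x /=; rewrite in_itv/= => /andP[tx _]; rewrite lee_fin.
    by apply: (nfun_dhomo H) => //; rewrite le_max (ltW tx) orbT.
have up : (\int[mu]_(x in `]t, r]) (g x)%:E <= (dphi r * (r - t))%:E)%E.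
  rewrite EFinM -mtr -integral_cst//; apply: ge0_le_integral => //.
  - exact: mg.
  - move=> x /=; rewrite in_itv/= => /andP[tx xr]; rewrite lee_fin.
    by apply: (nfun_dhomo H); rewrite ?le_max ?lexx// ge_max r0 xr.
move: lo up; case: (\int[mu]_(x in _) _)%E => [z| |]//.
rewrite !lee_fin -EFinD => lo up [->]; rewrite addrAC subrr add0r; exact/andP.
Qed.

Lemma nfun_line (t r : R) : 0 <= t -> 0 <= r -> phi t + dphi t * (r - t) <= phi r.
Proof.
move=> t0 r0; have [tr|/ltW rt] := leP t r.
  by have /andP[h _] := nfun_incr t0 tr; lra.
have /andP[_ h] := nfun_incr r0 rt.
have E : dphi t * (r - t) = - (dphi t * (t - r)) by ring.
rewrite E; lra.
Qed.

Lemma nfun_0 : phi 0 = 0.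
Proof.
have := nfun_int H (lexx 0); rewrite set_itv1 integral_set1 => -[].
by [].
Qed.

Lemma nfun_homo (t r : R) : 0 <= t -> t <= r -> phi t <= phi r.
Proof.
move=> t0 tr; have /andP[h _] := nfun_incr t0 tr.
rewrite -subr_ge0 (le_trans _ h)// mulr_ge0 ?subr_ge0//; exact: (nfun_dge0 H).
Qed.

Lemma nfun_lip (t r M : R) : 0 <= t <= M -> 0 <= r <= M ->
  `|phi t - phi r| <= dphi M * `|t - r|.
Proof.
wlog tr : t r / t <= r.
  move=> h tM rM; have [tr|/ltW rt] := leP t r; first exact: h.
  by rewrite distrC (distrC t); exact: h.
move=> /andP[t0 tM] /andP[r0 rM]; rewrite distrC (distrC t) !ger0_norm ?subr_ge0//.
  have /andP[_ h] := nfun_incr t0 tr; rewrite (le_trans h)//.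
  by rewrite ler_wpM2r ?subr_ge0//; exact: (nfun_dhomo H).
exact: nfun_homo.
Qed.

Definition cj (r : R) : R := fine (conjugate phi r).

(** As [dphi] tends to infinity, some slope [dphi t0] is at least [r]; the supporting line of [phi]
    at [t0] then bounds [r * s - phi s] uniformly in [s]. So [cj] is faithful on nonnegative
    arguments. *)
Lemma conjugate_EFin (r : R) : 0 <= r -> conjugate phi r = (cj r)%:E.
Proof.
move=> r0; rewrite /cj fineK//.
have [t0 [t0ge ht0]] : exists t, 0 <= t /\ r <= dphi t.
  have /cvgryPge/(_ r) [M [_ hM]] := nfun_dlim H.
  exists (Num.max 0 (M + 1)); rewrite le_max lexx; split => //.
  by apply: hM; rewrite lt_max ltrDl ltr01 orbT.
rewrite fin_numElt; apply/andP; split.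
  apply: (@lt_le_trans _ _ 0%E); first by rewrite ltNyr.
  apply: ereal_sup_ubound; exists 0 => //=.
  by rewrite mulr0 nfun_0 subrr.
apply: (@le_lt_trans _ _ (dphi t0 * t0)%:E); last by rewrite ltry.
apply: ge_ereal_sup => _ [s /= s0 <-]; rewrite lee_fin.
have := nfun_line t0ge s0; have : r * s <= dphi t0 * s by rewrite ler_wpM2r.
have := nfun_ge0 H t0ge; rewrite mulrBr; lra.
Qed.

Lemma young (r s : R) : 0 <= r -> 0 <= s -> r * s <= phi s + cj r.
Proof.
move=> r0 s0; have : ((r * s - phi s)%:E <= conjugate phi r)%E.
  by apply: ereal_sup_ubound; exists s.
by rewrite conjugate_EFin// lee_fin; lra.
Qed.

Lemma cj_le (r c : R) : 0 <= r -> (forall s, 0 <= s -> r * s - phi s <= c) -> cj r <= c.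
Proof.
move=> r0 h; rewrite -lee_fin -conjugate_EFin//.
by apply: ge_ereal_sup => _ [s /= s0 <-]; rewrite lee_fin; exact: h.
Qed.

Lemma cj_ge0 (r : R) : 0 <= r -> 0 <= cj r.
Proof. by move=> r0; have := young r0 (lexx 0); rewrite mulr0 nfun_0 add0r. Qed.

Lemma cj_homo (r q : R) : 0 <= r -> r <= q -> cj r <= cj q.
Proof.
move=> r0 rq; apply: cj_le => // s s0.
have := young (le_trans r0 rq) s0; have : r * s <= q * s by rewrite ler_wpM2r.
lra.
Qed.

(** * Consequences of equality in Young's inequality *)

Section young_equality.
Variables (a s : R) (a0 : 0 <= a) (s0 : 0 <= s) (E : phi a + cj s <= s * a).

Lemma young_eq_subgradient : subgradient (EFin \o phi) a s.
Proof.
move=> r r0; rewrite /= lee_fin; have := young s0 r0; have := E.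
by rewrite mulrBr; lra.
Qed.

Lemma young_eq_subgradient_cj : subgradient (conjugate phi) s a.
Proof.
move=> r r0; rewrite !conjugate_EFin// lee_fin; have := young r0 a0; have := E.
rewrite mulrBr (mulrC a r) (mulrC a s); lra.
Qed.

(** Otherwise right continuity gives [dphi r < s] just above [a], where the subgradient inequality
    forces [s <= dphi r]. Together with [young_eq_dphi_le], this places [s] between the left limit
    of [dphi] at [a] and [dphi a]. *)
Lemma young_eq_le_dphi : s <= dphi a.
Proof.
rewrite leNgt; apply/negP => /(cvgr_lt _ (nfun_drcont H a0)) lts.
near a^'+ => r.
have : dphi r < s by near: r.
apply/negP; rewrite -leNgt. have ar : a < r by near: r; exact: nbhs_right_gt.
have r0 : 0 <= r by rewrite (le_trans a0)// ltW.
have := young_eq_subgradient r0; rewrite /= lee_fin => h.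
have /andP[_ h2] := nfun_incr a0 (ltW ar).
by rewrite -(ler_pM2r (_ : 0 < r - a)) ?subr_gt0//; lra.
Unshelve. all: by end_near. Qed.

Lemma young_eq_dphi_le (r : R) : 0 <= r -> r < a -> dphi r <= s.
Proof.
move=> r0 ra.
have := young_eq_subgradient r0; rewrite /= lee_fin => h.
have /andP[h2 _] := nfun_incr r0 (ltW ra).
rewrite -(ler_pM2r (_ : 0 < a - r)) ?subr_gt0//.
have : s * (r - a) = - (s * (a - r)) by ring.
lra.
Qed.

(** With [young_eq_0r]: [a] and [s] vanish together, which is what reading the quotients as 0 at 0
    requires. *)
Lemma young_eq_0l : a = 0 -> s = 0.
Proof.
by move=> az; apply/eqP; rewrite eq_le s0 andbT -(nfun_d0 H) -az young_eq_le_dphi.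
Qed.

Lemma young_eq_0r : s = 0 -> a = 0.
Proof.
move=> sz; apply/eqP; rewrite eq_le a0 andbT leNgt; apply/negP => ap.
have a2 : 0 < a / 2 by rewrite divr_gt0.
have := young_eq_dphi_le (ltW a2) ltac:(lra); rewrite sz leNgt.
by rewrite (nfun_dgt0 H).
Qed.

Lemma young_eq_dphi : leftcont dphi a -> s = dphi a.
Proof.
move=> lc; have [az|az] := eqVneq a 0.
  by rewrite young_eq_0l// az (nfun_d0 H).
have ap : 0 < a by rewrite lt_def az.
apply/eqP; rewrite eq_le young_eq_le_dphi/=.
rewrite leNgt; apply/negP => /(cvgr_gt _ (lc ap)) lts.
near a^'- => r.
have : s < dphi r by near: r.
apply/negP; rewrite -leNgt; apply: young_eq_dphi_le; near: r; last exact: nbhs_left_lt.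
exact: nbhs_left_ge.
Unshelve. all: by end_near. Qed.

(** Every nonnegative [r < a] has [dphi r <= s], so the supremum is at least [a]. Conversely
    [dphi r <= q < s <= dphi a] forces [r <= a], so [dconjugate dphi q <= a] for [q < s], and left
    continuity carries this bound to [s]. *)
Lemma young_eq_dconjugate : leftcont (dconjugate dphi) s -> a = dconjugate dphi s.
Proof.
move=> lc.
have ub (q r : R) : 0 <= r -> dphi r <= q -> q < s -> r <= a.
  move=> r0 rq qs; rewrite leNgt; apply/negP => ar.
  have := young_eq_le_dphi; have := nfun_dhomo H a0 (ltW ar); lra.
have hs : has_sup [set r | 0 <= r /\ dphi r <= s].
  split; first by exists 0; rewrite /= (nfun_d0 H).
  have /cvgryPge/(_ (s + 1)) [M [_ hM]] := nfun_dlim H.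
  exists (Num.max 0 (M + 1)) => r [r0 rs]; rewrite leNgt; apply/negP => Mr.
  have : M < r by rewrite (le_lt_trans _ Mr)// le_max lerDl ler01 orbT.
  by move=> /hM/=; lra.
have le_sup : a <= dconjugate dphi s.
  rewrite leNgt; apply/negP => ha.
  have d0 : 0 <= dconjugate dphi s.
    by apply: ub_le_sup; [case: hs|rewrite /= (nfun_d0 H)].
  pose r := (dconjugate dphi s + a) / 2.
  have rin : r <= dconjugate dphi s.
    apply: ub_le_sup; first by case: hs.
    split; first by rewrite /r; lra.
    by apply: young_eq_dphi_le; rewrite /r; lra.
  by move: rin; rewrite /r; lra.
(* At [s = 0] left continuity says nothing; there the positivity of [dphi] on positive arguments
   confines the set under the supremum to 0. *)
have [sz|sz] := eqVneq s 0.
  apply/eqP; rewrite eq_le le_sup/= young_eq_0r//.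
  apply: ge_sup; first by exists 0; rewrite /= (nfun_d0 H).
  move=> r [r0]; rewrite sz => dr; rewrite leNgt; apply/negP => rp.
  by have := nfun_dgt0 H rp; rewrite ltNge dr.
have sp : 0 < s by rewrite lt_def sz.
apply/eqP; rewrite eq_le le_sup/=.
rewrite leNgt; apply/negP => /(cvgr_gt _ (lc sp)) lta.
near s^'- => q.
have : a < dconjugate dphi q by near: q.
apply/negP; rewrite -leNgt; have qs : q < s by near: q; exact: nbhs_left_lt.
have q0 : 0 <= q by near: q; exact: nbhs_left_ge.
apply: ge_sup; first by exists 0; rewrite /= (nfun_d0 H).
by move=> r [r0 rq]; exact: ub r0 rq qs.
Unshelve. all: by end_near. Qed.

End young_equality.

Section measurability.
Context d (T : measurableType d) (D : set T) (g : T -> R).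
Hypotheses (mg : measurable_fun D g) (g0 : forall x, 0 <= g x).

Lemma measurable_nondecreasing_comp (h : R -> R) :
  (forall t r : R, 0 <= t -> t <= r -> h t <= h r) -> measurable_fun D (h \o g).
Proof.
move=> hh; rewrite (_ : h \o g = (fun x => h (Num.max 0 x)) \o g).
  apply: measurableT_comp => //; apply: nondecreasing_measurable => //.
  move=> x y xy; apply: hh; first by rewrite le_max lexx.
  by rewrite ge_max le_max lexx/= le_max xy orbT.
by apply/funext => x /=; rewrite max_r.
Qed.

End measurability.
End nfunction_theory.

(** * Minimizers of the discrete energy and their stresses *)

(* An approximate nearest point to 0 already separates, so C need not be closed. *)
Lemma convex_separation0 {R : realType} N (C : set 'rV[R]_N) (M eta : R) :
  C !=set0 -> (forall c, C c -> frob c <= M) ->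
  (forall c c' (t : R), C c -> C c' -> 0 <= t <= 1 -> C (c + t *: (c' - c))) ->
  0 < eta -> (forall c, C c -> eta <= mxdot c c) ->
  exists (w : 'rV[R]_N) (e : R), 0 < e /\ forall c, C c -> mxdot w c <= - e.
Proof.
move=> [c1 Cc1] CM Ccvx eta0 Ceta.
pose S := [set mxdot c c | c in C].
have S0 : S !=set0 by exists (mxdot c1 c1), c1.
have Slb : lbound S eta by move=> _ [c Cc <-]; exact: Ceta.
have hS : has_inf S by split => //; exists eta.
pose dl := inf S.
have dl0 : 0 < dl by rewrite (lt_le_trans eta0)//; exact: lb_le_inf.
pose Y := (M + M) ^+ 2.
have Y0 : 0 <= Y by exact: sqr_ge0.
pose t := Num.min 1 (dl / (2 * (Y + 1))).
have Yp : 0 < 2 * (Y + 1) by rewrite mulr_gt0// ltr_wpDl.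
have t0 : 0 < t by rewrite lt_min ltr01 divr_gt0.
have t1 : t <= 1 by rewrite ge_min lexx.
have tY : t * Y <= dl / 2.
  have : t * (2 * (Y + 1)) <= dl by rewrite -ler_pdivlMr// ge_min lexx orbT.
  have := ltW t0; lra.
(* The squared norm of [c0] exceeds the infimum [dl] by less than [t * dl / 2], and a move of
   relative length [t] towards [c] stays in [C], so it cannot go below [dl]. The quadratic term
   costs at most another [t * dl / 2]; dividing by [t] leaves [mxdot c0 c >= dl / 2]. *)
have [_ [c0 Cc0 <-]] := inf_adherent (mulr_gt0 t0 (divr_gt0 dl0 (ltr0n R 2))) hS.
rewrite -/dl => c0dl.
have dlc c : C c -> dl <= mxdot c c by move=> Cc; apply: ge_inf; [exists eta|exists c].
exists (- c0), (dl / 2); rewrite divr_gt0//; split => // c Cc.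
have := dlc _ (Ccvx _ _ t Cc0 Cc ltac:(by rewrite (ltW t0) t1)).
have cc0 : frob (c - c0) <= M + M.
  by rewrite (le_trans (frobD _ _))// frobN lerD// CM.
have cY : mxdot (c - c0) (c - c0) <= Y.
  rewrite -frob_sqr /Y ler_pXn2r// ?nnegrE ?frob_ge0//.
  by rewrite (le_trans _ cc0)// frob_ge0.
have -> : mxdot (c0 + t *: (c - c0)) (c0 + t *: (c - c0)) =
   mxdot c0 c0 + t * (2 * mxdot c0 (c - c0)) + t * (t * mxdot (c - c0) (c - c0)).
  move: (c - c0) => z.
  by rewrite mxdotDl !mxdotDr !mxdotZl !mxdotZr (mxdotC z c0); ring.
rewrite (mxdotC (- c0)) mxdotNr (mxdotC c c0) lerN2.
have -> : mxdot c0 (c - c0) = mxdot c0 c - mxdot c0 c0 by rewrite mxdotDr mxdotNr.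
have := dlc _ Cc0; move: c0dl cY tY.
move: (mxdot c0 c0) (mxdot (c - c0) (c - c0)) (mxdot c0 c) => a b x.
move=> h1 h2 h3 h4 h5.
have h6 : t * (t * b) <= t * (dl / 2).
  by rewrite ler_wpM2l ?(ltW t0)// (le_trans _ h3)// ler_wpM2l// ltW.
have h7 : 0 < t * (2 * (x - a)) + t * (dl / 2) + t * (dl / 2) by lra.
rewrite -!mulrDr pmulr_rgt0// in h7; lra.
Qed.

(** The sum of the series has integral at most [2 * C], hence is finite almost everywhere. This is
    how pointwise convergence is extracted from fast convergence in L^1. *)
Lemma ae_cvg_series_geometric {R : realType} d (T : measurableType d)
    (mu : {measure set T -> \bar R}) (D : set T) (g : nat -> T -> R) (C : R) :
  measurable D -> (forall i, measurable_fun D (g i)) ->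
  (forall i x, D x -> 0 <= g i x) ->
  (forall i, (\int[mu]_(x in D) (g i x)%:E <= (geometric C 2^-1 i)%:E)%E) ->
  {ae mu, forall x, D x -> cvgn (series (g ^~ x))}.
Proof.
move=> mD mg g0 gC.
pose G x := (\sum_(0 <= i <oo) (g i x)%:E)%E.
have mGi i : measurable_fun D (fun x => (g i x)%:E) by exact/measurable_EFinP.
have g0' n x : D x -> (0 <= (g n x)%:E)%E by move=> Dx; rewrite lee_fin g0.
have IG : (\int[mu]_(x in D) G x = \sum_(0 <= i <oo) \int[mu]_(x in D) (g i x)%:E)%E.
  by rewrite integral_nneseries.
have IGfin : (\int[mu]_(x in D) G x < +oo)%E.
  rewrite IG; apply: (@le_lt_trans _ _ (2 * C)%:E); last by rewrite ltry.
  apply: lime_le.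
    by apply: is_cvg_nneseries => i _ _; apply: integral_ge0 => x Dx; exact: g0'.
  apply: nearW => n; rewrite /=.
  have -> : 2 * C = \sum_(0 <= i < n) geometric C 2^-1 i + 2 * C * 2^-1 ^+ n.
    elim: n => [|n IH]; first by rewrite big_geq// expr0 add0r mulr1.
    by rewrite big_nat_recr//= {1}IH exprS; field.
  apply: (@le_trans _ _ (\sum_(0 <= i < n) (geometric C 2^-1 i)%:E)%E).
    by apply: lee_sum => i _.
  rewrite sumEFin lee_fin lerDl -mulrA mulr_ge0// mulr_ge0 ?exprn_ge0//.
  have := le_trans (integral_ge0 _ (fun x => @g0' 0%N x)) (gC 0%N).
  by rewrite /= lee_fin expr0 mulr1.
have G0 x : D x -> (0 <= G x)%E by move=> Dx; apply: nneseries_ge0 => i _ _; exact: g0'.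
have mG : measurable_fun D G by apply: ge0_emeasurable_sum => // i x Dx _; exact: g0'.
have iG : mu.-integrable D G.
  apply/integrableP; split => //.
  by rewrite (eq_integral G)// => x; rewrite inE => Dx; rewrite gee0_abs// G0.
apply: filterS (integrable_ae mD iG) => x /[swap] Dx /(_ Dx) Gx.
apply: nondecreasing_is_cvgn.
  by apply: nondecreasing_series => i _ _; exact: g0.
exists (fine (G x)) => _ [n _ <-]; rewrite -lee_fin fineK//.
rewrite /series/= -sumEFin; apply: nneseries_lim_ge => i _ _; exact: g0'.
Qed.

(** * Bounded measurable functions on a set of finite measure *)

Section bounded_measurable.
Context {R : realType} d (T : measurableType d) (mu : {measure set T -> \bar R}).
Context (D : set T) (mD : measurable D) (muD : (mu D < +oo)%E).

(** A class closed under sums and products whose members are all integrable, so that the rules for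
    real integrals below carry no separate integrability conditions. *)
Definition bm (g : T -> R) :=
  measurable_fun D g /\ exists M, forall x, D x -> `|g x| <= M.

Lemma bm_integrable g : bm g -> mu.-integrable D (EFin \o g).
Proof.
move=> [mg [M hM]]; apply: measurable_bounded_integrable => //.
exists M; split; first exact: num_real.
by move=> x Mx y /= Dy; rewrite (le_trans (hM _ Dy))// ltW.
Qed.

Lemma bm_cst c : bm (fun=> c).
Proof. by split => //; exists `|c|. Qed.

Lemma bmD g h : bm g -> bm h -> bm (fun x => g x + h x).
Proof.
move=> [mg [M hM]] [mh [K hK]]; split; first exact: measurable_funD.
by exists (M + K) => x Dx; rewrite (le_trans (ler_normD _ _))// lerD// ?hM ?hK.
Qed.

Lemma bmM g h : bm g -> bm h -> bm (fun x => g x * h x).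
Proof.
move=> [mg [M hM]] [mh [K hK]]; split; first exact: measurable_funM.
by exists (M * K) => x Dx; rewrite normrM ler_pM// ?hM ?hK.
Qed.

Lemma bmZ c g : bm g -> bm (fun x => c * g x).
Proof. by apply: bmM; exact: bm_cst. Qed.

Lemma bmB g h : bm g -> bm h -> bm (fun x => g x - h x).
Proof.
move=> bg bh; have := bmD bg (bmZ (-1) bh).
by under eq_fun do rewrite mulN1r.
Qed.

Lemma bm_sum I (r : seq I) (h : I -> T -> R) :
  (forall i, bm (h i)) -> bm (fun x => \sum_(i <- r) h i x).
Proof.
move=> bh; elim: r => [|i r IH].
  by under eq_fun do rewrite big_nil; exact: bm_cst.
by under eq_fun do rewrite big_cons; exact: bmD.
Qed.

Lemma bm_norm g : bm g -> bm (fun x => `|g x|).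
Proof.
move=> [mg [M hM]]; split; first exact: measurableT_comp.
by exists M => x Dx; rewrite normr_id hM.
Qed.

Lemma bm_RintegralD g h : bm g -> bm h ->
  \int[mu]_(x in D) (g x + h x) = \int[mu]_(x in D) g x + \int[mu]_(x in D) h x.
Proof. by move=> bg bh; rewrite RintegralD//; exact: bm_integrable. Qed.

Lemma bm_RintegralB g h : bm g -> bm h ->
  \int[mu]_(x in D) (g x - h x) = \int[mu]_(x in D) g x - \int[mu]_(x in D) h x.
Proof. by move=> bg bh; rewrite RintegralB//; exact: bm_integrable. Qed.

Lemma bm_RintegralZ c g : bm g ->
  \int[mu]_(x in D) (c * g x) = c * \int[mu]_(x in D) g x.
Proof. by move=> bg; rewrite RintegralZl//; exact: bm_integrable. Qed.

Lemma bm_Rintegral_sum I (r : seq I) (h : I -> T -> R) : (forall i, bm (h i)) ->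
  \int[mu]_(x in D) (\sum_(i <- r) h i x) = \sum_(i <- r) \int[mu]_(x in D) h i x.
Proof.
move=> bh; elim: r => [|i r IH].
  under eq_Rintegral do rewrite big_nil.
  by rewrite big_nil Rintegral_cst// mul0r.
under eq_Rintegral do rewrite big_cons.
by rewrite big_cons bm_RintegralD ?IH//; exact: bm_sum.
Qed.

Lemma bm_le_Rintegral g h : bm g -> bm h -> (forall x, D x -> g x <= h x) ->
  \int[mu]_(x in D) g x <= \int[mu]_(x in D) h x.
Proof. by move=> bg bh gh; apply: le_Rintegral => //; exact: bm_integrable. Qed.

Lemma bm_Rintegral_le_cst g c : bm g -> (forall x, D x -> g x <= c) ->
  \int[mu]_(x in D) g x <= c * fine (mu D).
Proof.
by move=> bg gc; rewrite -Rintegral_cst//; apply: bm_le_Rintegral => //; exact: bm_cst.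
Qed.

Lemma bm_normr_Rintegral_le g c : bm g -> (forall x, D x -> `|g x| <= c) ->
  `|\int[mu]_(x in D) g x| <= c * fine (mu D).
Proof.
move=> bg gc; rewrite (le_trans (le_normr_Rintegral _ _))//; first exact: bm_integrable.
by apply: bm_Rintegral_le_cst => //; exact: bm_norm.
Qed.

Lemma bm_Rintegral_dist g h c : bm g -> bm h ->
  (forall x, D x -> `|g x - h x| <= c) ->
  `|\int[mu]_(x in D) g x - \int[mu]_(x in D) h x| <= c * fine (mu D).
Proof.
move=> bg bh gh; rewrite -bm_RintegralB//; apply: bm_normr_Rintegral_le => //.
exact: bmB.
Qed.

Lemma EFin_bm_Rintegral g : bm g ->
  (\int[mu]_(x in D) g x)%:E = (\int[mu]_(x in D) (g x)%:E)%E.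
Proof.
move=> bg; rewrite /Rintegral fineK//.
by apply: integrable_fin_num => //; exact: bm_integrable.
Qed.

Lemma bm_Rintegral_eq0 g : bm g -> (forall x, D x -> 0 <= g x) ->
  \int[mu]_(x in D) g x = 0 -> {ae mu, forall x, D x -> g x = 0}.
Proof.
move=> bg g0 Ig; have h := EFin_bm_Rintegral bg; rewrite Ig in h.
have mg : measurable_fun D (EFin \o g) by apply/measurable_EFinP; case: bg.
have : (\int[mu]_(x in D) `|(EFin \o g) x| = 0)%E.
  transitivity (\int[mu]_(x in D) (g x)%:E)%E; last exact: esym h.
  apply: eq_integral => x; rewrite inE => Dx /=.
  by rewrite ger0_norm// g0.
move=> /(ae_eq_integral_abs mu mD mg); apply: filterS => x /[swap] Dx /(_ Dx).
by move=> /= -[].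
Qed.

Context {m n : nat}.
Implicit Types s : T -> 'M[R]_(m, n).

Definition mxm s := forall a b, measurable_fun D (fun x => s x a b).
Definition mxb s C := forall x, D x -> frob (s x) <= C.

Lemma mxmD s s' : mxm s -> mxm s' -> mxm (fun x => s x + s' x).
Proof. by move=> h h' a b; under eq_fun do rewrite mxE; exact: measurable_funD. Qed.

Lemma mxmM (g : T -> R) s : measurable_fun D g -> mxm s -> mxm (fun x => g x *: s x).
Proof. by move=> h h' a b; under eq_fun do rewrite mxE; exact: measurable_funM. Qed.

Lemma mxmB s s' : mxm s -> mxm s' -> mxm (fun x => s x - s' x).
Proof. by move=> h h' a b; under eq_fun do rewrite !mxE; exact: measurable_funB. Qed.

Lemma measurable_mxdot s s' : mxm s -> mxm s' ->
  measurable_fun D (fun x => mxdot (s x) (s' x)).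
Proof.
move=> h h'; apply: measurable_sum => a; apply: measurable_sum => b.
exact: measurable_funM.
Qed.

Lemma measurable_frob s : mxm s -> measurable_fun D (fun x => frob (s x)).
Proof.
move=> h; have ms : measurable_fun setT (Num.sqrt : R -> R).
  by apply: nondecreasing_measurable => // x y; exact: ler_wsqrtr.
exact: (measurableT_comp ms (measurable_mxdot h h)).
Qed.

Lemma bm_mxdot s s' C C' : mxm s -> mxm s' -> mxb s C -> mxb s' C' ->
  bm (fun x => mxdot (s x) (s' x)).
Proof.
move=> h h' b b'; split; first exact: measurable_mxdot.
exists (C * C') => x Dx; rewrite (le_trans (normr_mxdot_le _ _))//.
by rewrite ler_pM ?frob_ge0 ?b ?b'.
Qed.

Lemma bm_frob s C : mxm s -> mxb s C -> bm (fun x => frob (s x)).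
Proof.
move=> h b; split; first exact: measurable_frob.
by exists C => x Dx; rewrite ger0_norm ?frob_ge0// b.
Qed.

End bounded_measurable.

Lemma locally_lipschitz_continuous {R : realType} N (F : 'rV[R]_N -> R) :
  (forall M, 0 <= M -> exists C, 0 <= C /\
    forall l k, `|l| <= M -> `|k| <= M -> `|F l - F k| <= C * `|l - k|) ->
  continuous F.
Proof.
move=> h x; have [C [C0 hC]] := h (`|x| + 1) (addr_ge0 (normr_ge0 _) ler01).
apply/(@cvgrPdist_le _ _ _ (nbhs x) (nbhs_filter x)) => /= e e0.
have C1 : 0 < C + 1 by rewrite ltr_wpDl.
have d0 : 0 < Num.min 1 (e / (C + 1)) by rewrite lt_min ltr01 divr_gt0.
near=> y.
have : `|x - y| <= Num.min 1 (e / (C + 1)).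
  by near: y; apply: cvgr_dist_le => //; exact: cvg_id.
rewrite le_min => /andP[xy1 xye].
have yx : `|y| <= `|x| + 1.
  by have := ler_normB x (x - y); rewrite opprB addrC subrK => h1; rewrite (le_trans h1)// lerD2l.
rewrite (le_trans (hC x y _ yx))//; first by rewrite lerDl.
rewrite ler_pdivlMr// in xye; rewrite (le_trans _ xye)// mulrC ler_wpM2l//.
by rewrite lerDl.
Unshelve. all: by end_near. Qed.

(** * The stress given by the right derivative *)

Section stress_law.
Context {R : realType} (phi dphi : R -> R) (H : nfunction phi dphi).
Context {m n : nat}.
Implicit Types A B : 'M[R]_(m, n).

Definition stress_law A := (dphi (frob A) / frob A) *: A.

Lemma frob_stress_law A : frob (stress_law A) = dphi (frob A).
Proof.
rewrite /stress_law frobZ; have [->|A0] := eqVneq (frob A) 0.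
  by rewrite mulr0 (nfun_d0 H).
rewrite ger0_norm ?mulfVK// divr_ge0 ?frob_ge0//; exact/(nfun_dge0 H)/frob_ge0.
Qed.

(** Cauchy-Schwarz reduces this to the supporting line of [phi] at [frob A]. Where [phi] has a kink,
    [stress_law] is one selection among the subgradients of [phi(|.|)]. *)
Lemma stress_law_subgradient A B :
  phi (frob A) + mxdot (stress_law A) (B - A) <= phi (frob B).
Proof.
apply: le_trans (nfun_line H (frob_ge0 A) (frob_ge0 B)).
rewrite lerD2l mxdotDr mxdotNr mulrBr lerD//.
  by rewrite (le_trans (mxdot_le_frob _ _))// frob_stress_law.
rewrite lerN2 /stress_law mxdotZl -frob_sqr; have [->|A0] := eqVneq (frob A) 0.
  by rewrite !mulr0 expr0n mulr0.
by rewrite expr2 mulrA mulfVK.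
Qed.

Context d (T : measurableType d) (D : set T).

Lemma mxm_stress_law (s : T -> 'M[R]_(m, n)) : mxm D s -> mxm D (fun x => stress_law (s x)).
Proof.
move=> ms; have mf := measurable_frob ms.
apply: mxmM => //; apply: measurable_funM.
  exact: (measurable_nondecreasing_comp mf (fun x => frob_ge0 _) (nfun_dhomo H)).
(* The inverse inherits measurability from the real power, with which it agrees on nonnegative
   numbers, 0 included. *)
rewrite (_ : (fun x => _) = (fun r => r `^ (-1)) \o (fun x => frob (s x))).
  by apply: measurableT_comp => //; exact: measurable_powR.
by apply/funext => x /=; rewrite powR_inv1// frob_ge0.
Qed.

Lemma bm_phi_frob (s : T -> 'M[R]_(m, n)) C : mxm D s -> mxb D s C ->
  bm D (fun x => phi (frob (s x))).
Proof.
move=> ms bs; have mf := measurable_frob ms; split.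
  exact: (measurable_nondecreasing_comp mf (fun x => frob_ge0 _) (nfun_homo H)).
exists (phi C) => x Dx; rewrite ger0_norm; first by rewrite (nfun_homo H)// ?frob_ge0 ?bs.
exact/(nfun_ge0 H)/frob_ge0.
Qed.

End stress_law.

(** * Minimization over finitely many coefficients of bounded fields *)

Section fenchel_core.
Context {R : realType} d (T : measurableType d) (mu : {measure set T -> \bar R}).
Context (D : set T) (mD : measurable D) (muD : (mu D < +oo)%E).
Context (phi dphi : R -> R) (H : nfunction phi dphi).
Context {m n N : nat} (E : 'I_N -> T -> 'M[R]_(m, n)) (B : R) (f : 'rV[R]_N).
Hypotheses (mE : forall j, mxm D (E j)) (B0 : 0 <= B) (bE : forall j, mxb D (E j) B).

(** In the application [E j] is the broken gradient of the j-th basis function of the discrete space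
    and [f] lists the loads of the basis functions. *)
Definition comb (l : 'rV[R]_N) (x : T) := \sum_j l ord0 j *: E j x.
Let K := N%:R * B.

Let K0 : 0 <= K.
Proof. exact: mulr_ge0. Qed.

Lemma combD l k t x : comb (l + t *: k) x = comb l x + t *: comb k x.
Proof.
rewrite /comb scaler_sumr -big_split/=; apply: eq_bigr => j _.
by rewrite !mxE scalerDl scalerA.
Qed.

Lemma combB l k x : comb (l - k) x = comb l x - comb k x.
Proof. by rewrite -scaleN1r combD scaleN1r. Qed.

Lemma frob_comb l x : D x -> frob (comb l x) <= `|l| * K.
Proof.
move=> Dx; rewrite (le_trans (frob_sum _ _))//.
apply: (@le_trans _ _ (\sum_(j < N) `|l| * B)).
  by apply: ler_sum => j _; rewrite frobZ ler_pM ?frob_ge0 ?coord_le_norm ?bE.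
by rewrite sumr_const card_ord /K -[X in X <= _]mulr_natl mulrCA.
Qed.

Lemma mxm_comb l : mxm D (comb l).
Proof.
move=> a b; under eq_fun do rewrite summxE.
apply: measurable_sum => j; under eq_fun do rewrite mxE.
by apply: measurable_funM => //; exact: mE.
Qed.

Lemma mxb_comb l : mxb D (comb l) (`|l| * K).
Proof. by move=> x; exact: frob_comb. Qed.

Definition penergy l := \int[mu]_(x in D) phi (frob (comb l x)).

Let bm_penergy l : bm D (fun x => phi (frob (comb l x))).
Proof. exact: (bm_phi_frob H (mxm_comb l) (mxb_comb l)). Qed.

Let V := fine (mu D).

Let V0 : 0 <= V.
Proof. by rewrite fine_ge0. Qed.

Lemma penergy_lip M l k : 0 <= M -> `|l| <= M -> `|k| <= M ->
  `|penergy l - penergy k| <= dphi (M * K) * (K * V) * `|l - k|.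
Proof.
move=> M0 lM kM.
have -> : dphi (M * K) * (K * V) * `|l - k| = dphi (M * K) * (`|l - k| * K) * V by ring.
apply: (bm_Rintegral_dist mD muD (bm_penergy l) (bm_penergy k)) => x Dx.
have le k' : `|k'| <= M -> 0 <= frob (comb k' x) <= M * K.
  by move=> k'M; rewrite frob_ge0 (le_trans (frob_comb _ Dx))// ler_wpM2r.
rewrite (le_trans (nfun_lip H (le _ lM) (le _ kM)))// ler_wpM2l//.
  by apply: (nfun_dge0 H); rewrite mulr_ge0.
by rewrite (le_trans (frob_dist _ _))// -combB frob_comb.
Qed.

Hypothesis indep : forall l, {ae mu, forall x, D x -> comb l x = 0} -> l = 0.

Let q l := \int[mu]_(x in D) frob (comb l x).

Let bm_q l : bm D (fun x => frob (comb l x)).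
Proof. exact: bm_frob (mxm_comb l) (mxb_comb l). Qed.

(** By [indep], [q] is positive on the unit sphere, which is compact; it attains its minimum [c]
    there and is homogeneous. *)
Let q_coercive : exists c, 0 < c /\ forall l, c * `|l| <= q l.
Proof.
have q0 l : 0 <= q l by apply: Rintegral_ge0 => x _; exact: frob_ge0.
have qZ t l : q (t *: l) = `|t| * q l.
  rewrite /q -(bm_RintegralZ mD muD)//; apply: eq_Rintegral => x _.
  have := combD 0 l t x; rewrite add0r => ->.
  by rewrite {1}/comb big1 ?add0r ?frobZ// => j _; rewrite mxE scale0r.
pose S := [set l : 'rV[R]_N | `|l| = 1].
(* The sphere is empty only if every coefficient vector is 0, that is, for [N = 0]. *)
have [S0|/set0P/negP] := pselect (S !=set0); last first.
  rewrite negbK => /eqP S0; exists 1; split => // l.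
  have [->|l0] := eqVneq l 0; first by rewrite normr0 mulr0.
  have : S (`|l|^-1 *: l).
    by rewrite /S/= normrZ normfV normr_id mulVf// normr_eq0.
  by rewrite S0.
have cnorm : continuous (fun l : 'rV[R]_N => `|l|).
  apply: locally_lipschitz_continuous => M M0; exists 1; split => // l k _ _.
  by rewrite mul1r ler_dist_dist.
have cS : compact S.
  apply: bounded_closed_compact.
    by exists 1; split => // M M1 l /= ->; rewrite ltW.
  exact: ((continuous_closedP _).1 cnorm [set x | x = 1] (@closed_eq _ 1)).
have cq : continuous q.
  apply: locally_lipschitz_continuous => M M0; exists (K * V); rewrite mulr_ge0//.
  split => // l k _ _; rewrite (_ : K * V * `|l - k| = (`|l - k| * K) * V); last by ring.
  apply: (bm_Rintegral_dist mD muD (bm_q l) (bm_q k)) => x Dx.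
  by rewrite (le_trans (frob_dist _ _))// -combB frob_comb.
have [c Sc cmin] := EVT_min_rV S0 cS (continuous_subspaceT cq).
rewrite inE in Sc.
exists (q c); split.
  rewrite lt_def q0 andbT; apply/eqP => qc0.
  have /indep c0 : {ae mu, forall x, D x -> comb c x = 0}.
    have := bm_Rintegral_eq0 mD muD (bm_q c) (fun x _ => frob_ge0 _) qc0.
    by apply: filterS => x h Dx; exact: frob_eq0 (h Dx).
  by move: Sc; rewrite /S/= c0 normr0 => /eqP; rewrite eq_sym oner_eq0.
move=> l; have [->|l0] := eqVneq l 0; first by rewrite normr0 mulr0.
have l1 : 0 < `|l| by rewrite normr_gt0.
have /cmin : `|l|^-1 *: l \in S.
  by rewrite inE /S/= normrZ normfV normr_id mulVf// normr_eq0.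
by rewrite qZ normfV normr_id mulrC ler_pdivlMr.
Qed.

Let Ff := \sum_j `|f ord0 j|.

Let dot_le l : `|mxdot l f| <= `|l| * Ff.
Proof.
rewrite /mxdot big_ord1 (le_trans (ler_norm_sum _ _ _))// mulr_sumr.
by apply: ler_sum => j _; rewrite normrM ler_wpM2r// coord_le_norm.
Qed.

Lemma penergy_minimizer : exists u, forall v,
  penergy u - mxdot u f <= penergy v - mxdot v f.
Proof.
have [c [c0 hc]] := q_coercive.
have Ff0 : 0 <= Ff by exact: sumr_ge0.
(* With this slope, Young's inequality [k * t <= phi t + cj phi k], applied to the norm of the
   field, outweighs the load by one full [|l|]; this is [Jlow]. *)
pose k := (Ff + 1) / c.
have k0 : 0 <= k by rewrite divr_ge0 ?(ltW c0)// addr_ge0.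
pose J l := penergy l - mxdot l f.
have Jlow l : `|l| - cj phi k * V <= J l.
  have : k * q l - cj phi k * V <= penergy l.
    rewrite /q -(bm_RintegralZ mD muD _ (bm_q l)) -Rintegral_cst//.
    rewrite -(bm_RintegralB mD muD (bmZ k (bm_q l)) (bm_cst _ _)).
    apply: (bm_le_Rintegral mD muD (bmB (bmZ k (bm_q l)) (bm_cst _ _)) (bm_penergy l)).
    by move=> x Dx; have := young H k0 (frob_ge0 (comb l x)); lra.
  have : (Ff + 1) * `|l| <= k * q l.
    rewrite -[X in X * _](@divfK _ c) ?lt0r_neq0// -/k -mulrA.
    by rewrite ler_wpM2l.
  have := dot_le l; rewrite ler_norml /J => /andP[_].
  move: (penergy l) (mxdot l f) => a b; rewrite mulrDl mul1r mulrC; lra.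
(* Outside the ball of this radius the lower bound [Jlow] exceeds [J 0]. *)
pose r := `|cj phi k * V| + `|J 0|.
have r0 : 0 <= r by rewrite addr_ge0.
pose S := [set l : 'rV[R]_N | `|l| <= r].
have cS : compact S.
  apply: bounded_closed_compact.
    by exists r; split; [exact: num_real|move=> M M1 l /= lr; rewrite (le_trans lr)// ltW].
  have cnorm : continuous (fun l : 'rV[R]_N => `|l|).
    apply: locally_lipschitz_continuous => M M0; exists 1; split => // l l' _ _.
    by rewrite mul1r ler_dist_dist.
  exact: ((continuous_closedP _).1 cnorm [set x | x <= r] (@closed_le _ r)).
have S0 : S !=set0 by exists 0; rewrite /S/= normr0.
have cJ : continuous J.
  apply: locally_lipschitz_continuous => M M0.
  exists (dphi (M * K) * (K * V) + Ff); split.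
    rewrite addr_ge0// mulr_ge0 ?mulr_ge0//.
    by apply: (nfun_dge0 H); rewrite mulr_ge0.
  move=> l l' lM l'M; rewrite mulrDl.
  have -> : J l - J l' = (penergy l - penergy l') - mxdot (l - l') f.
    by rewrite /J mxdotDl mxdotNl; ring.
  rewrite (le_trans (ler_normB _ _))// lerD//; first exact: penergy_lip.
  by rewrite mulrC dot_le.
have [u Su umin] := EVT_min_rV S0 cS (continuous_subspaceT cJ).
exists u => v; have [vr|rv] := leP `|v| r.
  by apply: umin; rewrite inE.
have := umin 0; rewrite inE => /(_ ltac:(by rewrite /S/= normr0)) h.
apply: (le_trans h); have := Jlow v.
have := ler_norm (cj phi k * V); have := ler_norm (J 0); move: rv; rewrite /r -/(J v).
lra.
Qed.

Variable u : 'rV[R]_N.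
Hypothesis umin : forall v, penergy u - mxdot u f <= penergy v - mxdot v f.

(** Bounds the stresses of all points within distance 1 of [u]; only such points are used in the
    descent argument. *)
Let L := dphi ((`|u| + 1) * K).

Let L0 : 0 <= L.
Proof. by apply: (nfun_dge0 H); rewrite mulr_ge0// addr_ge0. Qed.

(** Measurable [delta]-subgradients of [phi(|.|)] along [comb u]. The uniform bound [L] is what
    later permits dominated convergence. *)
Definition subgrad_set (delta : R) := [set s : T -> 'M[R]_(m, n) | [/\ mxm D s,
  mxb D s L & forall x, D x -> forall A,
   phi (frob (comb u x)) + mxdot (s x) (A - comb u x) - delta <= phi (frob A)]].

Lemma subgrad_set_convex delta s s' t : subgrad_set delta s ->
  subgrad_set delta s' -> 0 <= t <= 1 ->
  subgrad_set delta (fun x => s x + t *: (s' x - s x)).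
Proof.
move=> [ms bs hs] [ms' bs' hs'] /andP[t0 t1]; have t1' : 0 <= 1 - t by rewrite subr_ge0.
split.
- by apply: mxmD => //; apply: mxmM => //; exact: mxmB.
- move=> x Dx; have -> : s x + t *: (s' x - s x) = (1 - t) *: s x + t *: s' x.
    by rewrite scalerBr scalerBl scale1r addrA addrAC.
  rewrite (le_trans (frobD _ _))// !frobZ !ger0_norm//.
  have h1 : (1 - t) * frob (s x) <= (1 - t) * L by rewrite ler_wpM2l// bs.
  have h2 : t * frob (s' x) <= t * L by rewrite ler_wpM2l// bs'.
  by have := lerD h1 h2; rewrite -mulrDl subrK mul1r.
- move=> x Dx A; rewrite mxdotDl mxdotZl mxdotDl mxdotNl.
  have h1 := ler_wpM2l t1' (hs x Dx A); have h2 := ler_wpM2l t0 (hs' x Dx A).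
  have := lerD h1 h2; move: (mxdot (s x) _) (mxdot (s' x) _) (phi _) (phi _) => a b p p'.
  have -> : p' + (a + t * (b - a)) - delta = (1 - t) * (p' + a - delta) + t * (p' + b - delta).
    by ring.
  by move=> h; rewrite (le_trans h)// -mulrDl subrK mul1r.
Qed.

(** Moving the base point of the subgradient from [comb v] to [comb u] costs the product of a stress
    with [comb v - comb u] twice, once with the stress at each of the two points; each product is at
    most [L * K * |v - u|]. *)
Lemma stress_law_subgrad_set delta v : `|v - u| <= 1 -> 2 * L * K * `|v - u| <= delta ->
  subgrad_set delta (fun x => stress_law dphi (comb v x)).
Proof.
move=> vu1 vud.
have vu : `|v| <= `|u| + 1.
  by have := ler_normD u (v - u); rewrite addrC subrK => h; rewrite (le_trans h)// lerD2l.
have blaw : mxb D (fun x => stress_law dphi (comb v x)) L.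
  move=> x Dx; rewrite (frob_stress_law H); apply: (nfun_dhomo H); first exact: frob_ge0.
  by rewrite (le_trans (frob_comb _ Dx))// ler_wpM2r.
split; [exact: (mxm_stress_law H (mxm_comb v))|exact: blaw|move=> x Dx A].
have h1 := stress_law_subgradient H (comb v x) A.
have h2 := stress_law_subgradient H (comb u x) (comb v x).
have e : frob (comb v x - comb u x) <= `|v - u| * K by rewrite -combB frob_comb.
have h3 : mxdot (stress_law dphi (comb v x)) (comb v x - comb u x) <= L * (`|v - u| * K).
  rewrite (le_trans (mxdot_le_frob _ _))// ler_pM ?frob_ge0//; exact: blaw.
have h4 : - (L * (`|v - u| * K)) <= mxdot (stress_law dphi (comb u x)) (comb v x - comb u x).
  rewrite lerNl -mxdotNr (le_trans (mxdot_le_frob _ _))// frobN ler_pM ?frob_ge0//.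
  rewrite (frob_stress_law H); apply: (nfun_dhomo H); first exact: frob_ge0.
  by rewrite (le_trans (frob_comb _ Dx))// ler_wpM2r// lerDl.
have E1 : mxdot (stress_law dphi (comb v x)) (A - comb u x) =
  mxdot (stress_law dphi (comb v x)) (A - comb v x)
  + mxdot (stress_law dphi (comb v x)) (comb v x - comb u x).
  by rewrite -mxdotDr addrA subrK.
have E2 : 2 * L * K * `|v - u| = L * (`|v - u| * K) + L * (`|v - u| * K) by ring.
rewrite E1; rewrite E2 in vud; lra.
Qed.

Definition residual (s : T -> 'M[R]_(m, n)) : 'rV[R]_N :=
  \row_j (\int[mu]_(x in D) mxdot (s x) (E j x) - f ord0 j).

Lemma mxdot_residual w s C : mxm D s -> mxb D s C ->
  mxdot w (residual s) = \int[mu]_(x in D) mxdot (s x) (comb w x) - mxdot w f.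
Proof.
move=> ms bs.
have bj j : bm D (fun x => mxdot (s x) (E j x)) by exact: bm_mxdot ms (mE j) bs (bE j).
under eq_Rintegral do rewrite mxdot_sumr.
under eq_Rintegral do under eq_bigr do rewrite mxdotZr.
rewrite bm_Rintegral_sum//; last by move=> j; exact: bmZ.
rewrite !mxdot_row -sumrB; apply: eq_bigr => j _.
by rewrite mxE (bm_RintegralZ mD muD _ (bj j)) mulrBr.
Qed.

Lemma residual_convex s s' C t : mxm D s -> mxb D s C -> mxm D s' -> mxb D s' C ->
  residual (fun x => s x + t *: (s' x - s x)) =
  residual s + t *: (residual s' - residual s).
Proof.
move=> ms bs ms' bs'; apply/rowP => j; rewrite !mxE.
have bj : bm D (fun x => mxdot (s x) (E j x)) by exact: bm_mxdot ms (mE j) bs (bE j).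
have bj' : bm D (fun x => mxdot (s' x) (E j x)) by exact: bm_mxdot ms' (mE j) bs' (bE j).
under eq_Rintegral do rewrite mxdotDl mxdotZl mxdotDl mxdotNl.
rewrite bm_RintegralD//; last by apply: bmZ; exact: bmB.
rewrite bm_RintegralZ//; last exact: bmB.
by rewrite bm_RintegralB//; ring.
Qed.

(* Otherwise a direction [w] separates the residuals from 0; as the stresses of
   [u + t w] are approximate subgradients, the energy would decrease along [w]. *)
Lemma subgrad_residual delta eta : 0 < delta -> 0 < eta ->
  exists2 s, subgrad_set delta s & mxdot (residual s) (residual s) < eta.
Proof.
move=> delta0 eta0; apply: contrapT => /forall2NP hno.
have hge s : subgrad_set delta s -> eta <= mxdot (residual s) (residual s).
  by move=> Ks; have [//|/negP] := hno s; rewrite -leNgt.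
pose C := [set residual s | s in subgrad_set delta].
have C0 : C !=set0.
  exists (residual (fun x => stress_law dphi (comb u x))).
  exists (fun x => stress_law dphi (comb u x)) => //.
  by apply: stress_law_subgrad_set; rewrite subrr normr0 ?mulr0// ltW.
have CM c : C c -> frob c <= \sum_(a < 1) \sum_(j < N) (L * B * V + `|f a j|).
  move=> [s [ms bs _] <-]; rewrite (le_trans (frob_le_sum _))//.
  apply: ler_sum => a _; apply: ler_sum => j _; rewrite (ord1 a) mxE.
  rewrite (le_trans (ler_normB _ _))// lerD2r; apply: bm_normr_Rintegral_le => //.
    exact: bm_mxdot ms (mE j) bs (bE j).
  move=> x Dx; rewrite (le_trans (normr_mxdot_le _ _))// ler_pM ?frob_ge0//; first exact: bs.
  exact: bE.
have Ccvx c c' (t : R) : C c -> C c' -> 0 <= t <= 1 -> C (c + t *: (c' - c)).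
  move=> [s Ks <-] [s' Ks' <-] t01.
  exists (fun x => s x + t *: (s' x - s x)); first exact: subgrad_set_convex.
  by case: Ks => ms bs _; case: Ks' => ms' bs' _; exact: residual_convex ms bs ms' bs'.
have [w [e [e0 he]]] := convex_separation0 C0 CM Ccvx eta0
  (fun c Cc => let: ex_intro2 s Ks sc := Cc in eq_ind _ (fun c => eta <= mxdot c c) (hge s Ks) c sc).
have w1 : 0 < `|w| + 1 by rewrite ltr_wpDl.
have LK : 0 < 2 * L * K + 1 by rewrite ltr_wpDl// !mulr_ge0.
(* Short enough for both smallness conditions of [stress_law_subgrad_set] at [v = u + t w]; the
   added ones keep the denominator positive. *)
pose t := Num.min 1 delta / ((`|w| + 1) * (2 * L * K + 1)).
have md0 : 0 < Num.min 1 delta by rewrite lt_min ltr01.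
have t0 : 0 < t by rewrite divr_gt0// mulr_gt0.
pose v := u + t *: w.
have vuE : v - u = t *: w by rewrite /v addrAC subrr add0r.
have tw : t * (`|w| + 1) * (2 * L * K + 1) = Num.min 1 delta.
  by rewrite /t -mulrA divfK// mulf_neq0// lt0r_neq0.
have vun : `|v - u| * (2 * L * K + 1) <= Num.min 1 delta.
  rewrite vuE normrZ gtr0_norm// -tw ler_wpM2r ?(ltW LK)// ler_wpM2l ?(ltW t0)//.
  by rewrite lerDl.
have [vu1 vud] : `|v - u| <= 1 /\ 2 * L * K * `|v - u| <= delta.
  move: vun; rewrite le_min mulrDr mulr1 => /andP[h1 h2].
  have h3 : 0 <= `|v - u| * (2 * L * K) by rewrite mulr_ge0// !mulr_ge0.
  have h4 := normr_ge0 (v - u); rewrite mulrC; lra.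
have Ks := stress_law_subgrad_set vu1 vud.
have [ms bs _] := Ks.
have := he _ (ex_intro2 _ _ _ Ks erefl); rewrite (mxdot_residual w ms bs).
set I := \int[mu]_(x in D) _ => hI.
(* The subgradient inequality at [comb v], tested with [comb u], bounds the change of energy from
   above. Separation makes [t * I] smaller than the change of load by [t * e], which contradicts the
   minimality of [u]. *)
have hp : penergy v - penergy u <= t * I.
  have bw := bm_mxdot ms (mxm_comb w) bs (mxb_comb w).
  rewrite -(bm_RintegralZ mD muD _ bw) -(bm_RintegralB mD muD (bm_penergy v) (bm_penergy u)).
  apply: (bm_le_Rintegral mD muD (bmB (bm_penergy v) (bm_penergy u)) (bmZ t bw)) => x Dx.
   have := stress_law_subgradient H (comb v x) (comb u x).
  have -> : comb u x - comb v x = - (t *: comb w x).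
    by rewrite /v combD opprD addrA subrr sub0r.
  rewrite mxdotNr mxdotZr; lra.
have := umin v; rewrite /v mxdotDl mxdotZl -/v => hu.
have : t * (I - mxdot w f) <= t * - e by rewrite ler_wpM2l// ltW.
rewrite mulrBr mulrN; have := mulr_gt0 t0 e0; lra.
Qed.

Let inv_gt0 (k : nat) : 0 < k.+1%:R^-1 :> R.
Proof. by rewrite invr_gt0. Qed.

Let inv_anti (k l : nat) : (k <= l)%N -> l.+1%:R^-1 <= k.+1%:R^-1 :> R.
Proof. by move=> kl; rewrite lef_pV2 ?posrE ?ltr0n// ler_nat ltnS. Qed.

(** A decreasing sequence of nonempty convex sets; a limit of elements taken from them has zero
    residual and satisfies the exact subgradient inequality. *)
Definition near_stress (k : nat) := [set s | subgrad_set k.+1%:R^-1 s /\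
  frob (residual s) <= k.+1%:R^-1].

Lemma near_stress_nonempty k : near_stress k !=set0.
Proof.
have [s Ks hs] := subgrad_residual (inv_gt0 k) (exprn_gt0 2 (inv_gt0 k)).
exists s; split => //.
by rewrite -(@ler_pXn2r _ 2)// ?nnegrE ?frob_ge0 ?(ltW (inv_gt0 _))// frob_sqr ltW.
Qed.

Lemma near_stress_anti k l : (k <= l)%N -> near_stress l `<=` near_stress k.
Proof.
move=> kl s [[ms bs hs] rs]; split; last exact: le_trans rs (inv_anti kl).
split => // x Dx A; apply: le_trans (hs x Dx A).
by rewrite lerD2l lerN2 inv_anti.
Qed.

Lemma near_stress_mid k s s' : near_stress k s -> near_stress k s' ->
  near_stress k (fun x => s x + 2^-1 *: (s' x - s x)).
Proof.
move=> [Ks rs] [Ks' rs']; split; first by apply: subgrad_set_convex => //; lra.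
case: Ks => ms bs _; case: Ks' => ms' bs' _.
rewrite (residual_convex _ ms bs ms' bs').
have -> : residual s + 2^-1 *: (residual s' - residual s) =
  2^-1 *: residual s + 2^-1 *: residual s'.
  rewrite scalerBr addrCA addrC; congr (_ + _).
  by rewrite -{1}(scale1r (residual s)) -scalerBl; congr (_ *: _); lra.
rewrite (le_trans (frobD _ _))// !frobZ ger0_norm//.
by move: rs rs'; move: (frob _) (frob _) (k.+1%:R^-1) => a b c; lra.
Qed.

Definition sqnorm (s : T -> 'M[R]_(m, n)) := \int[mu]_(x in D) mxdot (s x) (s x).

(* Elements of almost minimal L^2 norm form a Cauchy sequence, by the
   parallelogram identity; this replaces weak compactness. *)
Lemma near_stress_cauchy : exists s : nat -> T -> 'M[R]_(m, n),
  (forall k, near_stress k (s k)) /\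
  forall e, 0 < e -> exists k0, forall k l, (k0 <= k <= l)%N ->
    sqnorm (fun x => s k x - s l x) <= e.
Proof.
have nb k s : near_stress k s -> bm D (fun x => mxdot (s x) (s x)).
  by move=> [[ms bs _] _]; exact: (bm_mxdot ms ms bs bs).
have nle k s : near_stress k s -> sqnorm s <= L ^+ 2 * V.
  move=> ks; apply: (bm_Rintegral_le_cst mD muD (nb k s ks)) => x Dx.
  by case: ks => -[_ bs _] _; rewrite -frob_sqr ler_pXn2r ?nnegrE ?frob_ge0//; exact: bs.
pose S k := [set sqnorm s | s in near_stress k].
have S0 k : S k !=set0 by have [s ks] := near_stress_nonempty k; exists (sqnorm s), s.
have Slb k : lbound (S k) 0.
  by move=> _ [s _ <-]; apply: Rintegral_ge0 => x _; exact: mxdot_ge0.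
have Sinf k : has_inf (S k) by split => //; exists 0.
pose nu k := inf (S k).
have nuP k s : near_stress k s -> nu k <= sqnorm s.
  by move=> ks; apply: ge_inf; [exists 0|exists s].
have nu_le k : nu k <= L ^+ 2 * V.
  have [s ks] := near_stress_nonempty k; exact: le_trans (nuP _ _ ks) (nle _ _ ks).
have /choice[s hs] : forall k, exists s, near_stress k s /\ sqnorm s < nu k + k.+1%:R^-1.
  by move=> k; have [_ [s ks <-] h] := inf_adherent (inv_gt0 k) (Sinf k); exists s.
exists s; split => [k|e e0]; first by have [] := hs k.
(* The midpoint of [s k] and [s l] lies in [near_stress k], so [sqnorm] of it is at least [nu k].
   The infima [nu] increase and are bounded, hence [nu l - nu k] becomes small. *)
have key k l : (k <= l)%N ->
    sqnorm (fun x => s k x - s l x) <= 2 * (nu l - nu k) + 4 * k.+1%:R^-1.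
  move=> kl; have [ak hk] := hs k; have [al hl] := hs l.
  have al' := near_stress_anti kl al.
  have mid := near_stress_mid ak al'.
  have -> : sqnorm (fun x => s k x - s l x) =
      2 * (sqnorm (s k) + sqnorm (s l))
      - 4 * sqnorm (fun x => s k x + 2^-1 *: (s l x - s k x)).
    rewrite -(bm_RintegralD mD muD (nb _ _ ak) (nb _ _ al)).
    rewrite -(bm_RintegralZ mD muD _ (bmD (nb _ _ ak) (nb _ _ al))).
    rewrite -(bm_RintegralZ mD muD _ (nb _ _ mid)).
    rewrite -(bm_RintegralB mD muD (bmZ _ (bmD (nb _ _ ak) (nb _ _ al))) (bmZ _ (nb _ _ mid))).
    apply: eq_Rintegral => x _; move: (s k x) (s l x) => P Q.
    rewrite mxdot_sub_sqr !mxdotDl !mxdotDr !mxdotZl !mxdotZr !mxdotDl !mxdotDr.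
    by rewrite !mxdotNl !mxdotNr (mxdotC Q P); field.
  have := nuP _ _ mid; have := inv_anti kl; move: hk hl; rewrite -/(nu k) -/(nu l).
  move: (k.+1%:R^-1) (l.+1%:R^-1) => p r; lra.
have hr : has_sup (range nu).
  by split; [exists (nu 0%N), 0%N|exists (L ^+ 2 * V) => _ [k _ <-]].
have e4 : 0 < e / 4 by rewrite divr_gt0.
have e8 : 0 < e / 8 by rewrite divr_gt0.
have [_ [k1 _ <-] hk1] := sup_adherent e4 hr.
have [k2 _ hk2] := near_infty_natSinv_lt (PosNum e8).
exists (maxn k1 k2) => k l /andP[kk kl]; rewrite geq_max in kk.
have /andP[k1k k2k] := kk.
apply: (le_trans (key k l kl)).
have nul : nu l <= sup (range nu) by apply: ub_le_sup; [case: hr|exists l].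
have nuk : nu k1 <= nu k.
  apply: lb_le_inf => // _ [s' ks' <-]; apply: nuP.
  exact: near_stress_anti k1k _ ks'.
have := hk2 k k2k; rewrite /= => h; move: hk1 nul nuk h.
move: (nu k1) (nu k) (nu l) (sup _) (k.+1%:R^-1) => a b c z p; lra.
Qed.

Let cvg_sumr I (r : seq I) (F : I -> nat -> R) (l : I -> R) :
  (forall i, F i @ \oo --> l i) ->
  (fun k => \sum_(i <- r) F i k) @ \oo --> \sum_(i <- r) l i.
Proof.
move=> h; elim: r => [|i r IH].
  by under eq_fun do rewrite big_nil; rewrite big_nil; exact: cvg_cst.
by under eq_fun do rewrite big_cons; rewrite big_cons; exact: cvgD (h i) IH.
Qed.

Let cvg_mxdot (t : nat -> 'M[R]_(m, n)) (s A : 'M[R]_(m, n)) :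
  (forall a b, (fun i => t i a b) @ \oo --> s a b) ->
  (fun i => mxdot (t i) A) @ \oo --> mxdot s A.
Proof.
move=> h; apply: cvg_sumr => a; apply: cvg_sumr => b.
by apply: cvgM; [exact: h|exact: cvg_cst].
Qed.

(** A fast subsequence of the Cauchy sequence converges almost everywhere and is bounded by [L].
    Dominated convergence passes the load identities to the limit, while the subgradient
    inequalities pass pointwise. *)
Lemma stress_exists : exists s : T -> 'M[R]_(m, n), [/\ mxm D s,
  forall a b, mu.-integrable D (fun x => (s x a b)%:E),
  forall j, \int[mu]_(x in D) mxdot (s x) (E j x) = f ord0 j &
  {ae mu, forall x, D x -> forall A,
    phi (frob (comb u x)) + mxdot (s x) (A - comb u x) <= phi (frob A)}].
Proof.
have [s [hs cs]] := near_stress_cauchy.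
have b0 i : 0 < 2^-1 ^+ i :> R by rewrite exprn_gt0.
have /choice[k0 hk0] : forall i : nat, exists k0, forall k l, (k0 <= k <= l)%N ->
    sqnorm (fun x => s k x - s l x) <= (2^-1 ^+ i) ^+ 2.
  by move=> i; apply: cs; rewrite exprn_gt0.
(* These indices increase, are at least [i], and lie beyond the Cauchy threshold [k0 i]. *)
pose ka i := \sum_(j < i.+1) (k0 j).+1.
have kaS i : ka i.+1 = (ka i + (k0 i.+1).+1)%N by rewrite /ka big_ord_recr.
have k0ka i : (k0 i <= ka i)%N.
  by rewrite /ka big_ord_recr/= (leq_trans (leqnSn _))// leq_addl.
have ika i : (i <= ka i)%N.
  elim: i => // i IH; by rewrite kaS addnS ltnS (leq_trans IH)// leq_addr.
pose t i := s (ka i).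
have tn i : near_stress i (t i) by exact: near_stress_anti (ika i) _ (hs _).
have mt i : mxm D (t i) by case: (tn i) => -[].
have bt i : mxb D (t i) L by case: (tn i) => -[].
have mdt i : mxm D (fun x => t i x - t i.+1 x) by exact: mxmB.
have bdt i : mxb D (fun x => t i x - t i.+1 x) (L + L).
  by move=> x Dx; rewrite (le_trans (frobD _ _))// frobN lerD// bt.
pose g i x := frob (t i x - t i.+1 x).
have bg i : bm D (g i) by exact: bm_frob (mdt i) (bdt i).
have gint i : (\int[mu]_(x in D) (g i x)%:E <= (geometric ((1 + V) / 2) 2^-1 i)%:E)%E.
  rewrite -(EFin_bm_Rintegral mD muD (bg i)) lee_fin /=.
  have b2 := bm_mxdot (mdt i) (mdt i) (bdt i) (bdt i).
  (* An L^1 bound from the L^2 bound: [2 b g <= g^2 + b^2] with [b = 2^-i], integrated over a set of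
     measure [V]. *)
  rewrite -(ler_pM2l (_ : 0 < 2 * 2^-1 ^+ i)); last by rewrite mulr_gt0.
  rewrite -(bm_RintegralZ mD muD _ (bg i)).
  apply: (@le_trans _ _ (sqnorm (fun x => t i x - t i.+1 x) + (2^-1 ^+ i) ^+ 2 * V)).
    rewrite -Rintegral_cst// -(bm_RintegralD mD muD b2 (bm_cst _ _)).
    apply: (bm_le_Rintegral mD muD (bmZ _ (bg i)) (bmD b2 (bm_cst _ _))) => x Dx.
    rewrite -frob_sqr -/(g i x); have := sqr_ge0 (g i x - 2^-1 ^+ i).
    by rewrite sqrrB; move: (g i x) (2^-1 ^+ i) => p r; rewrite -mulr_natl; lra.
  have := hk0 i (ka i) (ka i.+1); rewrite k0ka kaS leq_addr => /(_ isT).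
  rewrite -kaS -/(t i) -/(t i.+1) => h.
  have -> : 2 * 2^-1 ^+ i * ((1 + V) / 2 * 2^-1 ^+ i) =
    (2^-1 ^+ i) ^+ 2 + (2^-1 ^+ i) ^+ 2 * V by field.
  by rewrite lerD2r.
have aecvg := ae_cvg_series_geometric mD (fun i => (bg i).1)
  (fun i x _ => frob_ge0 (t i x - t i.+1 x)) gint.
(* The limit superior is measurable on all of [D], including the null set where the sequence need
   not converge. *)
pose sg x := \matrix_(a, b) limn_sup (fun i => t i x a b) : 'M[R]_(m, n).
have tcvg : {ae mu, forall x, D x -> forall a b,
    (fun i => t i x a b) @ \oo --> sg x a b}.
  apply: filterS aecvg => x /[swap] Dx /(_ Dx) cg a b; rewrite mxE.
  pose w i : R := t i x a b.
  have cw : cvgn w.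
    have : cvgn (series (telescope w)).
      apply: normed_cvg; apply: series_le_cvg cg => i; [exact: normr_ge0|exact: frob_ge0|].
      rewrite /telescope/= distrC (le_trans _ (coord_le_frob _ a b))//.
      by rewrite !mxE.
    rewrite telescopeK => h.
    have <- : (fun i => (w i - w 0%N) + w 0%N) = w by apply/funext => i; rewrite subrK.
    by apply: is_cvgD; [exact: h|exact: is_cvg_cst].
  by rewrite cvg_limn_supE.
have tL i x a b : D x -> `|t i x a b| <= L.
  by move=> Dx; rewrite (le_trans (coord_le_frob _ a b))// bt.
have msg : mxm D sg.
  move=> a b; under eq_fun do rewrite mxE.
  apply: (measurable_fun_limn_sup (h := fun i x => t i x a b)) => [x Dx|x Dx|i].
  - by exists L => _ [i _ <-]; have := tL i x a b Dx; rewrite ler_norml => /andP[].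
  - by exists (- L) => _ [i _ <-]; have := tL i x a b Dx; rewrite ler_norml => /andP[].
  - exact: mt.
exists sg; split => //.
- move=> a b.
  have [] // := @dominated_convergence _ _ _ mu D mD (fun i x => (t i x a b)%:E)
    (fun x => (sg x a b)%:E) (cst L%:E).
  + by move=> i; apply/measurable_EFinP; exact: mt.
  + by apply/measurable_EFinP; exact: msg.
  + apply: filterS tcvg => x h Dx; apply: cvg_EFin; last exact: h.
    exact: nearW.
  + by have := bm_integrable mD muD (bm_cst D L).
  + by apply: aeW => x i Dx /=; rewrite lee_fin tL.
- move=> j.
  have bj i := bm_mxdot (mt i) (mE j) (bt i) (bE j).
  have [] := @dominated_convergence _ _ _ mu D mD (fun i x => (mxdot (t i x) (E j x))%:E)
    (fun x => (mxdot (sg x) (E j x))%:E) (cst (L * B)%:E).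
  + by move=> i; apply/measurable_EFinP; case: (bj i).
  + by apply/measurable_EFinP; exact: measurable_mxdot.
  + apply: filterS tcvg => x h Dx; apply: cvg_EFin; first exact: nearW.
    by apply: cvg_mxdot => a b; exact: h.
  + by have := bm_integrable mD muD (bm_cst D (L * B)).
  + apply: aeW => x i Dx /=; rewrite lee_fin (le_trans (normr_mxdot_le _ _))//.
    by rewrite ler_pM ?frob_ge0 ?bt ?bE.
  move=> _ _ h.
  pose r i := \int[mu]_(x in D) mxdot (t i x) (E j x).
  have rf : r @ \oo --> f ord0 j.
    apply/cvgrPdist_le => /= e e0; near=> i.
    have := coord_le_frob (residual (t i)) ord0 j; rewrite mxE -/(r i) distrC => h1.
    rewrite (le_trans h1)//; have [_ h2] := tn i; rewrite (le_trans h2)// ltW//.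
    by near: i; exact: (near_infty_natSinv_lt (PosNum e0)).
  rewrite /Rintegral.
  suff -> : (\int[mu]_(x in D) (mxdot (sg x) (E j x))%:E = (f ord0 j)%:E)%E by [].
  apply: (cvg_unique _ h) => //.
  have -> : (fun i => \int[mu]_(x in D) (mxdot (t i x) (E j x))%:E)%E = EFin \o r.
    by apply/funext => i /=; rewrite (EFin_bm_Rintegral mD muD (bj i)).
  have h2 : EFin \o r @ \oo --> (f ord0 j)%:E.
    by apply: cvg_EFin; [exact: nearW|exact: rf].
  exact: h2.
- apply: filterS tcvg => x h Dx A.
  rewrite -lerBrDl.
  have c1 := @cvg_mxdot (fun i => t i x) (sg x) (A - comb u x) (h Dx).
  have c2 : (fun i : nat => phi (frob A) - phi (frob (comb u x)) + i.+1%:R^-1) @ \oo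
     --> phi (frob A) - phi (frob (comb u x)) + (0 : R).
    by apply: cvgD; [exact: cvg_cst|exact: cvg_harmonic].
  rewrite addr0 in c2; apply: (ler_cvg_to c1 c2); apply: nearW => i.
  have [[_ _ hi] _] := tn i; have := hi x Dx A.
  by move: (mxdot _ _) (phi _) (phi _) (i.+1%:R^-1) => p1 p2 p3 e; lra.
Unshelve. all: by end_near. Qed.

End fenchel_core.

(** * Barycentric coordinates and triangulations *)

Section barycentric.
Context {R : realType} {d : nat}.
Implicit Types (A : 'M[R]_(d.+1, d)) (x y : 'rV[R]_d).

(** With a column of ones in front, barycentric coordinates solve a linear system: [c *m aug A]
    records the sum of the coefficients along with the combination of the vertices. *)
Definition aug A : 'M[R]_(d.+1) := row_mx (const_mx 1 : 'M[R]_(d.+1, 1)) A.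
Definition augv x : 'rV[R]_(d.+1) := row_mx (const_mx 1 : 'M[R]_(1, 1)) x.

Definition nondegenerate A := forall c : 'rV[R]_d.+1,
  \sum_j c ord0 j = 0 -> c *m A = 0 -> c = 0.

Lemma mul_aug A (c : 'rV[R]_d.+1) :
  c *m aug A = row_mx (const_mx (\sum_j c ord0 j) : 'M[R]_(1, 1)) (c *m A).
Proof.
rewrite /aug (mul_mx_row c (const_mx 1 : 'M[R]_(d.+1, 1)) A).
have -> : c *m (const_mx 1 : 'M[R]_(d.+1, 1)) = const_mx (\sum_j c ord0 j).
  by apply/matrixP => i j; rewrite !mxE (ord1 i); apply: eq_bigr => k _; rewrite mxE mulr1.
by [].
Qed.

Lemma aug_unit A : nondegenerate A -> aug A \in unitmx.
Proof.
move=> nd; rewrite -row_free_unit -kermx_eq0; apply/eqP/row_matrixP => i.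
rewrite row0; set c := row i _.
have E : c *m aug A = 0 by rewrite /c -row_mul mulmx_ker row0.
rewrite mul_aug in E.
have [h1 h2] := @eq_row_mx R 1 1 d _ _ _ _ (etrans E (esym (@row_mx0 R 1 1 d))).
by apply: nd => //; have /matrixP/(_ ord0 ord0) := h1; rewrite !mxE.
Qed.

Variables (A : 'M[R]_(d.+1, d)) (nd : nondegenerate A).

Definition bc x : 'rV[R]_(d.+1) := augv x *m invmx (aug A).

Lemma bc_uniq x (c : 'rV[R]_d.+1) : \sum_j c ord0 j = 1 -> x = c *m A -> c = bc x.
Proof.
move=> c1 ->; rewrite /bc -[c in LHS]mulmx1 -(mulmxV (aug_unit nd)) mulmxA mul_aug c1.
by [].
Qed.

Lemma bc_aug x : bc x *m aug A = augv x.
Proof. by rewrite /bc mulmxKV ?aug_unit. Qed.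

Lemma bc_sum x : \sum_j bc x ord0 j = 1.
Proof.
have E := bc_aug x; rewrite mul_aug in E.
have [/matrixP/(_ ord0 ord0)] := @eq_row_mx R 1 1 d _ _ _ _ E.
by rewrite !mxE.
Qed.

Lemma bc_comb x : x = bc x *m A.
Proof.
have E := bc_aug x; rewrite mul_aug in E.
by have [_ ->] := @eq_row_mx R 1 1 d _ _ _ _ E.
Qed.

Lemma bc_affine x y t : bc (x + t *: (y - x)) = bc x + t *: (bc y - bc x).
Proof.
rewrite /bc -mulmxBl scalemxAl -mulmxDl; congr (_ *m _).
rewrite /augv (@opp_row_mx R 1 1 d) (@add_row_mx R 1 1 d) (@scale_row_mx R 1 1 d).
rewrite (@add_row_mx R 1 1 d).
have -> : const_mx 1 + t *: (const_mx 1 - const_mx 1) = const_mx 1 :> 'M[R]_(1, 1).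
  by rewrite subrr scaler0 addr0.
by [].
Qed.

Lemma bc_row k : bc (row k A) = delta_mx ord0 k.
Proof.
apply/esym/bc_uniq; last by rewrite rowE.
rewrite (bigD1 k)//= mxE !eqxx big1 ?addr0// => j jk.
by rewrite mxE (negbTE jk) andbF.
Qed.

Lemma bc_rowE k l : bc (row k A) ord0 l = (l == k)%:R.
Proof. by rewrite bc_row mxE eqxx. Qed.

Lemma bc_affineE x y t k :
  bc (x + t *: (y - x)) ord0 k = (1 - t) * bc x ord0 k + t * bc y ord0 k.
Proof. by rewrite bc_affine; move: (bc x) (bc y) => u v; rewrite !mxE; ring. Qed.

Lemma hullP (S : pred 'I_d.+1) x :
  hull A S x <-> (forall k, 0 <= bc x ord0 k) /\ (forall k, ~~ S k -> bc x ord0 k = 0).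
Proof.
split; first by move=> [l [l0 lS l1 xE]]; rewrite -(bc_uniq l1 xE).
move=> [h0 hS]; exists (bc x); split => //; [exact: bc_sum|exact: bc_comb].
Qed.

Lemma bc_coordE x k : bc x ord0 k =
  invmx (aug A) (lshift d (ord0 : 'I_1)) k
  + \sum_(b < d) x ord0 b * invmx (aug A) (rshift 1 b) k.
Proof.
rewrite /bc mxE (@big_split_ord _ _ _ 1 d) /=; congr (_ + _).
  by rewrite big_ord1 /augv (@row_mxEl _ 1 1 d) mxE mul1r.
by apply: eq_bigr => b _; rewrite /augv (@row_mxEr _ 1 1 d).
Qed.

End barycentric.

Section barycentric_topology.
Context {R : realType} {n : nat}.
Notation d := n.+1.
Variables (A : 'M[R]_(d.+1, d)) (nd : nondegenerate A).

Lemma continuous_bc k : continuous (fun x : 'rV[R]_d => bc A x ord0 k).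
Proof.
under eq_fun do rewrite bc_coordE.
apply: (proj1 (Cn1_add (Cn1_cst _) _)); apply: Cn1_sum => b _.
exact: Cn1_mul (Cn1_coord b) (Cn1_cst _).
Qed.

Definition open_hull := [set x : 'rV[R]_d | forall k, 0 < bc A x ord0 k].

Lemma open_open_hull : open open_hull.
Proof.
rewrite openE => x hx; rewrite /interior.
have h (k : 'I_d.+1) : \forall y \near x, [set z | 0 < bc A z ord0 k] y.
  exact: (cvgr_gt _ (@continuous_bc k x)).
exact: (@filter_forall _ 'I_d.+1 (fun k => [set z | 0 < bc A z ord0 k]) (nbhs x) _ h).
Qed.

Lemma open_hull_nonempty : open_hull !=set0.
Proof.
pose c : 'rV[R]_d.+1 := const_mx d.+1%:R^-1.
have c1 : \sum_j c ord0 j = 1.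
  under eq_bigr do rewrite mxE.
  by rewrite sumr_const card_ord -[LHS]mulr_natl divff// pnatr_eq0.
exists (c *m A) => k; rewrite -(bc_uniq nd c1 erefl) mxE invr_gt0 ltr0n//.
Qed.

Lemma closed_hullT : closed (hull A xpredT).
Proof.
rewrite (_ : hull _ _ = \bigcap_(k in [set: 'I_d.+1])
    ((fun x => bc A x ord0 k) @^-1` [set r | 0 <= r])).
  apply: closed_bigI => k _.
  by have /continuous_closedP := @continuous_bc k; apply; exact: closed_ge.
apply/seteqP; split => x; first by move=> /(hullP nd)[h _] k _; exact: h.
by move=> h; apply/(hullP nd); split => // k; exact: h.
Qed.

Lemma open_hull_sub : open_hull `<=` hull A xpredT.
Proof. by move=> x h; apply/(hullP nd); split => // k; exact/ltW. Qed.

End barycentric_topology.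

(** * Intersections of simplices in a conforming triangulation *)

Section triangulation_geometry.
Context {R : realType} {n : nat}.
Notation d := n.+1.
Context (Omega : set 'rV[R]_d) (N : nat) (tri : 'I_N -> 'M[R]_(d.+1, d)).
Hypothesis htri : triangulation Omega tri.

Lemma tri_nd i : nondegenerate (tri i).
Proof. exact: (tri_nondegenerate htri). Qed.
Arguments tri_nd : clear implicits.

Notation bci i := (bc (tri i)).

Lemma simplexP i x : simplex tri i x <-> forall k, 0 <= bci i x ord0 k.
Proof.
split; first by move=> /(hullP (tri_nd i))[].
by move=> h; apply/(hullP (tri_nd i)); split.
Qed.

Lemma faceP i k x : face tri i k x <->
  (forall k', 0 <= bci i x ord0 k') /\ bci i x ord0 k = 0.
Proof.
split.
  by move=> /(hullP (tri_nd i))[h0 h]; split => //; apply: h; rewrite /= eqxx.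
move=> [h0 hk]; apply/(hullP (tri_nd i)); split => // k'.
by rewrite /= negbK => /eqP->.
Qed.

(** By conformity [x] lies in the hull of the common vertices, and there the weights of all other
    vertices vanish. *)
Lemma common_vertex i j x k : simplex tri i x -> simplex tri j x ->
  bci i x ord0 k != 0 -> exists l, row k (tri i) = row l (tri j).
Proof.
move=> xi xj xk.
have : (simplex tri i `&` simplex tri j) x by [].
rewrite (tri_conforming htri) => /(hullP (tri_nd i))[_ h].
have [/existsP[l /eqP kl]|/h xk0] := boolP [exists l, row k (tri i) == row l (tri j)].
  by exists l.
by rewrite xk0 eqxx in xk.
Qed.

Lemma simplex_sub_rows i j : (forall k, exists l, row k (tri i) = row l (tri j)) ->
  simplex tri i `<=` simplex tri j.
Proof.
move=> /choice[s sE] x /simplexP h.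
have xE := bc_comb (tri_nd i) x.
(* A vertex of [tri j] collects the weights of all vertices of [tri i] that [s] sends to it. *)
exists (\row_l \sum_(k | s k == l) bci i x ord0 k); split => //.
- by move=> l; rewrite mxE; exact: sumr_ge0.
- under eq_bigr do rewrite mxE.
  by rewrite -[RHS](bc_sum (tri_nd i) x) [RHS](partition_big s xpredT).
- rewrite {1}xE !mulmx_sum_row (partition_big s xpredT)//=; apply: eq_bigr => l _.
  by rewrite mxE scaler_suml; apply: eq_bigr => k /eqP <-; rewrite sE.
Qed.

Lemma row_tri_inj i : injective (fun k => row k (tri i)).
Proof.
move=> k k' /(congr1 (bci i)); rewrite !(bc_row (tri_nd i)) => /rowP/(_ k).
by rewrite !mxE !eqxx/=; case: eqVneq => // _ /eqP; rewrite oner_eq0.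
Qed.

(** All weights of [x] are positive, so every vertex of [tri i] is one of [tri j]. The vertex map is
    injective between sets of equal size, hence onto, and the two simplices coincide. *)
Lemma open_hull_uniq i j x : open_hull (tri i) x -> simplex tri j x -> j = i.
Proof.
move=> xi xj.
have xi' : simplex tri i x by apply: open_hull_sub => //; exact: tri_nd.
have /choice[s sE] : forall k, exists l, row k (tri i) = row l (tri j).
  by move=> k; apply: (common_vertex xi' xj); rewrite gt_eqF// xi.
have s_inj : injective s.
  by move=> k k' /(congr1 (fun l => row l (tri j))); rewrite -!sE => /row_tri_inj.
apply: (tri_distinct htri); apply/seteqP; split; apply: simplex_sub_rows => k.
  by exists (invF s_inj k); rewrite sE f_invF.
by exists (s k).
Qed.

Lemma piecewise_open_hull w i x : open_hull (tri i) x -> piecewise tri w x = w i x.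
Proof.
move=> xi; rewrite /piecewise; case: pickP => [j|/(_ i)].
  by rewrite inE => /(open_hull_uniq xi)->.
by rewrite mem_set//; apply: open_hull_sub => //; exact: tri_nd.
Qed.

Lemma simplex_sub_closure i : simplex tri i `<=` closure Omega.
Proof. by rewrite -(tri_cover htri) => x xi; exists i. Qed.

(** Covering places a simplex only in the closure of [Omega], while almost-everywhere statements
    speak of [Omega]; an open neighbourhood of a point of the closure meets [Omega]. *)
Lemma open_hull_meets i : open Omega ->
  open (open_hull (tri i) `&` Omega) /\ open_hull (tri i) `&` Omega !=set0.
Proof.
move=> oO; have oi := @open_open_hull _ _ (tri i).
split; first exact: openI.
have [x xi] := open_hull_nonempty (tri_nd i).
have : closure Omega x.
  by apply: (@simplex_sub_closure i); apply: open_hull_sub => //; exact: tri_nd.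
have xn : nbhs x (open_hull (tri i)) by exact: open_nbhs_nbhs.
by move=> /(_ _ xn); rewrite setIC.
Qed.

Lemma measurable_simplex i : measurable (simplex tri i).
Proof. by apply: closed_measurable_row; apply: closed_hullT; exact: tri_nd. Qed.

Lemma bc_bary i k k' : bci i (bary tri i k) ord0 k' = if k' == k then 0 else d%:R^-1.
Proof.
pose c : 'rV[R]_d.+1 := \row_k' if k' == k then 0 else d%:R^-1.
have c1 : \sum_j c ord0 j = 1.
  rewrite (bigD1 k)//= mxE eqxx add0r (eq_bigr (fun=> d%:R^-1)).
    by rewrite sumr_const cardC1 card_ord -[LHS]mulr_natl divff// pnatr_eq0.
  by move=> j /negbTE jk; rewrite mxE jk.
have xE : bary tri i k = c *m tri i.
  rewrite mulmx_sum_row (bigD1 k)//= mxE eqxx scale0r add0r /bary scaler_sumr.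
  by apply: eq_bigr => j /negbTE jk; rewrite mxE jk.
by rewrite -(bc_uniq (tri_nd i) c1 xE) mxE.
Qed.

Lemma bary_face i k : face tri i k (bary tri i k).
Proof.
apply/faceP; split => [k'|]; rewrite bc_bary ?eqxx//.
by case: ifP.
Qed.

End triangulation_geometry.
Arguments tri_nd {R n Omega N tri} htri i c _ _.

(** * Piecewise constant Crouzeix-Raviart functions *)

(** Pigeonhole as [t] tends to 0: if each [j] failed below some [e j], all would fail below their
    minimum. It picks one simplex that contains points arbitrarily close behind a face. *)
Lemma finite_frequently {R : realType} (I : finType) (P : I -> R -> Prop) :
  (forall e, 0 < e -> exists t j, 0 < t < e /\ P j t) ->
  exists j, forall e, 0 < e -> exists t, 0 < t < e /\ P j t.
Proof.
move=> h; apply: contrapT => /forallNP hn.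
have /choice[e he] : forall j, exists e, 0 < e /\ forall t, 0 < t < e -> ~ P j t.
  move=> j; apply: contrapT => /forallNP hj; apply: (hn j) => e e0.
  apply: contrapT => /forallNP ht; apply: (hj e); split => // t te Pt.
  by apply: (ht t).
pose m := \big[Num.min/1]_j e j.
have m0 : 0 < m by apply: lt_bigmin => // j _; have [] := he j.
have [t [j [/andP[t0 tm] Pt]]] := h m m0.
have [_ hj] := he j; apply: (hj t) => //; rewrite t0 (lt_le_trans tm)//.
exact: bigmin_le_cond.
Qed.

Section crouzeix_raviart_uniqueness.
Context {R : realType} {n : nat}.
Notation d := n.+1.
Context (Omega : set 'rV[R]_d) (N : nat) (tri : 'I_N -> 'M[R]_(d.+1, d)).
Hypotheses (htri : triangulation Omega tri) (oOmega : open Omega).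

Notation bci i := (bc (tri i)).
Let nd := tri_nd htri.
(** The volume of the simplex up to the common factor [d!]. *)
Let vol i := `|\det (aug (tri i))|.

Let vol_gt0 i : 0 < vol i.
Proof. by rewrite normr_gt0 -unitfE -unitmxE aug_unit. Qed.

(* The two simplices lie on opposite sides of a common face; [a] is minus the
   quotient of their volumes. *)
Definition opposite (p q : 'I_N * 'I_d.+1) := face tri p.1 p.2 = face tri q.1 q.2 /\
  exists a, [/\ a < 0, forall x, bci q.1 x ord0 q.2 = a * bci p.1 x ord0 p.2 &
    a * vol q.1 = - vol p.1].

(** Barycentric coordinates with respect to [j] are affine in [x], hence determined by their values
    at the vertices of [i]. *)
Let bc_rows i j x l : bci j x ord0 l = \sum_k bci i x ord0 k * bci j (row k (tri i)) ord0 l.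
Proof.
have E : \row_l (\sum_k bci i x ord0 k * bci j (row k (tri i)) ord0 l) = bci j x.
  apply: (bc_uniq (@nd j)).
    under eq_bigr do rewrite mxE.
    rewrite exchange_big/= -(bc_sum (@nd i) x); apply: eq_bigr => k _.
    by rewrite -mulr_sumr (bc_sum (@nd j)) mulr1.
  rewrite {1}(bc_comb (@nd i) x) !mulmx_sum_row.
  under [RHS]eq_bigr do rewrite mxE scaler_suml.
  rewrite exchange_big/=; apply: eq_bigr => k _.
  rewrite {1}(bc_comb (@nd j) (row k (tri i))) mulmx_sum_row scaler_sumr.
  by apply: eq_bigr => l' _; rewrite scalerA.
by rewrite -E mxE.
Qed.

Let face_reindex (i j : 'I_N) (k : 'I_d.+1) (s : {perm 'I_d.+1}) :
  (forall k', k' != k -> row k' (tri i) = row (s k') (tri j)) ->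
  face tri i k = face tri j (s k) /\
  forall x, bci j x ord0 (s k) = bci i x ord0 k * bci j (row k (tri i)) ord0 (s k).
Proof.
move=> hs.
have bcs x k' : bci i x ord0 k = 0 -> bci j x ord0 (s k') = bci i x ord0 k'.
  move=> xk; rewrite (bc_rows i) (bigD1 k)//= xk mul0r add0r.
  have [->|k'k] := eqVneq k' k.
    rewrite big1 ?xk// => l lk; rewrite (hs _ lk) (bc_rowE (@nd j)).
    by rewrite (inj_eq perm_inj) eq_sym (negbTE lk) mulr0.
  rewrite (bigD1 k')//= big1 ?addr0 => [|l /andP[lk lk']].
    by rewrite (hs _ k'k) (bc_rowE (@nd j)) eqxx mulr1.
  rewrite (hs _ lk) (bc_rowE (@nd j)).
  by rewrite (inj_eq perm_inj) eq_sym (negbTE lk') mulr0.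
have bck x : bci j x ord0 (s k) = bci i x ord0 k * bci j (row k (tri i)) ord0 (s k).
  rewrite (bc_rows i) (bigD1 k)//= big1 ?addr0// => l lk.
  rewrite (hs _ lk) (bc_rowE (@nd j)).
  by rewrite (inj_eq perm_inj) eq_sym (negbTE lk) mulr0.
split => //; apply/seteqP; split => x.
  move=> /(faceP htri)[h0 hk]; apply/(faceP htri); split; last by rewrite bcs.
  by move=> l; rewrite -(permKV s l) bcs.
move=> /(faceP htri)[h0 hsk]; apply/(faceP htri).
suff hk : bci i x ord0 k = 0 by split => // k'; rewrite -bcs.
have a0 : bci j (row k (tri i)) ord0 (s k) != 0.
  apply/eqP => a0.
  have hk0 : bci j (bci i x *m tri i) ord0 (s k) = 0 by rewrite -(bc_comb (@nd i)).
  have all0 y : bci j y ord0 (s k) = 0 by rewrite bck a0 mulr0.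
  have := all0 (row (s k) (tri j)); rewrite (bc_rowE (@nd j)) eqxx => /eqP.
  by rewrite oner_eq0.
by move: hsk; rewrite bck => /eqP; rewrite mulf_eq0 (negbTE a0) orbF => /eqP.
Qed.

(** [P] holds the coordinates of the vertices of [tri i] with respect to [tri j]: unit vectors
    except in row [k]. Up to a permutation of rows its determinant is the single entry
    [c ord0 (s k)]. *)
Let vol_reindex (i j : 'I_N) (k : 'I_d.+1) (s : {perm 'I_d.+1}) :
  (forall k', k' != k -> row k' (tri i) = row (s k') (tri j)) ->
  `|bci j (row k (tri i)) ord0 (s k)| * vol j = vol i.
Proof.
move=> hs; set c := bci j (row k (tri i)).
pose P := \matrix_k' (if k' == k then c else delta_mx ord0 (s k')) : 'M[R]_d.+1.
have PE : P *m aug (tri j) = aug (tri i).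
  apply/row_matrixP => k'; rewrite row_mul rowK.
  have rowaug i' l : row l (aug (tri i')) = augv (row l (tri i')).
    rewrite /aug /augv (@row_row_mx _ _ 1 d).
    by have -> : row l (const_mx 1) = const_mx 1 :> 'M[R]_(1, 1) by apply/rowP => ?; rewrite !mxE.
  case: eqVneq => [->|k'k]; first by rewrite bc_aug ?rowaug.
  by rewrite -rowE !rowaug hs.
have PP : P = perm_mx s *m (\matrix_l (if l == s k then c else delta_mx ord0 l)).
  rewrite -row_permE; apply/matrixP => k' b; rewrite [LHS]mxE [RHS]mxE [RHS]mxE.
  by rewrite (inj_eq perm_inj).
have dP : `|\det P| = `|c ord0 (s k)|.
  rewrite PP det_mulmx normrM det_perm normrX normrN1 expr1n mul1r; congr `|_|.
  rewrite (expand_det_col _ (s k)) (bigD1 (s k))//= big1 ?addr0.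
    rewrite mxE eqxx /cofactor -signr_odd addnn odd_double mul1r.
    rewrite (_ : row' _ _ = 1%:M) ?det1 ?mulr1//.
    apply/matrixP => a b; rewrite !mxE eq_sym (negbTE (neq_lift _ _)).
    by rewrite mxE eqxx/= (inj_eq lift_inj) eq_sym.
  move=> l lk; rewrite mxE (negbTE lk) mxE eqxx/=.
  by rewrite eq_sym (negbTE lk) mul0r.
by rewrite /vol -PE det_mulmx normrM dP.
Qed.

(** Take [y] in [Omega] in the relative interior of the face. Points just beyond the face are still
    in [Omega], and by finiteness one simplex [j] contains such points arbitrarily close to [y]. It
    contains [y] too, hence by conformity all vertices of the face. *)
Lemma neighbour i k : ~ face tri i k `<=` bdry Omega -> exists q, opposite (i, k) q.
Proof.
move=> /existsNP[x0 /not_implyP[x0F x0b]].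
have x0O : Omega x0.
  apply: contrapT => nO; apply: x0b; split => //.
  apply: (simplex_sub_closure htri (i := i)).
  by apply/(simplexP htri); have /(faceP htri)[] := x0F.
have /nbhs_ballP[r /= r0 rO] : nbhs x0 Omega by exact: open_nbhs_nbhs.
rewrite ballE_cube// in rO.
have seg (y : 'rV[R]_d) : exists2 e, 0 < e & forall t, 0 < t < e ->
    cube x0 (r / 2) (x0 + t *: (y - x0)).
  exists (r / 2 / (`|y - x0| + 1)); first by rewrite !divr_gt0// ltr_wpDl.
  move=> t /andP[t0 te] b; rewrite [X in `|_ - X|]mxE opprD addrA subrr add0r normrN mxE normrM.
  rewrite gtr0_norm//; rewrite ltr_pdivlMr ?ltr_wpDl// in te.
  rewrite (le_lt_trans _ te)// ler_wpM2l ?(ltW t0)// (le_trans (coord_le_norm _ _))//.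
  by rewrite lerDl.
have [e1 e10 he1] := seg (bary tri i k).
(* [e2 < e1] keeps [y] near [x0], and [e2 <= 1 / 2] keeps the weight of [x0] nonnegative; the move
   towards the barycentre makes all coordinates of [y] but the k-th positive. *)
pose e2 := Num.min (e1 / 2) (1 / 2).
have e20 : 0 < e2 by rewrite lt_min !divr_gt0.
have e21 : e2 < e1.
  by rewrite (@le_lt_trans _ _ (e1 / 2))// ?ge_min ?lexx// ltr_pdivrMr// mulr2n mulrDr mulr1 ltrDl.
have e2h : e2 <= 1 / 2 by rewrite ge_min lexx orbT.
pose y := x0 + e2 *: (bary tri i k - x0).
have yO : cube x0 (r / 2) y by apply: he1; rewrite e20 e21.
have [h0 h0k] := (faceP htri i k x0).1 x0F.
have ybc k' : bci i y ord0 k' =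
   (1 - e2) * bci i x0 ord0 k' + e2 * bci i (bary tri i k) ord0 k'.
  exact: bc_affineE.
have yk : bci i y ord0 k = 0 by rewrite ybc h0k (bc_bary htri) eqxx !mulr0 addr0.
have ypos k' : k' != k -> 0 < bci i y ord0 k'.
  move=> k'k; rewrite ybc (bc_bary htri) (negbTE k'k) ltr_wpDl//.
    by rewrite mulr_ge0// subr_ge0 (le_trans e2h)//; lra.
  by rewrite mulr_gt0// invr_gt0 ltr0n.
pose z t := y + t *: (row k (tri i) - y).
(* points [z (- t)] lie on the far side of the face *)
have zO : exists2 e, 0 < e & forall t, 0 < t < e -> Omega (z (- t)).
  pose v := row k (tri i).
  exists (r / 2 / (`|v - y| + 1)); first by rewrite !divr_gt0// ltr_wpDl.
  move=> t /andP[t0 te]; apply: rO => b.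
  have E : x0 ord0 b - z (- t) ord0 b = (x0 ord0 b - y ord0 b) + t * (v - y) ord0 b.
    by rewrite /z !mxE; ring.
  rewrite E (le_lt_trans (ler_normD _ _))//.
  suff : `|t * (v - y) ord0 b| < r / 2 by have := yO b; lra.
  rewrite normrM gtr0_norm//; rewrite ltr_pdivlMr ?ltr_wpDl// in te.
  rewrite (le_lt_trans _ te)// ler_wpM2l ?(ltW t0)// (le_trans (coord_le_norm _ _))//.
  by rewrite lerDl.
have [e3 e30 he3] := zO.
have [j hj] : exists j, forall e, 0 < e -> exists t, 0 < t < e /\ simplex tri j (z (- t)).
  apply: finite_frequently => e e0.
  have m0 : 0 < Num.min e e3 / 2 by rewrite divr_gt0// lt_min e0.
  have m1 : Num.min e e3 / 2 < Num.min e e3.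
    by rewrite ltr_pdivrMr// mulr2n mulrDr mulr1 ltrDl lt_min e0.
  have : closure Omega (z (- (Num.min e e3 / 2))).
    apply: subset_closure; apply: he3; rewrite m0 (lt_le_trans m1)//.
    by rewrite ge_min lexx orbT.
  rewrite -(tri_cover htri) => -[j _ zj]; exists (Num.min e e3 / 2), j.
  by rewrite m0 (lt_le_trans m1)// ge_min lexx.
have zbc i' t k' : bci i' (z (- t)) ord0 k' =
   (1 + t) * bci i' y ord0 k' - t * bci i' (row k (tri i)) ord0 k'.
  by rewrite bc_affineE; ring.
(* Coordinates are affine in [t]: one that is negative at [y] would stay negative at [z (- t)] for
   all small [t]. *)
have yj : simplex tri j y.
  apply/(simplexP htri) => l; rewrite leNgt; apply/negP => yl.
  set u := bci j y ord0 l in yl; set w := bci j (row k (tri i)) ord0 l.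
  have w1 : 0 < `|u - w| + 1 by rewrite ltr_wpDl.
  have [t [/andP[t0 tl]]] := hj (- u / (`|u - w| + 1)) ltac:(by rewrite divr_gt0// oppr_gt0).
  move=> /(simplexP htri)/(_ l); rewrite zbc -/u -/w.
  rewrite ltr_pdivlMr// mulrDr mulr1 in tl.
  have := ler_norm (u - w); rewrite -(ler_pM2l t0) => h1 h2; lra.
have yi : simplex tri i y.
  apply/(simplexP htri) => k'; have [->|/ypos/ltW//] := eqVneq k' k.
  by rewrite yk.
have [t0 [/andP[t00 _] zj]] := hj 1 ltr01.
have ji : j != i.
  apply/eqP => ji; move: zj; rewrite ji => /(simplexP htri)/(_ k).
  by rewrite zbc yk mulr0 sub0r (bc_rowE (@nd i)) eqxx mulr1 oppr_ge0 leNgt t00.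
have /choice[sg hsg] : forall k', exists l, k' != k -> row k' (tri i) = row l (tri j).
  move=> k'; have [->|k'k] := eqVneq k' k; first by exists k.
  have [l hl] := common_vertex htri yi yj (lt0r_neq0 (ypos _ k'k)).
  by exists l.
pose im := sg @: predC1 k.
have sg_inj : {in predC1 k &, injective sg}.
  move=> k1 k2; rewrite !inE => h1 h2 E; apply: (row_tri_inj htri (i := i)) => /=.
  by rewrite !hsg// E.
(* The face takes all vertices of [tri j] but one, [l0]; sending [k] to it completes [sg] to a
   permutation. *)
have : #|~: im| = 1%N.
  by rewrite cardsCs finset.setCK card_in_imset// cardC1 !card_ord subSnn.
move=> /eqP/cards1P[l0 iml].
pose s0 k' := if k' == k then l0 else sg k'.
have s0_inj : injective s0.
  move=> k1 k2; rewrite /s0; case: eqVneq => [->|n1]; case: eqVneq => [->|n2] // E.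
  - have : l0 \in ~: im by rewrite iml inE.
    by rewrite E inE imset_f// !inE.
  - have : l0 \in ~: im by rewrite iml inE.
    by rewrite -E inE imset_f// !inE.
  - by apply: sg_inj; rewrite ?inE.
pose s := perm s0_inj.
have hs k' : k' != k -> row k' (tri i) = row (s k') (tri j).
  by move=> k'k; rewrite permE /s0 (negbTE k'k) hsg.
have [hF hbc] := face_reindex hs; have hv := vol_reindex hs.
exists (j, s k); split => //=.
set a := bci j (row k (tri i)) ord0 (s k) in hbc hv.
(* [a] is nonzero because volumes are. Its sign comes from [z (- t0)], whose coordinate [k] is
   negative in [i] while its coordinates in [j] are nonnegative. *)
have a0 : a < 0.
  rewrite lt_neqAle; apply/andP; split.
    by apply/eqP => a0; move: hv; rewrite a0 normr0 mul0r => /esym/eqP; rewrite gt_eqF.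
  move: zj => /(simplexP htri)/(_ (s k)); rewrite hbc zbc yk mulr0 sub0r.
  rewrite (bc_rowE (@nd i)) eqxx mulr1 mulNr oppr_ge0.
  by rewrite pmulr_rle0.
exists a; split => //; first by move=> x; rewrite hbc mulrC.
by rewrite -hv ltr0_norm// mulNr opprK.
Qed.

(** Both factors [a] are negative, so the two simplices lie on the same side of the common face.
    Points of the open simplex [p.1] close to a relatively interior point of the face then belong to
    [p'.1] too, and an open simplex meets no other one. *)
Lemma opposite_inj p p' q : opposite p q -> opposite p' q -> p = p'.
Proof.
case: p p' q => [i k] [i' k'] [j l] [/= F [a [a0 ha _]]] [/= F' [a' [a'0 ha' _]]].
pose b1 := bary tri i k; pose b2 := bary tri i' k'.
have FF : face tri i k = face tri i' k' by rewrite F F'.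
have [p1 z1] := (faceP htri i k b1).1 (bary_face htri i k).
have [p2 z2] := (faceP htri i' k' b2).1 (bary_face htri i' k').
have [q1 y1] : (forall k0, 0 <= bci i' b1 ord0 k0) /\ bci i' b1 ord0 k' = 0.
  by apply: (faceP htri i' k' b1).1; rewrite -FF; exact: (bary_face htri).
have [q2 y2] : (forall k0, 0 <= bci i b2 ord0 k0) /\ bci i b2 ord0 k = 0.
  by apply: (faceP htri i k b2).1; rewrite FF; exact: (bary_face htri).
(* Each barycentre is known to have positive coordinates off the face index only in its own simplex,
   and nonnegative ones in the other; their midpoint has positive ones in both. *)
pose x := b1 + 2^-1 *: (b2 - b1).
have xi k0 : bci i x ord0 k0 = (bci i b1 ord0 k0 + bci i b2 ord0 k0) / 2.
  by rewrite bc_affineE; field.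
have xi' k0 : bci i' x ord0 k0 = (bci i' b1 ord0 k0 + bci i' b2 ord0 k0) / 2.
  by rewrite bc_affineE; field.
have dpos : 0 < d%:R^-1 :> R by rewrite invr_gt0 ltr0n.
have xipos k0 : k0 != k -> 0 < bci i x ord0 k0.
  move=> h; rewrite xi divr_gt0// ltr_pwDl//.
  by rewrite (bc_bary htri) (negbTE h).
have xi'pos k0 : k0 != k' -> 0 < bci i' x ord0 k0.
  move=> h; rewrite xi' divr_gt0// ltr_wpDl//.
  by rewrite (bc_bary htri) (negbTE h).
have xik : bci i x ord0 k = 0 by rewrite xi z1 y2 addr0 mul0r.
have xi'k : bci i' x ord0 k' = 0 by rewrite xi' z2 y1 addr0 mul0r.
pose v := row k (tri i).
pose w k0 := bci i' v ord0 k0.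
have wk' : 0 < w k'.
  have := ha v; rewrite (bc_rowE (@nd i)) eqxx mulr1 (ha' v) -/(w k') => h.
  by rewrite -(nmulr_rlt0 _ a'0) h.
pose z t := x + t *: (v - x).
have zi t : 0 < t < 1 -> open_hull (tri i) (z t).
  move=> /andP[t0 t1] k0; rewrite bc_affineE (bc_rowE (@nd i)).
  have [->|k0k] := eqVneq k0 k; first by rewrite xik mulr0 mulr1 add0r.
  by rewrite mulr0 addr0 mulr_gt0 ?xipos// subr_gt0.
have ei k0 : exists e, 0 < e /\ forall t, 0 < t < e -> 0 <= bci i' (z t) ord0 k0.
  have zE t : bci i' (z t) ord0 k0 = bci i' x ord0 k0 + t * (w k0 - bci i' x ord0 k0).
    by rewrite bc_affineE /w; ring.
  have [->|k0k] := eqVneq k0 k'.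
    exists 1; split => // t /andP[t0 _]; rewrite bc_affineE xi'k mulr0 add0r.
    by rewrite mulr_ge0 ?(ltW t0)// ltW.
  have h1 := xi'pos _ k0k; set u := bci i' x ord0 k0 in zE h1.
  have w1 : 0 < `|w k0 - u| + 1 by rewrite ltr_wpDl.
  exists (u / (`|w k0 - u| + 1)); split; first by rewrite divr_gt0.
  move=> t /andP[t0]; rewrite ltr_pdivlMr// mulrDr mulr1 zE => ht.
  have := ler_norm (- (w k0 - u)); rewrite normrN -(ler_pM2l t0) mulrN; lra.
have /choice[e he] := ei.
pose m := \big[Num.min/1]_k0 e k0.
have m0 : 0 < m by apply: lt_bigmin => // k0 _; have [] := he k0.
have m2 : 0 < m / 2 < m.
  by rewrite divr_gt0//= ltr_pdivrMr// mulr2n mulrDr mulr1 ltrDl.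
have m1 : m <= 1 by apply: bigmin_le_id.
have ii' : i' = i.
  apply: (open_hull_uniq htri (x := z (m / 2))).
    by apply: zi; case/andP: m2 => -> /lt_le_trans ->.
  apply/(simplexP htri) => k0; have [_ h] := he k0; apply: h.
  case/andP: m2 => -> h2; rewrite (lt_le_trans h2)//; exact: bigmin_le_cond.
rewrite ii' in q1 y1 *; congr (_, _); apply/eqP; rewrite eq_sym; apply: contraT => kk.
by move: y1; rewrite (bc_bary htri) (negbTE kk) => /eqP; rewrite gt_eqF.
Qed.

(* Barycentric coordinates sum to 1, so the total volume of the simplices on which
   [c] does not vanish is the sum over their faces of volume times opposite
   coordinate (at any point, here 0); every such face is shared with another of
   these simplices, and the two contributions cancel. *)
Lemma cr_const_eq0 (w : 'I_N -> 'rV[R]_d -> R) (c : 'I_N -> R) :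
  (forall i x, w i x = c i) -> cr_comp Omega tri w -> forall i, c i = 0.
Proof.
move=> wc [hint hbd].
pose S : {set 'I_N * 'I_d.+1} := finset (fun p => c p.1 != 0).
have /choice[nb hnb] : forall p : 'I_N * 'I_d.+1, exists q, c p.1 != 0 -> opposite p q.
  move=> [i k]; have [ci|ci] := eqVneq (c i) 0; first by exists (i, k).
  have nF : ~ face tri i k `<=` bdry Omega.
    by move=> /hbd; rewrite wc => /eqP; rewrite (negbTE ci).
  by have [q hq] := neighbour nF; exists q.
have nbS p : p \in S -> nb p \in S.
  rewrite !inE => cp; have [F _] := hnb p cp.
  have nF : ~ face tri p.1 p.2 `<=` bdry Omega.
    by move=> /hbd; rewrite wc => /eqP; rewrite (negbTE cp).
  by have := hint _ _ _ _ F nF; rewrite !wc => <-.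
have nb_inj : {in S &, injective nb}.
  move=> p p'; rewrite !inE => cp cp' E.
  by apply: (@opposite_inj p p' (nb p)); [exact: hnb|rewrite E; exact: hnb].
pose term (p : 'I_N * 'I_d.+1) := bci p.1 0 ord0 p.2 * vol p.1.
have tN p : p \in S -> term (nb p) = - term p.
  rewrite inE => cp; have [_ [a [_ h1 h2]]] := hnb p cp.
  by rewrite /term h1 mulrAC h2 mulNr mulrC.
have imS : nb @: S = S.
  apply/eqP; rewrite eqEcard card_in_imset// leqnn andbT.
  by apply/fintype.subsetP => _ /imsetP[p pS ->]; exact: nbS.
have sum0 : \sum_(p in S) term p = 0.
  have E : \sum_(p in S) term p = - \sum_(p in S) term p.
    rewrite -{1}imS big_imset//= -sumrN; apply: eq_bigr => p pS; exact: tN.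
  by move: E => /eqP; rewrite -addr_eq0 -mulr2n mulrn_eq0/= => /eqP.
move=> i; apply/eqP; apply: contraT => ci.
have sumE : \sum_(p in S) term p = \sum_(j | c j != 0) vol j.
  rewrite (eq_bigl (fun p : 'I_N * 'I_d.+1 => (c p.1 != 0) && true)); last first.
    by move=> p; rewrite inE andbT.
  rewrite -(pair_big (fun j => c j != 0) xpredT (fun j k => term (j, k)))/=.
  apply: eq_bigr => j _; rewrite /term/= -mulr_suml (bc_sum (@nd j)) mul1r//.
have : 0 < \sum_(j | c j != 0) vol j.
  rewrite (bigD1 i)//= ltr_pwDl ?vol_gt0//; apply: sumr_ge0 => j _; exact/ltW/vol_gt0.
by rewrite -sumE sum0 ltxx.
Qed.

End crouzeix_raviart_uniqueness.

(** * Piecewise constant functions in W^{1,1}_0 *)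

Section cutoff.
Context {R : realType}.

Lemma poly_primitive (p : {poly R}) : exists q : {poly R}, q^`() = p.
Proof.
exists (\poly_(i < (size p).+1) (p`_i.-1 / i%:R)); apply/polyP => i.
rewrite coef_deriv coef_poly ltnS; case: ltnP => [ip|pi]; last first.
  by rewrite mul0rn nth_default.
by rewrite /= -[LHS]mulr_natr divfK// pnatr_eq0.
Qed.

Lemma poly_bounded_on (p : {poly R}) (M : R) : exists B, forall x, `|x| <= M -> `|p.[x]| <= B.
Proof.
exists (\sum_(i < size p) `|p`_i| * M ^+ i) => x xM.
rewrite horner_coef (le_trans (ler_norm_sum _ _ _))//; apply: ler_sum => i _.
by rewrite normrM normrX ler_wpM2l// lerXn2r// nnegrE (le_trans _ xM).
Qed.

(** [q] is nondecreasing; a value taken twice makes it constant in between, hence a constant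
    polynomial, and then [p = 0]. *)
Lemma poly_primitive_inj (p q : {poly R}) : p != 0 -> (forall x, 0 <= p.[x]) ->
  q^`() = p -> injective (horner q).
Proof.
move=> p0 p_ge0 qp.
have dq x : derivable (horner q) x 1 by exact: derivable_horner.
have mono a b : a <= b -> q.[a] <= q.[b].
  move=> ab; apply: (@ger0_derive1_le_cc R (horner q) a b) => //.
  - by move=> x _; rewrite -derivE qp.
  - exact/continuous_subspaceT/continuous_horner.
  - by rewrite in_itv/= lexx.
  - by rewrite in_itv/= lexx ab.
suff h a b : a < b -> q.[a] != q.[b].
  move=> a b E; apply/eqP; case: ltgtP => // /h; rewrite E eqxx//.
move=> ab; apply: contraNneq p0 => E.
have qc : q \Po ('X + a%:P) - q.[a]%:P = 0.
  apply: (@poly_eq0_interval _ _ (b - a)); first by rewrite subr_gt0.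
  move=> s /andP[s0 sb]; rewrite !hornerE horner_comp !hornerE.
  apply/eqP; rewrite subr_eq0 eq_le; apply/andP; split.
    by rewrite E; apply: mono; rewrite -lerBrDr ltW.
  by apply: mono; rewrite lerDr ltW.
have qa : q = q.[a]%:P.
  have : (q \Po ('X + a%:P)) \Po ('X - a%:P) = q.[a]%:P.
    by have /eqP := qc; rewrite subr_eq0 => /eqP ->; rewrite comp_polyC.
  rewrite -comp_polyA comp_polyD comp_polyX comp_polyC subrK comp_polyXr.
  by [].
by rewrite -qp qa derivC.
Qed.

(* A function [w] with values in [vals] has [T' \o w = 0], hence [T \o w] has zero
   weak gradient, while [T] still separates the values from 0. *)
Lemma finite_valued_cutoff (vals : seq R) : exists (T T' : R -> R) (B : R),
  [/\ T 0 = 0, (forall s, is_derive s (1 : R) T (T' s)) /\ continuous T',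
      forall s, `|T' s| <= B /\ `|T s| <= B,
      forall c, c \in vals -> T' c = 0 & forall s, T s = 0 -> s = 0].
Proof.
(* The squares make [p] nonnegative, so its primitive is injective. Composition with [atan], whose
   values stay in [[-2, 2]], makes both the primitive and its derivative bounded. *)
pose p : {poly R} := \prod_(c <- vals) ('X - (atan c)%:P) ^+ 2.
have p0 : p != 0.
  by rewrite prodf_seq_neq0; apply/allP => c _ /=; rewrite expf_neq0// polyXsubC_eq0.
have p_ge0 x : 0 <= p.[x].
  by rewrite horner_prod; apply: prodr_ge0 => c _; rewrite horner_exp sqr_ge0.
have [q qp] := poly_primitive p.
have [B1 hB1] := poly_bounded_on p 2.
have [B2 hB2] := poly_bounded_on (q - q.[0]%:P) 2.
have at2 x : `|atan x| <= 2 :> R.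
  have := atan_gtNpi2 x; have := atan_ltpi2 x; have := @pihalf_lt2 R.
  rewrite ler_norml; lra.
have x1 (x : R) : 0 < 1 + x ^+ 2 by rewrite ltr_pwDl// sqr_ge0.
exists (fun s => (q - q.[0]%:P).[atan s]), (fun s => p.[atan s] * (1 + s ^+ 2)^-1), (Num.max B1 B2).
split.
- by rewrite atan0 !hornerE subrr.
- split => s.
    have := is_derive1_comp (is_derive_poly (q - q.[0]%:P) (atan s)) (is_derive1_atan s).
    by rewrite derivB derivC subr0 qp.
  apply: (@cvgM _ _ (nbhs s)).
    apply: (@continuous_comp _ _ _ atan (horner p)); first exact: continuous_atan.
    exact: continuous_horner.
  apply: cvgV; first exact: lt0r_neq0.
  apply: cvgD; [exact: cvg_cst|exact: exprn_continuous].
- move=> s; split; rewrite le_max.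
    apply/orP; left; rewrite normrM (le_trans _ (hB1 _ (at2 s)))// ler_piMr//.
    by rewrite normfV ger0_norm ?(ltW (x1 s))// invf_le1// lerDl sqr_ge0.
  by apply/orP; right; exact: hB2.
- move=> c cv; rewrite horner_prod (big_rem c)//= horner_exp !hornerE subrr.
  by rewrite expr0n/= !mul0r.
- move=> s /eqP; rewrite !hornerE subr_eq0 => /eqP /(poly_primitive_inj p0 p_ge0 qp) h.
  by rewrite -(atanK s) h -[RHS](@atanK R 0) atan0.
Qed.

End cutoff.

(** * A Poincare inequality along lines *)

Section line_poincare.
Context {R : realType} {n : nat}.
Notation d := n.+1.
Context (Omega : set 'rV[R]_d).

Lemma derive_line (psi : 'rV[R]_d -> R) (x0 v : 'rV[R]_d) (t : R) :
  derivable psi (x0 + t *: v) v ->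
  is_derive t (1 : R) (fun s => psi (x0 + s *: v)) ('D_v psi (x0 + t *: v)).
Proof.
move=> dpsi.
have E : (fun h : R => h^-1 *: (((fun s => psi (x0 + s *: v)) \o shift t) (h *: 1)
    - psi (x0 + t *: v))) =
  (fun h : R => h^-1 *: ((psi \o shift (x0 + t *: v)) (h *: v) - psi (x0 + t *: v))).
  apply/funext => h /=; congr (_ *: (psi _ - _)).
  have -> : h *: (1 : R) = h by exact: mulr1.
  by rewrite scalerDl addrCA.
by split; rewrite /derivable /derive E.
Qed.

Lemma test_function_support (psi : 'rV[R]_d -> R) b : test_function Omega psi ->
  forall x, ~ Omega x -> psi x = 0 /\ 'D_(unit_row R b) psi x = 0.
Proof.
move=> [_ [K [cK KO] psi0]] x nO; have nK : ~ K x by move=> /KO.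
split; first exact: psi0.
have clK : closed K by apply: compact_closed => //; exact: norm_hausdorff.
rewrite (@near_eq_derive _ _ _ psi (cst 0)); first by rewrite derive_cst.
have : open (~` K) by exact: closed_openC.
move=> oK; have := open_nbhs_nbhs (conj oK nK : open_nbhs x (~` K)).
by apply: filterS => y /psi0.
Qed.

Lemma row_cons_line (t : R) (y : 'rV[R]_n) :
  row_cons (t, y) = row_cons (0, y) + t *: unit_row R ord0.
Proof.
apply/rowP => i; rewrite !mxE eqxx/=; case: unliftP => [j ->|->]/=.
  by rewrite mulr0 addr0.
by rewrite mulr1 add0r.
Qed.

(** On a line in the first direction, [T \o psi] is the integral of its derivative from a point
    outside [Omega], hence at most [I y], the integral over the whole line. Integration over
    [|t| <= M] gives the factor [2 * M]. *)
Lemma cutoff_poincare (T T' : R -> R) (psi : 'rV[R]_d -> R) (M : R) :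
  0 < M -> (forall x, Omega x -> `|x ord0 ord0| <= M) ->
  T 0 = 0 -> (forall s, is_derive s (1 : R) T (T' s)) -> continuous T' ->
  test_function Omega psi ->
  (\int[leb R d]_x `|T (psi x)|%:E <=
   \int[leb R d]_x `|T' (psi x) * 'D_(unit_row R ord0) psi x|%:E * (2 * M)%:E)%E.
Proof.
move=> M0 OM T0 dT cT' tpsi.
have [[cpsi hpsi] _] : Cn 1 psi /\ True by split => //; exact: tpsi.1.
have [dpsi cdpsi] := hpsi ord0.
have cT : continuous T.
  by move=> s; apply/differentiable_continuous/derivable1_diffP; case: (dT s).
have cTpsi : continuous (T \o psi).
  by move=> x; apply: continuous_comp; [exact: cpsi|exact: cT].
pose F x := T' (psi x) * 'D_(unit_row R ord0) psi x.
have cF : continuous F.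
  move=> x; apply: (@cvgM _ _ (nbhs x)); last exact: cdpsi.
  by apply: (@continuous_comp _ _ _ psi T'); [exact: cpsi|exact: cT'].
have mF : measurable_fun setT (fun x => `|F x|%:E).
  apply/measurable_EFinP; apply: measurableT_comp => //.
  exact: continuous_measurable_row.
have mT : measurable_fun setT (fun x => `|T (psi x)|%:E).
  apply/measurable_EFinP; apply: measurableT_comp => //.
  exact: (continuous_measurable_row cTpsi).
rewrite (ge0_integral_leb mT); last by move=> x; rewrite lee_fin.
rewrite (ge0_integral_leb mF); last by move=> x; rewrite lee_fin.
pose I y := (\int[lebesgue_measure]_t `|F (row_cons (t, y))|%:E)%E.
have I0 y : (0 <= I y)%E by apply: integral_ge0 => t _; rewrite lee_fin.
have mrc : measurable_fun setT (fun p : measurableTypeR R * 'rV[R]_n => `|F (row_cons p)|%:E).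
  exact: (measurableT_comp mF (@measurable_row_cons R n)).
have mI : measurable_fun setT I.
  apply: (@measurable_fun_fubini_tonelli_G _ _ _ _ R lebesgue_measure
    (fun p : measurableTypeR R * 'rV[R]_n => `|F (row_cons p)|%:E) mrc).
  by move=> p; rewrite lee_fin.
have out y t : M < `|t| -> psi (row_cons (t, y)) = 0.
  move=> Mt; have /(test_function_support ord0 tpsi)[] // : ~ Omega (row_cons (t, y)).
  by move=> /OM; rewrite mxE unlift_none/= leNgt Mt.
have pw y t : (`|T (psi (row_cons (t, y)))|%:E <= I y)%E.
  have [tM|Mt] := ltP M `|t|; first by rewrite out// T0 normr0.
  pose g s := T (psi (row_cons (0, y) + s *: unit_row R ord0)).
  pose g' s := F (row_cons (0, y) + s *: unit_row R ord0).
  have dg s : is_derive s (1 : R) g (g' s).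
    apply: (@is_derive1_comp _ T (fun s => psi (row_cons (0, y) + s *: unit_row R ord0))).
    exact: (derive_line (dpsi _)).
  have cg : continuous g.
    by move=> s; apply/differentiable_continuous/derivable1_diffP; case: (dg s).
  have cg' : continuous g'.
    have cl : continuous (fun s : R => row_cons (0, y) + s *: unit_row R ord0 : 'rV[R]_d).
      move=> s; apply: (@cvgD _ _ _ (nbhs s)); first exact: cvg_cst.
      by apply: (@cvgZl _ _ _ (nbhs s)); exact: cvg_id.
    move=> s; exact: (continuous_comp (cl s) (cF _)).
  (* The starting point lies strictly outside the slab [|t| <= M], so [psi] vanishes there. *)
  have Nt : - (M + 1) < t by move: Mt; rewrite ler_norml; lra.
  have := @continuous_FTC2 _ g' g _ _ Nt.
  have -> : g (- (M + 1)) = 0.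
    by rewrite /g -row_cons_line out// normrN ger0_norm ?ltrDl// addr_ge0// ltW.
  rewrite sube0 => ftc.
  rewrite row_cons_line -/(g t) -abse_EFin -ftc; last first.
  - by move=> s _; rewrite derive1E; case: (dg s) => _ ->.
  - split => [s _||]; first by case: (dg s).
      exact/cvg_at_right_filter/cg.
    exact/cvg_at_left_filter/cg.
  - exact: continuous_subspaceT.
  have mg' : measurable_fun setT (EFin \o g').
    apply/measurable_EFinP; exact: continuous_measurable_fun.
  have mJ : measurable (`[- (M + 1), t]%classic : set (measurableTypeR R)).
    exact: measurable_itv.
  have mg'J : measurable_fun (`[- (M + 1), t]%classic : set (measurableTypeR R)) (EFin \o g').
    exact: measurable_funTS.
  apply: (le_trans (le_abse_integral lebesgue_measure mJ mg'J)).
  rewrite /I.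
  have -> : (fun t0 => `|F (row_cons (t0, y))|%:E) = (abse \o (EFin \o g')).
    by apply/funext => s; rewrite row_cons_line.
  by apply: ge0_subset_integral => //; exact: measurableT_comp.
apply: (@le_trans _ _ (\int[leb R n]_y (I y * (2 * M)%:E))%E); last first.
  rewrite ge0_integralZr// ?lee_fin ?mulr_ge0 ?(ltW M0)//.
apply: ge0_le_integral => //.
- by move=> y _; apply: integral_ge0 => t _; rewrite lee_fin.
- apply: (@measurable_fun_fubini_tonelli_G _ _ _ _ R lebesgue_measure
    (fun p : measurableTypeR R * 'rV[R]_n => `|T (psi (row_cons p))|%:E)).
    exact: (measurableT_comp mT (@measurable_row_cons R n)).
  by move=> p; rewrite lee_fin.
- by apply: emeasurable_funM => //.
move=> y _.
have -> : (\int[lebesgue_measure]_t `|T (psi (row_cons (t, y)))|%:E =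
    \int[lebesgue_measure]_(t in `[(- M)%R, M]) `|T (psi (row_cons (t, y)))|%:E)%E.
  rewrite [RHS]integral_mkcond; apply: eq_integral => t _; rewrite patchE.
  case: ifPn => // tM; rewrite out ?T0 ?normr0//.
  rewrite ltNge; apply: contra tM => tM.
  by rewrite mem_set//= in_itv/= -ler_norml.
have mTy : measurable_fun setT (fun t : measurableTypeR R => `|T (psi (row_cons (t, y)))|%:E).
  have := measurableT_comp mT (@measurable_row_cons R n).
  by move=> h; exact: (measurableT_comp h (measurable_pair2 y)).
have -> : (2 * M)%:E = lebesgue_measure `[(- M)%R, M].
  rewrite lebesgue_measure_itv/= lte_fin gtrN// opprK; congr EFin; ring.
have mJ : measurable (`[- M, M]%classic : set (measurableTypeR R)).
  exact: measurable_itv.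
rewrite -(integral_cst lebesgue_measure mJ).
apply: ge0_le_integral; [exact: mJ|by move=> t _; rewrite lee_fin| |
  exact: measurable_cst|by move=> t _; exact: pw].
exact: measurable_funTS mTy.
Qed.

End line_poincare.

Lemma cvge0_near_le {R : realType} (u : (\bar R)^nat) (e : R) :
  u @ \oo --> 0%E -> 0 < e -> \forall i \near \oo, (u i <= e%:E)%E.
Proof.
move=> /fine_cvgP[uf u0] e0; have h := (@cvgr0Pnorm_le _ _ _ _ _ _).1 u0 e e0; near=> i.
have fi : u i \is a fin_num by near: i.
rewrite -(fineK fi) lee_fin (le_trans (ler_norm _))//.
by near: i; exact: h.
Unshelve. all: by end_near. Qed.

(** A nonempty open set has positive measure, so the exceptional null set cannot contain it. *)
Lemma ae_open_witness {R : realType} n (Omega : set 'rV[R]_n) (P : 'rV[R]_n -> Prop) U :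
  {ae leb R n, forall x, Omega x -> P x} -> open U -> U `<=` Omega -> U !=set0 ->
  exists2 x, U x & P x.
Proof.
move=> [N [mN N0 hN]] oU UO U0; apply: contrapT => h.
have UN : U `<=` N.
  move=> x Ux; apply: hN => /= hx; apply: h; exists x => //; exact/hx/UO.
have := leb_open_gt0 oU U0; rewrite ltNge => /negP; apply.
by rewrite -N0; apply: le_measure; rewrite ?inE//; exact: open_measurable_row.
Qed.

(* Along a fast subsequence of test functions [psi l] converging to [w], the
   Poincare inequality bounds the L^1 norm of [T \o psi l] by that of
   [T' (psi l) * D psi l], which tends to 0 because [T' \o w = 0]. *)
Lemma W110_finite_valued {R : realType} n (Omega : set 'rV[R]_n.+1)
    (w : 'rV[R]_n.+1 -> R) (vals : seq R) :
  open Omega -> bounded_set Omega -> W110 Omega w ->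
  (forall x, Omega x -> w x \in vals) ->
  {ae leb R n.+1, forall x, Omega x -> w x = 0}.
Proof.
move=> oO bO [wL1 [g [gL1 _ [psi [tpsi cw cg]]]]] wvals.
have mO : measurable Omega by exact: open_measurable_row.
have muO := leb_bounded mO bO.
have [M M0 OM] : exists2 M, 0 < M & forall x, Omega x -> `|x ord0 ord0| <= M.
  case: bO => M0 [_ hM]; exists (`|M0| + 1); first by rewrite ltr_wpDl.
  move=> x /(hM (`|M0| + 1)) h; rewrite (le_trans (coord_le_norm _ _))// h//.
  by rewrite (le_lt_trans (ler_norm _))// ltrDl.
have [T [T' [B [T0 [dT cT'] TB Tvals Tinj]]]] := finite_valued_cutoff vals.
have B0 : 0 <= B by have [h _] := TB 0; rewrite (le_trans _ h).
have cT : continuous T.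
  by move=> s; apply/differentiable_continuous/derivable1_diffP; case: (dT s).
pose D0 (f : 'rV[R]_n.+1 -> R) x := 'D_(unit_row R ord0) f x.
have /choice[ka hka] : forall i : nat, exists l,
    (\int[leb R n.+1]_(x in Omega) `|psi l x - w x|%:E <= (geometric 1 2^-1 i)%:E)%E /\
    (\int[leb R n.+1]_(x in Omega) `|D0 (psi l) x - g ord0 x|%:E <= (geometric 1 2^-1 i)%:E)%E.
  move=> i; have e0 : 0 < geometric 1 2^-1 i :> R by rewrite /= mul1r exprn_gt0.
  near \oo => l; exists l; split; near: l.
    exact: (cvge0_near_le cw e0).
  exact: (cvge0_near_le (cg ord0) e0).
pose ph i := psi (ka i).
have cph i : continuous (ph i) by have [h _] := tpsi (ka i); case: (h 1%N).
have cDph i : continuous (D0 (ph i)).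
  by have [h _] := tpsi (ka i); have [_ h1] := h 1%N; have [_] := h1 ord0.
have mcont (f : 'rV[R]_n.+1 -> R) : continuous f -> measurable_fun Omega f.
  by move=> cf; apply: measurable_funTS; exact: continuous_measurable_row.
have mw : measurable_fun Omega w by apply/measurable_EFinP; exact: measurable_int wL1.
have mg : measurable_fun Omega (g ord0) by apply/measurable_EFinP; exact: measurable_int (gL1 ord0).
have mT' i : measurable_fun Omega (fun x => T' (ph i x)).
  by apply: mcont => x; apply: (@continuous_comp _ _ _ (ph i) T'); [exact: cph|exact: cT'].
have mTp i : measurable_fun Omega (fun x => T (ph i x)).
  by apply: mcont => x; apply: (@continuous_comp _ _ _ (ph i) T); [exact: cph|exact: cT].
have mT : measurable_fun setT (T : R -> R) by exact: continuous_measurable_fun.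
have phw : {ae leb R n.+1, forall x, Omega x -> (fun i => ph i x) @ \oo --> w x}.
  have := @ae_cvg_series_geometric _ _ _ (leb R n.+1) Omega (fun i x => `|ph i x - w x|) 1 mO.
  have mi i : measurable_fun Omega (fun x => `|ph i x - w x|).
    by apply: measurableT_comp => //; apply: measurable_funB => //; exact: mcont.
  move=> /(_ mi (fun _ _ _ => normr_ge0 _) (fun i => (hka i).1)).
  apply: filterS => x h Ox; have /cvg_series_cvg_0/norm_cvg0 h2 := h Ox.
  have := cvgD h2 (cvg_cst (w x)); rewrite add0r => h3.
  have E : (fun i => ph i x - w x + w x) = (fun i => ph i x) by apply/funext => i; rewrite subrK.
  by rewrite -E; exact: h3.
pose a i := (\int[leb R n.+1]_(x in Omega) `|T' (ph i x) * g ord0 x|%:E)%E.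
have a0 : a @ \oo --> 0%E.
  have [] := @dominated_convergence _ _ _ (leb R n.+1) Omega mO
    (fun i x => `|T' (ph i x) * g ord0 x|%:E) (cst 0%E) (fun x => (B%:E * `|(g ord0 x)%:E|)%E).
  - move=> i; apply/measurable_EFinP; apply: measurableT_comp => //.
    exact: measurable_funM.
  - exact: measurable_cst.
  - apply: filterS phw => x h Ox; apply: cvg_EFin; first exact: nearW.
    have c1 : (fun i => T' (ph i x)) @ \oo --> T' (w x).
      exact: (cvg_comp _ _ (h Ox) (cT' (w x))).
    have c2 := cvg_norm (cvgM c1 (cvg_cst (g ord0 x))).
    rewrite (Tvals _ (wvals _ Ox)) mul0r normr0 in c2; exact: c2.
  - by apply: integrableZl => //; exact: (integrable_abse (gL1 ord0)).
  - apply: aeW => x i Ox; rewrite /= normr_id normrM lee_fin ler_wpM2r//.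
    by have [] := TB (ph i x).
  move=> _ _; rewrite integral0; exact.
pose c i := (\int[leb R n.+1]_(x in Omega) `|T (ph i x)|%:E)%E.
have c_lim : c @ \oo --> (\int[leb R n.+1]_(x in Omega) `|T (w x)|%:E)%E.
  have [] // := @dominated_convergence _ _ _ (leb R n.+1) Omega mO
    (fun i x => `|T (ph i x)|%:E) (fun x => `|T (w x)|%:E) (cst B%:E).
  - by move=> i; apply/measurable_EFinP; exact: measurableT_comp.
  - apply/measurable_EFinP; apply: measurableT_comp => //.
    exact: measurableT_comp.
  - apply: filterS phw => x h Ox; apply: cvg_EFin; first exact: nearW.
    by apply: cvg_norm; exact: (cvg_comp _ _ (h Ox) (cT (w x))).
  - by have := bm_integrable mO muO (bm_cst Omega B).
  - by apply: aeW => x i Ox; rewrite /= normr_id lee_fin; have [] := TB (ph i x).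
(* The derivative of [ph i] is split as [(D0 (ph i) - g) + g]: the first part is small in L^1 and is
   multiplied by the bounded [T'], the second gives [a i]. *)
have c_le i : (c i <= ((B * geometric 1 2^-1 i)%:E + a i) * (2 * M)%:E)%E.
  have tph := tpsi (ka i).
  have mTa : measurable_fun setT (fun x => `|T (ph i x)|%:E).
    apply/measurable_EFinP; apply: measurableT_comp => //.
    apply: continuous_measurable_row => x.
    by apply: (@continuous_comp _ _ _ (ph i) T); [exact: cph|exact: cT].
  apply: (@le_trans _ _ (\int[leb R n.+1]_x `|T (ph i x)|%:E)%E).
    by apply: ge0_subset_integral.
  apply: (le_trans (cutoff_poincare M0 OM T0 dT cT' tph)).
  rewrite lee_wpmul2r ?lee_fin ?mulr_ge0 ?(ltW M0)//.
  have -> : (\int[leb R n.+1]_x `|T' (psi (ka i) x) * 'D_(unit_row R ord0) (psi (ka i)) x|%:E =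
     \int[leb R n.+1]_(x in Omega) `|T' (ph i x) * D0 (ph i) x|%:E)%E.
    rewrite [RHS]integral_mkcond; apply: eq_integral => x _; rewrite patchE.
    case: ifPn => // xO; have nO : ~ Omega x by move=> Ox; move: xO; rewrite mem_set.
    have [_ ->] := test_function_support ord0 tph nO.
    by rewrite mulr0 normr0.
  have mDg : measurable_fun Omega (fun x => D0 (ph i) x - g ord0 x).
    by apply: measurable_funB => //; exact: mcont.
  apply: (@le_trans _ _ (\int[leb R n.+1]_(x in Omega)
     (B%:E * `|D0 (ph i) x - g ord0 x|%:E + `|T' (ph i x) * g ord0 x|%:E))%E).
    apply: ge0_le_integral => //.
    - apply/measurable_EFinP; apply: measurableT_comp => //.
      by apply: measurable_funM => //; exact: mcont.
    - apply: emeasurable_funD.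
        apply: emeasurable_funM => //; apply/measurable_EFinP; exact: measurableT_comp.
      by apply/measurable_EFinP; apply: measurableT_comp => //; exact: measurable_funM.
    - move=> x Ox; rewrite -EFinM -EFinD lee_fin.
      rewrite -[X in T' _ * X](subrK (g ord0 x)) mulrDr (le_trans (ler_normD _ _))//.
      by rewrite lerD2r normrM ler_wpM2r//; have [] := TB (ph i x).
  rewrite ge0_integralD//; last first.
  - by apply/measurable_EFinP; apply: measurableT_comp => //; exact: measurable_funM.
  - by apply: emeasurable_funM => //; apply/measurable_EFinP; exact: measurableT_comp.
  - by move=> x _; rewrite -EFinM lee_fin mulr_ge0.
  rewrite leeD2r// ge0_integralZl_EFin//; last first.
    by apply/measurable_EFinP; exact: measurableT_comp.
  by rewrite EFinM lee_wpmul2l ?lee_fin//; have [] := hka i.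
have L0 : (\int[leb R n.+1]_(x in Omega) `|T (w x)|%:E = 0)%E.
  apply/eqP; rewrite eq_le integral_ge0 ?andbT; last by move=> x _; rewrite lee_fin.
  apply/lee_addgt0Pr => e e0; rewrite add0e.
  apply: (cvge_to_le c_lim).
  have M2 : 0 < 2 * M by rewrite mulr_gt0.
  pose e1 := e / (2 * M) / 2.
  have e10 : 0 < e1 by rewrite !divr_gt0.
  have gcv : (fun i => B * geometric 1 2^-1 i) @ \oo --> (0 : R).
    rewrite -(mulr0 B); apply: cvgMr; apply: cvg_geometric.
    by rewrite ger0_norm// invf_lt1// ltr1n.
  near=> i; apply: (le_trans (c_le i)).
  have h1 : (a i <= e1%:E)%E by near: i; exact: cvge0_near_le.
  have h2 : B * geometric 1 2^-1 i <= e1.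
    by near: i; exact: (cvgr_le _ gcv).
  apply: (@le_trans _ _ ((e1%:E + e1%:E) * (2 * M)%:E)%E).
    by rewrite lee_wpmul2r ?lee_fin ?(ltW M2)// leeD// lee_fin.
  rewrite -EFinD -EFinM lee_fin /e1 -splitr divfK// lt0r_neq0//.
have mTw : measurable_fun Omega (EFin \o (fun x => T (w x))).
  apply/measurable_EFinP; exact: measurableT_comp.
have /(ae_eq_integral_abs (leb R n.+1) mO mTw) :
  (\int[leb R n.+1]_(x in Omega) `|(EFin \o (fun x => T (w x))) x| = 0)%E by exact: L0.
by apply: filterS => x h Ox; apply: Tinj; have [] := h Ox.
Unshelve. all: by end_near. Qed.

Lemma lagrange_const_eq0 {R : realType} n (Omega : set 'rV[R]_n.+1) N
    (tri : 'I_N -> 'M[R]_(n.+2, n.+1)) (w : 'I_N -> 'rV[R]_n.+1 -> R) (c : 'I_N -> R) :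
  triangulation Omega tri -> open Omega -> bounded_set Omega ->
  (forall i x, w i x = c i) -> lagrange_comp Omega tri w -> forall i, c i = 0.
Proof.
move=> htri oO bO wc lw i.
(* The extra value 0 is the default of [piecewise] when no simplex is picked. *)
have vals x : Omega x -> piecewise tri w x \in 0 :: [seq c j | j : 'I_N].
  move=> _; rewrite /piecewise; case: pickP => [j _|_]; last by rewrite inE eqxx.
  by rewrite wc inE map_f ?orbT// mem_enum.
have [oU U0] := open_hull_meets htri i oO.
have [x [xi xO] wx0] := ae_open_witness (W110_finite_valued oO bO lw vals) oU
  (@subIsetr _ _ _) U0.
by rewrite -(wc i x) -(piecewise_open_hull htri w xi).
Qed.

(** * Discrete spaces *)

Section norm_property.
Context {R : realType} {n : nat} {Omega : set 'rV[R]_n.+1} {N : nat}.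
Context {tri : 'I_N -> 'M[R]_(n.+2, n.+1)}.
Hypotheses (htri : triangulation Omega tri) (oO : open Omega) (bO : bounded_set Omega).

(** A derivative of a piece that is nonzero at a point of [Omega] in the open simplex is nonzero on
    an open set there, against the almost-everywhere hypothesis. So all derivatives vanish on an
    open set and the polynomial piece is constant. *)
Lemma gradh_eq0_const k m (v : broken R n N m) : Pk k v ->
  {ae leb R n.+1, forall x, Omega x -> gradh tri v x = 0} ->
  exists c : 'I_N -> 'I_m -> R, forall i a x, v i a x = c i a.
Proof.
move=> Pv hae.
have ex i a : exists c : R, forall x, v i a x = c.
  have [oU U0] := open_hull_meets htri i oO.
  apply: (polynomial_fun_const (Pv i a) oU U0) => b x [xi Ox].
  apply/eqP/negPn/negP => ne0.
  have [_ /(_ b) [_ cD]] := polynomial_fun_Cn1 (Pv i a).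
  pose W := (open_hull (tri i) `&` Omega) `&`
    ((fun x => 'D_(unit_row R b) (v i a) x) @^-1` [set y | y != 0]).
  have oW : open W.
    by apply: openI => //; apply: open_comp => [z _|]; [exact: cD|exact: open_neq].
  have [y [[yi Oy] /= ny] gy] := ae_open_witness hae oW (fun z h => h.1.2)
    (ex_intro _ x (conj (conj xi Ox) ne0)).
  move/matrixP: gy => /(_ a b); rewrite !mxE (piecewise_open_hull htri _ yi).
  by move/eqP; rewrite (negbTE ny).
exists (fun i a => sval (cid (ex i a))) => i a x.
by case: (cid (ex i a)) => c /= ->.
Qed.

(** The alternative is made for each component because the Kouhia-Stenberg element mixes both
    kinds. *)
Lemma gradh_eq0 k m (v : broken R n N m) : Pk k v ->
  (forall a, lagrange_comp Omega tri (fun i => v i a) \/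
             cr_comp Omega tri (fun i => v i a)) ->
  {ae leb R n.+1, forall x, Omega x -> gradh tri v x = 0} -> v = 0.
Proof.
move=> Pv hv hae; have [c vc] := gradh_eq0_const Pv hae.
apply/funext => i; apply/funext => a; apply/funext => x; rewrite vc.
case: (hv a) => [lv|cv].
  exact: (lagrange_const_eq0 htri oO bO (fun i x => vc i a x) lv i).
exact: (cr_const_eq0 htri oO (fun i x => vc i a x) cv i).
Qed.

End norm_property.

Section bounded_measurable_row.
Context {R : realType} {n : nat}.
Implicit Types A : set 'rV[R]_n.+1.

Lemma bounded_closure A : bounded_set A -> bounded_set (closure A).
Proof.
move=> [M [Mr hM]]; exists M; split => // K MK x clx.
have cK : closed [set y : 'rV[R]_n.+1 | `|y| <= K].
  apply: (@closed_comp _ _ (fun y : 'rV[R]_n.+1 => `|y|) [set y | y <= K]) => [y _|].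
    exact: norm_continuous.
  exact: closed_le.
have AK : A `<=` [set y | `|y| <= K] by move=> y; exact: hM.
by move: clx => /(closureS AK); rewrite -(closure_id _).1.
Qed.

Lemma bm_continuous A (g : 'rV[R]_n.+1 -> R) : bounded_set A -> continuous g -> bm A g.
Proof.
move=> bA cg; split; last exact: continuous_bounded_on.
by apply: measurable_funTS; exact: continuous_measurable_row.
Qed.

End bounded_measurable_row.

Lemma bm_prod {R : realType} d (T : measurableType d) (D : set T) I (r : seq I)
    (h : I -> T -> R) :
  (forall i, bm D (h i)) -> bm D (fun x => \prod_(i <- r) h i x).
Proof.
move=> bh; elim: r => [|i r IH].
  by under eq_fun do rewrite big_nil; exact: bm_cst.
by under eq_fun do rewrite big_cons; exact: bmM.
Qed.

(** * Linearity and boundedness of broken gradients *)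

Section piecewise_functions.
Context {R : realType} {n : nat} {Omega : set 'rV[R]_n.+1} {N : nat}.
Context {tri : 'I_N -> 'M[R]_(n.+2, n.+1)}.

Lemma piecewise_lin (w1 w2 : 'I_N -> 'rV[R]_n.+1 -> R) c x :
  piecewise tri (fun i x => c * w1 i x + w2 i x) x =
  c * piecewise tri w1 x + piecewise tri w2 x.
Proof. by rewrite /piecewise; case: pickP => // _; rewrite mulr0 addr0. Qed.

Lemma dpiece_lin k m (u v : broken R n N m) c i a b x : Pk k u -> Pk k v ->
  dpiece (c *: u + v) i a b x = c * dpiece u i a b x + dpiece v i a b x.
Proof.
move=> Pu Pv; have [_ /(_ b) [du _]] := polynomial_fun_Cn1 (Pu i a).
have [_ /(_ b) [dv _]] := polynomial_fun_Cn1 (Pv i a).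
rewrite /dpiece; have -> : (c *: u + v) i a = c *: (u i a) + v i a by [].
by rewrite deriveD ?deriveZ//; exact: derivableZ.
Qed.

Lemma gradh_lin k m (u v : broken R n N m) c x : Pk k u -> Pk k v ->
  gradh tri (c *: u + v) x = c *: gradh tri u x + gradh tri v x.
Proof.
move=> Pu Pv; apply/matrixP => a b; rewrite !mxE -piecewise_lin.
by congr (piecewise _ _ _); apply/funext => i; apply/funext => y; exact: dpiece_lin.
Qed.

Hypothesis htri : triangulation Omega tri.

(* On the set of points lying in exactly the simplices of J, a piecewise
   function is the piece that [pick] selects from J. *)
Lemma bm_piecewise (w : 'I_N -> 'rV[R]_n.+1 -> R) A :
  (forall i, bm A (w i)) -> bm A (piecewise tri w).
Proof.
move=> bw.
pose ind (J : {set 'I_N}) (x : 'rV[R]_n.+1) : R := \prod_(j <- enum 'I_N)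
  (if j \in J then \1_(simplex tri j) x else 1 - \1_(simplex tri j) x).
have -> : piecewise tri w = fun x => \sum_(J <- enum {set 'I_N})
    ind J x * (if [pick i in J] is Some i then w i x else 0).
  apply/funext => x; rewrite big_enum/=.
  pose Jx := finset (fun i => x \in simplex tri i).
  rewrite (bigD1 Jx)//= big1 => [|J JJ].
    rewrite addr0 /ind big1_seq => [|j _].
      rewrite mul1r /piecewise.
      have -> : [pick i | x \in simplex tri i] = [pick i in Jx] => //.
      by apply: eq_pick => i; rewrite inE.
    have -> : (j \in Jx) = (x \in simplex tri j) by rewrite [LHS]inE.
    by rewrite indicE; case: (_ \in _); rewrite ?subr0.
  suff [j jJ] : exists j, (j \in J) != (x \in simplex tri j).
    rewrite /ind big_enum (bigD1 j)//= indicE.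
    by move: jJ; case: (j \in J); case: (x \in _) => //= _; rewrite ?subrr !mul0r.
  apply: contrapT => h; move/eqP: JJ; apply; apply/setP => j; rewrite inE.
  by apply/eqP/negPn/negP => hj; apply: h; exists j.
apply: bm_sum => J; apply: bmM; last by case: pickP => [i _|_]; [exact: bw|exact: bm_cst].
apply: bm_prod => j.
have b1 : bm A (\1_(simplex tri j) : _ -> R).
  split; first by apply: measurable_indic; exact: (measurable_simplex htri).
  by exists 1 => x _; rewrite indicE; case: (_ \in _); rewrite ?normr1 ?normr0.
by case: (j \in J) => //; exact: (bmB (bm_cst A 1) b1).
Qed.

Hypothesis bO : bounded_set Omega.

Lemma bounded_simplex i : bounded_set (simplex tri i).
Proof.
have [M [Mr hM]] := bounded_closure bO; exists M; split => // K MK x xi.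
by apply: hM => //; exact: (simplex_sub_closure htri xi).
Qed.

Lemma bm_dpiece k m (v : broken R n N m) i a b (A : set 'rV[R]_n.+1) :
  bounded_set A -> Pk k v -> bm A (dpiece v i a b).
Proof.
move=> bA Pv; have [_ /(_ b) [_ cD]] := polynomial_fun_Cn1 (Pv i a).
exact: bm_continuous.
Qed.

Lemma bm_gradh k m (v : broken R n N m) a b :
  Pk k v -> bm Omega (fun x => gradh tri v x a b).
Proof.
move=> Pv; under eq_fun do rewrite mxE.
by apply: bm_piecewise => i; exact: (bm_dpiece i a b bO Pv).
Qed.

End piecewise_functions.

Lemma bm_Rintegral_lin {R : realType} d (T : measurableType d)
    (mu : {measure set T -> \bar R}) (D : set T) (mD : measurable D)
    (muD : (mu D < +oo)%E) (c : R) (g h : T -> R) : bm D g -> bm D h ->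
  \int[mu]_(x in D) (c * g x + h x) =
  c * \int[mu]_(x in D) g x + \int[mu]_(x in D) h x.
Proof.
by move=> bg bh; rewrite (bm_RintegralD mD muD (bmZ c bg) bh) (bm_RintegralZ mD muD c bg).
Qed.

Lemma Rintegral_0 {R : realType} d (T : measurableType d)
    (mu : {measure set T -> \bar R}) (D : set T) : \int[mu]_(x in D) (0 : R) = 0.
Proof. by rewrite /Rintegral integral0. Qed.

(** * Linear combinations in W^{1,1}_0 *)

Section linear_closure.
Context {R : realType} {n : nat} (Omega : set 'rV[R]_n.+1).
Notation leb := (leb R n.+1).

Lemma Cn_lin k (p q : 'rV[R]_n.+1 -> R) c :
  Cn k p -> Cn k q -> Cn k (fun x => c * p x + q x).
Proof.
elim: k p q => [|k IH] p q /= => [cp cq x|[cp hp] [cq hq]].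
  exact: (cvgD (cvgM (cvg_cst c) (cp x)) (cq x)).
split => [x|b]; first exact: (cvgD (cvgM (cvg_cst c) (cp x)) (cq x)).
have [dp Dp] := hp b; have [dq Dq] := hq b.
have dcp x : derivable (c *: (p : _ -> R^o)) x (unit_row R b) by exact: derivableZ.
split => [x|]; first exact: (derivableD (dcp x) (dq x)).
have -> : (fun x => 'D_(unit_row R b) (fun y => c * p y + q y) x) =
    (fun x => c * 'D_(unit_row R b) p x + 'D_(unit_row R b) q x).
  by apply/funext => x; rewrite -[RHS]/(c *: _ + _) -deriveZ// -deriveD.
exact: IH.
Qed.

Lemma derive_lin (p q : 'rV[R]_n.+1 -> R) c b x : Cn 1 p -> Cn 1 q ->
  'D_(unit_row R b) (fun y => c * p y + q y) x =
  c * 'D_(unit_row R b) p x + 'D_(unit_row R b) q x.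
Proof.
move=> [_ /(_ b) [dp _]] [_ /(_ b) [dq _]].
rewrite -[RHS]/(c *: _ + _) -deriveZ// -deriveD//; exact: derivableZ.
Qed.

Lemma test_function_lin (p q : 'rV[R]_n.+1 -> R) c :
  test_function Omega p -> test_function Omega q ->
  test_function Omega (fun x => c * p x + q x).
Proof.
move=> [Cp [K [cK KO] pK]] [Cq [L [cL LO] qL]]; split => [k|]; first exact: Cn_lin.
exists (K `|` L); first by split; [exact: compactU|rewrite subUset].
by move=> x nKL; rewrite pK ?qL ?mulr0 ?addr0// => h; apply: nKL; [right|left].
Qed.

Hypotheses (oO : open Omega) (bO : bounded_set Omega).

Let mO : measurable Omega.
Proof. exact: open_measurable_row. Qed.

Lemma L1_lin (p q : 'rV[R]_n.+1 -> R) c :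
  L1 Omega p -> L1 Omega q -> L1 Omega (fun x => c * p x + q x).
Proof.
move=> ip iq; have := integrableD mO (integrableZl mO c ip) iq.
by rewrite /L1; congr (integrable _ _ _); apply/funext => x /=; rewrite EFinD EFinM.
Qed.

Lemma L1_continuous (p g : 'rV[R]_n.+1 -> R) :
  L1 Omega p -> continuous g -> L1 Omega (fun x => p x * g x).
Proof.
move=> ip cg; have [mg [M hM]] := bm_continuous bO cg.
have : leb.-integrable Omega ((EFin \o g) \* (EFin \o p))%E.
  apply: integrableMr => //; exists M; split; first exact: num_real.
  by move=> K MK x Ox; apply: (le_trans (hM x Ox)); exact: ltW.
by rewrite /L1; congr (integrable _ _ _); apply/funext => x /=; rewrite mulrC EFinM.
Qed.

Lemma cvg_L1_lin (p q : nat -> 'rV[R]_n.+1 -> R) (p' q' : 'rV[R]_n.+1 -> R) c :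
  (forall l, continuous (p l)) -> (forall l, continuous (q l)) ->
  L1 Omega p' -> L1 Omega q' ->
  (\int[leb]_(x in Omega) `|p l x - p' x|%:E @[l --> \oo] --> 0)%E ->
  (\int[leb]_(x in Omega) `|q l x - q' x|%:E @[l --> \oo] --> 0)%E ->
  (\int[leb]_(x in Omega) `|c * p l x + q l x - (c * p' x + q' x)|%:E
    @[l --> \oo] --> 0)%E.
Proof.
move=> cp cq ip iq Pp Qq.
have mdiff (r : nat -> 'rV[R]_n.+1 -> R) r' l : (forall l, continuous (r l)) ->
    L1 Omega r' -> measurable_fun Omega (fun x => r l x - r' x).
  move=> cr ir; apply: measurable_funB.
    by apply: measurable_funTS; exact: continuous_measurable_row.
  by apply/measurable_EFinP; exact: measurable_int ir.
have mn (r : 'rV[R]_n.+1 -> R) : measurable_fun Omega r ->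
    measurable_fun Omega (fun x => `|r x|%:E).
  by move=> mr; apply/measurable_EFinP; exact: measurableT_comp.
have le0 : (`|c|%:E * 0 + 0 = 0 :> \bar R)%E by rewrite mule0 add0e.
apply: (@squeeze_cvge _ _ _ _ (cst 0%E) _ (fun l =>
   `|c|%:E * (\int[leb]_(x in Omega) `|p l x - p' x|%:E) +
   \int[leb]_(x in Omega) `|q l x - q' x|%:E)%E).
- apply: nearW => l; rewrite integral_ge0/=; last by move=> x _; rewrite lee_fin.
  have mp := mn _ (mdiff p p' l cp ip); have mq := mn _ (mdiff q q' l cq iq).
  have <- : (\int[leb]_(x in Omega) (`|c|%:E * `|p l x - p' x|%:E + `|q l x - q' x|%:E) =
      `|c|%:E * (\int[leb]_(x in Omega) `|p l x - p' x|%:E) +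
      \int[leb]_(x in Omega) `|q l x - q' x|%:E)%E.
    rewrite ge0_integralD//; last first.
      by apply: emeasurable_funM => //; exact: mp.
    by rewrite ge0_integralZl_EFin//; exact: mp.
  apply: ge0_le_integral => //.
  + apply: (mn (fun x => c * p l x + q l x - (c * p' x + q' x))).
    have -> : (fun x => c * p l x + q l x - (c * p' x + q' x)) =
        (fun x => c * (p l x - p' x) + (q l x - q' x)) by apply/funext => x; ring.
    apply: measurable_funD; last exact: (mdiff q q' l cq iq).
    by apply: measurable_funM => //; exact: (mdiff p p' l cp ip).
  + apply: emeasurable_funD; last exact: mq.
    by apply: emeasurable_funM => //; exact: mp.
  + move=> x _; rewrite -EFinM -EFinD lee_fin -normrM.
    rewrite (_ : c * p l x + q l x - _ = c * (p l x - p' x) + (q l x - q' x)); last by ring.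
    exact: ler_normD.
- exact: cvg_cst.
- have h := cvgeZl (isT : `|c|%:E \is a fin_num) Pp.
  have := cvgeD _ h Qq.
  by rewrite le0; apply; rewrite mule0.
Qed.

Lemma W110_lin (p q : 'rV[R]_n.+1 -> R) c :
  W110 Omega p -> W110 Omega q -> W110 Omega (fun x => c * p x + q x).
Proof.
move=> [ip [gp [igp wp [psi [tpsi cpsi dpsi]]]]] [iq [gq [igq wq [chi [tchi cchi dchi]]]]].
split; first exact: L1_lin.
exists (fun b x => c * gp b x + gq b x); split => [b||]; first exact: L1_lin.
  move=> th b tth; have [/(_ 1%N) [cth /(_ b) [_ cDth]] _] := tth.
  have e g1 g2 (h : 'rV[R]_n.+1 -> R) : L1 Omega g1 -> L1 Omega g2 -> continuous h ->
      \int[leb]_(x in Omega) ((c * g1 x + g2 x) * h x) =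
      c * \int[leb]_(x in Omega) (g1 x * h x) + \int[leb]_(x in Omega) (g2 x * h x).
    move=> i1 i2 ch; have i1h := L1_continuous i1 ch; have i2h := L1_continuous i2 ch.
    rewrite -RintegralZl// -RintegralD//; last first.
      have := integrableZl mO c i1h.
      by congr (integrable _ _ _); apply/funext => x /=; rewrite EFinM.
    by apply: eq_Rintegral => x _; rewrite mulrDl mulrA.
  by rewrite (e _ _ _ ip iq cDth) (e _ _ _ (igp b) (igq b) cth) wp// wq// mulrN opprD.
have cT r : (forall l, test_function Omega (r l)) -> forall l, continuous (r l).
  by move=> tr l; have [/(_ 0%N)] := tr l.
have cD r b : (forall l, test_function Omega (r l)) ->
    forall l, continuous (fun x => 'D_(unit_row R b) (r l) x).
  by move=> tr l; have [/(_ 1%N) [_ /(_ b) []]] := tr l.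
exists (fun l x => c * psi l x + chi l x); split => [l||b].
- exact: test_function_lin.
- by apply: cvg_L1_lin => //; exact: cT.
- rewrite (_ : (fun l => _) = (fun l => \int[leb]_(x in Omega)
    `|c * 'D_(unit_row R b) (psi l) x + 'D_(unit_row R b) (chi l) x
      - (c * gp b x + gq b x)|%:E)%E).
    by apply: cvg_L1_lin => //; exact: cD.
  apply/funext => l; apply: eq_integral => x _; rewrite derive_lin//.
    by have [] := tpsi l.
  by have [] := tchi l.
Qed.

Lemma W110_0 : W110 Omega (fun=> 0).
Proof.
have i0 : L1 Omega (fun=> 0) by exact: integrable0.
have t0 : test_function Omega (fun=> 0).
  split; last by exists set0; [split; [exact: compact0|exact: sub0set]|].
  suff h k (c : R) : @Cn R n.+1 k (fun=> c) by move=> k; exact: h.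
  elim: k c => [|k IH] c /=; first exact: cst_continuous.
  split; first exact: cst_continuous.
  move=> b; split => [x|]; first exact: derivable_cst.
  under eq_fun do rewrite derive_cst; exact: IH.
split => //; exists (fun _ _ => 0); split => //.
  move=> psi b _; under eq_Rintegral do rewrite mul0r.
  by under [in RHS]eq_Rintegral do rewrite mul0r; rewrite Rintegral_0 oppr0.
exists (fun _ _ => 0); split => // [|b].
  under eq_fun do under eq_integral do rewrite subrr normr0.
  by under eq_fun do rewrite integral0; exact: cvg_cst.
under eq_fun do under eq_integral do rewrite derive_cst subrr normr0.
by under eq_fun do rewrite integral0; exact: cvg_cst.
Qed.

End linear_closure.

(** * The discrete spaces are linear and normed by the broken gradient *)

Section subspaces.
Context {R : realType} {n : nat} {Omega : set 'rV[R]_n.+1} {N : nat}.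
Context {tri : 'I_N -> 'M[R]_(n.+2, n.+1)}.
Hypotheses (htri : triangulation Omega tri) (oO : open Omega) (bO : bounded_set Omega).
Implicit Types w : 'I_N -> 'rV[R]_n.+1 -> R.

Let mO : measurable Omega.
Proof. exact: open_measurable_row. Qed.

Let muO : (leb R n.+1 Omega < +oo)%E.
Proof. exact: leb_bounded. Qed.

Lemma lagrange_comp_lin w1 w2 c : lagrange_comp Omega tri w1 ->
  lagrange_comp Omega tri w2 -> lagrange_comp Omega tri (fun i x => c * w1 i x + w2 i x).
Proof.
rewrite /lagrange_comp => h1 h2.
have -> : piecewise tri (fun i x => c * w1 i x + w2 i x) =
    (fun x => c * piecewise tri w1 x + piecewise tri w2 x).
  by apply/funext => x; exact: piecewise_lin.
exact: W110_lin.
Qed.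

Lemma cr_comp_lin w1 w2 c : cr_comp Omega tri w1 ->
  cr_comp Omega tri w2 -> cr_comp Omega tri (fun i x => c * w1 i x + w2 i x).
Proof.
move=> [h1 b1] [h2 b2]; split=> [i j k l Fij Fb|i k Fb].
  by rewrite (h1 _ _ _ _ Fij)// (h2 _ _ _ _ Fij).
by rewrite b1// b2// mulr0 addr0.
Qed.

Lemma lagrange_comp0 : lagrange_comp Omega tri (fun _ => fun=> 0).
Proof.
rewrite /lagrange_comp; have -> : piecewise tri (fun _ => fun=> 0) = (fun=> 0).
  by apply/funext => x; rewrite /piecewise; case: pickP.
exact: W110_0.
Qed.

Lemma cr_comp0 : cr_comp Omega tri (fun _ => fun=> 0).
Proof. by []. Qed.

Lemma Pk_subspace k m : Defs.subspace (@Pk R n N k m).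
Proof.
split=> [i a|c u v Pu Pv i a]; last exact: (polynomial_fun_lin c (Pu i a) (Pv i a)).
exists (fun=> 0) => x; rewrite big1// => e _; exact: mul0r.
Qed.

Lemma subspaceI m (U V : set (broken R n N m)) :
  Defs.subspace U -> Defs.subspace V -> Defs.subspace (U `&` V).
Proof.
move=> [U0 Ul] [V0 Vl]; split=> [//|c u v [Uu Vu] [Uv Vv]].
by split; [exact: Ul|exact: Vl].
Qed.

Lemma comp_subspace m (P : 'I_m -> ('I_N -> 'rV[R]_n.+1 -> R) -> Prop) :
  (forall a, P a (fun _ => fun=> 0)) ->
  (forall a w1 w2 c, P a w1 -> P a w2 -> P a (fun i x => c * w1 i x + w2 i x)) ->
  Defs.subspace [set v : broken R n N m | forall a, P a (fun i => v i a)].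
Proof.
move=> P0 Pl; split=> [a|c u v Vu Vv a]; first exact: P0.
exact: (Pl a _ _ c (Vu a) (Vv a)).
Qed.

Lemma lagrange_subspace k m : Defs.subspace (@Defs.lagrange R n Omega N tri k m).
Proof.
apply: subspaceI; first exact: Pk_subspace.
apply: (comp_subspace (P := fun=> lagrange_comp Omega tri)) => [_|_ w1 w2 c].
  exact: lagrange_comp0.
exact: lagrange_comp_lin.
Qed.

Lemma crouzeix_raviart_subspace m : Defs.subspace (@crouzeix_raviart R n Omega N tri m).
Proof.
apply: subspaceI; first exact: Pk_subspace.
apply: (comp_subspace (P := fun=> cr_comp Omega tri)) => [_|_ w1 w2 c].
  exact: cr_comp0.
exact: cr_comp_lin.
Qed.

Let dpiece0 m i a b x : dpiece (0 : broken R n N m) i a b x = 0.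
Proof. exact: derive_cst. Qed.

(** The divergence constraint is intersected with [Pk k] since differentiable pieces and bounded
    integrands are what makes it linear in [v]. *)
Lemma divh_free_subspace k :
  Defs.subspace ([set v | Pk k v] `&` [set v | divh_free tri v]).
Proof.
have [P0 Pl] := Pk_subspace k n.+1.
split=> [|c u v [Pu du] [Pv dv]].
  split; first exact: P0.
  move=> p _; rewrite big1// => i _.
  have e x : p i ord0 x * \sum_a dpiece (0 : broken R n N n.+1) i a a x = 0.
    by rewrite big1 ?mulr0// => a _; exact: dpiece0.
  by under eq_Rintegral do rewrite e; exact: Rintegral_0.
split; first exact: Pl.
move=> p Pp; pose I (w : broken R n N n.+1) := \sum_i \int[leb R n.+1]_(x in simplex tri i)
  (p i ord0 x * \sum_a dpiece w i a a x).
have Iu : I u = 0 by exact: (du p Pp).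
have Iv : I v = 0 by exact: (dv p Pp).
suff : I (c *: u + v) = c * I u + I v by rewrite Iu Iv mulr0 addr0.
rewrite /I mulr_sumr -big_split/=; apply: eq_bigr => i _.
have mS := measurable_simplex htri i; have bS := bounded_simplex htri bO i.
have muS := leb_bounded mS bS.
have bint (w : broken R n N n.+1) : Pk k w ->
    bm (simplex tri i) (fun x => p i ord0 x * \sum_a dpiece w i a a x).
  move=> Pw; apply: bmM; last by apply: bm_sum => a; exact: (bm_dpiece i a a bS Pw).
  by apply: bm_continuous => //; have [] := polynomial_fun_Cn1 (Pp i ord0).
rewrite -(bm_Rintegral_lin mS muS c (bint u Pu) (bint v Pv)).
apply: eq_Rintegral => x _.
under eq_bigr do rewrite (dpiece_lin _ _ _ _ _ Pu Pv).
by rewrite big_split/= -mulr_sumr mulrDr mulrCA.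
Qed.

Lemma crouzeix_raviart_div_subspace : Defs.subspace (@crouzeix_raviart_div R n Omega N tri).
Proof.
have -> : @crouzeix_raviart_div R n Omega N tri =
    @crouzeix_raviart R n Omega N tri n.+1 `&` ([set v | Pk 1 v] `&` [set v | divh_free tri v]).
  by apply/seteqP; split=> v; [move=> [[? ?] ?]|move=> [[? ?] [? ?]]].
by apply: subspaceI; [exact: crouzeix_raviart_subspace|exact: divh_free_subspace].
Qed.

Lemma kouhia_stenberg_subspace : Defs.subspace (@kouhia_stenberg R n Omega N tri).
Proof.
pose P a w := if a == ord0 :> 'I_n.+1 then lagrange_comp Omega tri w else cr_comp Omega tri w.
have -> : @kouhia_stenberg R n Omega N tri =
    [set v | forall a, P a (fun i => v i a)] `&` ([set v | Pk 1 v] `&` [set v | divh_free tri v]).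
  by apply/seteqP; split=> v; [move=> []|move=> [? []]].
apply: subspaceI; last exact: divh_free_subspace.
apply: (comp_subspace (P := P)) => [a|a w1 w2 c]; rewrite /P; case: ifP => _.
- exact: lagrange_comp0.
- exact: cr_comp0.
- exact: lagrange_comp_lin.
- exact: cr_comp_lin.
Qed.

Lemma taylor_hood_subspace : Defs.subspace (@taylor_hood R n Omega N tri).
Proof.
have [L0 Ll] := lagrange_subspace 2 n.+1.
split=> [|c u v [Lu tu] [Lv tv]].
  split; first exact: L0.
  have e p x : piecewise tri (fun i => p i ord0) x *
      \tr (gradh tri (0 : broken R n N n.+1) x) = 0.
    rewrite /mxtrace big1 ?mulr0// => a _; rewrite mxE /piecewise.
    by case: pickP => // i _; exact: dpiece0.
  by move=> p _ _; under eq_Rintegral do rewrite e; exact: Rintegral_0.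
split; first exact: Ll.
move=> p Pp cp.
transitivity (c * \int[leb R n.+1]_(x in Omega)
      (piecewise tri (fun i => p i ord0) x * \tr (gradh tri u x)) +
    \int[leb R n.+1]_(x in Omega)
      (piecewise tri (fun i => p i ord0) x * \tr (gradh tri v x))); last first.
  by rewrite (tu p Pp cp) (tv p Pp cp) mulr0 addr0.
have bint (w : broken R n N n.+1) : Pk 2 w ->
    bm Omega (fun x => piecewise tri (fun i => p i ord0) x * \tr (gradh tri w x)).
  move=> Pw; apply: bmM; last by apply: bm_sum => a; exact: (bm_gradh htri bO a a Pw).
  apply: (bm_piecewise htri) => i; apply: bm_continuous => //.
  by have [] := polynomial_fun_Cn1 (Pp i ord0).
have [Pu _] := Lu; have [Pv _] := Lv.
rewrite -(bm_Rintegral_lin mO muO c (bint u Pu) (bint v Pv)).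
apply: eq_Rintegral => x _.
by rewrite (gradh_lin _ _ Pu Pv) mxtraceD mxtraceZ mulrDr mulrCA.
Qed.

Lemma discrete_space_norm m (V : set (broken R n N m)) : discrete_space Omega tri V ->
  [/\ Defs.subspace V, exists k, V `<=` @Pk R n N k m &
    forall v, V v -> {ae leb R n.+1, forall x, Omega x -> gradh tri v x = 0} -> v = 0].
Proof.
case=> {m V} [k m|m||||k m V sV Vk nV].
- split; [exact: lagrange_subspace|by exists k => v []|move=> v [Pv lv]].
  by apply: (gradh_eq0 htri oO bO Pv) => a; left.
- split; [exact: crouzeix_raviart_subspace|by exists 1%N => v []|move=> v [Pv cv]].
  by apply: (gradh_eq0 htri oO bO Pv) => a; right.
- split; [exact: taylor_hood_subspace|by exists 2%N => v [[]]|move=> v [[Pv lv] _]].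
  by apply: (gradh_eq0 htri oO bO Pv) => a; left.
- split; [exact: crouzeix_raviart_div_subspace|by exists 1%N => v [[]]|move=> v [[Pv cv] _]].
  by apply: (gradh_eq0 htri oO bO Pv) => a; right.
- move=> _; split; [exact: kouhia_stenberg_subspace|by exists 1%N => v []|move=> v [Pv h _]].
  by apply: (gradh_eq0 htri oO bO Pv) => a; have := h a; case: ifP; [left|right].
- by split=> //; exists k.
Qed.

End subspaces.

(** A maximal independent family in [V]: its length is bounded by the number of generators, since
    independent vectors have independent coefficient rows, and by maximality it spans. The
    generators may lie outside [V]. *)
Lemma subspace_basis {R : realType} (W : lmodType R) (I : finType) (g : I -> W)
    (V : set W) :
  V 0 -> (forall c u v, V u -> V v -> V (c *: u + v)) ->
  (forall v, V v -> exists c : I -> R, v = \sum_i c i *: g i) ->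
  exists r (e : 'I_r -> W), [/\ forall j, V (e j),
    forall l : 'rV[R]_r, \sum_j l ord0 j *: e j = 0 -> l = 0 &
    forall v, V v -> exists l : 'rV[R]_r, v = \sum_j l ord0 j *: e j].
Proof.
move=> V0 Vl Vg.
pose indep r (e : 'I_r -> W) := (forall j, V (e j)) /\
  forall l : 'rV[R]_r, \sum_j l ord0 j *: e j = 0 -> l = 0.
have bound r : `[< exists e, @indep r e >] -> (r <= #|I|)%N.
  move=> /asboolP[e [Ve ie]].
  have /choice[c hc] : forall j, exists c : I -> R, e j = \sum_i c i *: g i.
    by move=> j; exact: Vg.
  pose M : 'M[R]_(r, #|I|) := \matrix_(j, t) c j (enum_val t).
  suff /eqP <- : row_free M by exact: rank_leq_col.
  apply: inj_row_free => l lM; apply: ie.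
  under eq_bigr do rewrite hc scaler_sumr.
  rewrite exchange_big/= big1// => i _.
  under eq_bigr do rewrite scalerA.
  rewrite -scaler_suml; move/rowP: lM => /(_ (enum_rank i)).
  rewrite !mxE; under eq_bigr do rewrite !mxE enum_rankK.
  by move=> ->; rewrite scale0r.
have ex : exists r, `[< exists e, @indep r e >].
  exists 0%N; apply/asboolP; exists (fun=> 0); split=> [[]//|l _].
  by apply/rowP => -[].
have [r /asboolP[e [Ve ie]] rmax] := ex_maxnP ex bound.
exists r, e; split=> // v Vv; apply: contrapT => nv.
suff : (r.+1 <= r)%N by rewrite ltnn.
apply: rmax; apply/asboolP.
exists (fun j => if unlift ord0 j is Some i then e i else v); split=> [j|l].
  by case: unliftP.
rewrite big_ord_recl/= unlift_none.
under eq_bigr do rewrite liftK.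
have [l0|l0] := eqVneq (l ord0 ord0) 0.
  rewrite l0 scale0r add0r => h.
  have /ie/rowP hl : \sum_j (\row_j l ord0 (lift ord0 j)) ord0 j *: e j = 0.
    by rewrite -[RHS]h; apply: eq_bigr => j _; rewrite mxE.
  apply/rowP => j; rewrite !mxE; case: (unliftP ord0 j) => [i ->|->//].
  by have := hl i; rewrite !mxE.
move=> /eqP; rewrite addr_eq0 => /eqP h; exfalso; apply: nv.
exists (\row_j (- (l ord0 ord0)^-1 * l ord0 (lift ord0 j))).
rewrite -[LHS]scale1r -(mulVf l0) -scalerA h scalerN scaler_sumr -sumrN.
by apply: eq_bigr => j _; rewrite mxE mulNr scaleNr scalerA.
Qed.

Lemma Pk_basis {R : realType} n N m k (V : set (broken R n N m)) :
  Defs.subspace V -> V `<=` @Pk R n N k m ->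
  exists r (e : 'I_r -> broken R n N m), [/\ forall j, V (e j),
    forall l : 'rV[R]_r, \sum_j l ord0 j *: e j = 0 -> l = 0 &
    forall v, V v -> exists l : 'rV[R]_r, v = \sum_j l ord0 j *: e j].
Proof.
move=> [V0 Vl] VP.
pose X := {ffun 'I_n.+1 -> 'I_k.+1}.
(* One monomial in one component on one simplex; index triples of total degree above [k] are given
   the zero function, so that the index type is a plain product. *)
pose g (t : 'I_N * 'I_m * X) : broken R n N m := fun i a x =>
  if (i == t.1.1) && (a == t.1.2) && (\sum_b t.2 b <= k)%N
  then \prod_b x ord0 b ^+ t.2 b else 0.
apply: (subspace_basis (g := g)) => // v /VP Pv.
have /choice[c hc] : forall p : 'I_N * 'I_m, exists c : X -> R, forall x,
    v p.1 p.2 x = \sum_(e : X | (\sum_b e b <= k)%N) c e * \prod_b x ord0 b ^+ e b.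
  by move=> [i a]; exact: Pv.
exists (fun t => c t.1 t.2).
apply/funext => i; apply/funext => a; apply/funext => x.
rewrite !fct_sumE.
rewrite (hc (i, a)) big_mkcond.
rewrite -(pair_bigA _ (fun p e => (c p e *: g (p, e)) i a x))/=.
rewrite (bigD1 (i, a))//= [X in _ + X]big1 ?addr0 => [|[i' a'] ne].
  apply: eq_bigr => e _; rewrite -[RHS]/(c (i, a) e * g (i, a, e) i a x) /g/= !eqxx/=.
  by case: ifP => // _; rewrite mulr0.
apply: big1 => e _; rewrite -[LHS]/(c (i', a') e * g (i', a', e) i a x) /g/=.
have -> : (i == i') && (a == a') = false; last by rewrite mulr0.
by apply/negbTE; apply: contra ne => /andP[/eqP-> /eqP->].
Qed.

(** * Duality *)

Section pointwise_duality.
Context {R : realType} {phi dphi : R -> R} (H : nfunction phi dphi) {m d : nat}.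
Implicit Types A S : 'M[R]_(m, d).

Lemma fenchel_young A S : 0 <= phi (frob A) + cj phi (frob S) - mxdot S A.
Proof.
rewrite subr_ge0 (le_trans (mxdot_le_frob S A))//.
exact: (young H (frob_ge0 S) (frob_ge0 A)).
Qed.

(** Testing with the multiple of [S] of Frobenius norm [t] turns the inequality for matrices into
    the scalar one under the supremum defining [cj]. For [S = 0] the matrix 0 serves, as [phi] is
    nondecreasing. *)
Lemma fenchel_young_subgradient A S :
  (forall A', phi (frob A) + mxdot S (A' - A) <= phi (frob A')) ->
  phi (frob A) + cj phi (frob S) - mxdot S A = 0.
Proof.
move=> sub; apply/eqP; rewrite eq_le fenchel_young andbT.
have {}sub A' : mxdot S A' - phi (frob A') <= mxdot S A - phi (frob A).
  by have := sub A'; rewrite mxdotDr mxdotNr; lra.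
suff : cj phi (frob S) <= mxdot S A - phi (frob A) by lra.
apply: (cj_le H (frob_ge0 S)) => t t0.
have [S0|S0] := eqVneq (frob S) 0.
  have := sub 0; rewrite frob0 (frob_eq0 S0) mxdotC mxdot0r frob0 => h.
  by have := nfun_homo H (lexx 0) t0; lra.
have := sub ((t / frob S) *: S); rewrite mxdotZr -frob_sqr frobZ.
rewrite ger0_norm ?divr_ge0 ?frob_ge0// divfK// expr2 mulrA divfK//.
by rewrite [t * _]mulrC.
Qed.

(** The expression is the sum of the defects in the Young and Cauchy-Schwarz inequalities, so each
    of them vanishes. *)
Lemma fenchel_young_eq A S : phi (frob A) + cj phi (frob S) - mxdot S A = 0 ->
  phi (frob A) + cj phi (frob S) <= frob S * frob A /\
  frob A *: S = frob S *: A.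
Proof.
move=> E; have h1 := mxdot_le_frob S A.
have h2 := young H (frob_ge0 S) (frob_ge0 A).
split; first lra.
by apply: mxdot_eq_frob; lra.
Qed.

Lemma parallel_scale A S : frob A *: S = frob S *: A ->
  (frob A = 0 -> frob S = 0) -> S = (frob S / frob A) *: A.
Proof.
move=> E h; have [A0|A0] := eqVneq (frob A) 0.
  by rewrite A0 invr0 mulr0 scale0r; apply: frob_eq0; exact: h.
by rewrite mulrC -scalerA -E scalerA mulVf// scale1r.
Qed.

End pointwise_duality.

Lemma bm_mxb {R : realType} d (T : measurableType d) (D : set T) m n
    (s : T -> 'M[R]_(m, n)) : (forall a b, bm D (fun x => s x a b)) ->
  exists C, 0 <= C /\ mxb D s C.
Proof.
move=> bs; have [_ [C hC]] :=
  bm_sum (index_enum _) (fun a => bm_sum (index_enum _) (fun b => bm_norm (bs a b))).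
exists `|C|; split=> // x Dx; rewrite (le_trans (frob_le_sum _))//.
rewrite (le_trans _ (ler_norm C))// (le_trans (ler_norm _))//.
exact: (hC x Dx).
Qed.

Lemma integrable_mxdot {R : realType} d (T : measurableType d)
    (mu : {measure set T -> \bar R}) (D : set T) m n (s A : T -> 'M[R]_(m, n)) :
  measurable D -> (forall a b, mu.-integrable D (fun x => (s x a b)%:E)) ->
  (forall a b, bm D (fun x => A x a b)) ->
  mu.-integrable D (fun x => (mxdot (s x) (A x))%:E).
Proof.
move=> mD is_ bA.
have -> : (fun x => (mxdot (s x) (A x))%:E) =
    (fun x => \sum_a (\sum_b (A x a b)%:E * (s x a b)%:E))%E.
  apply/funext => x; rewrite /mxdot -sumEFin; apply: eq_bigr => a _.
  by rewrite -sumEFin; apply: eq_bigr => b _; rewrite mulrC EFinM.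
have := @integrable_sum _ _ _ mu D mD _ (index_enum 'I_m) xpredT
  (fun a x => \sum_b (A x a b)%:E * (s x a b)%:E)%E; apply => a _.
have := @integrable_sum _ _ _ mu D mD _ (index_enum 'I_n) xpredT
  (fun b x => (A x a b)%:E * (s x a b)%:E)%E; apply => b _.
have [mA [M hM]] := bA a b.
have := @integrableMr _ _ _ mu D mD (fun x => A x a b) _ mA _ (is_ a b); apply.
exists M; split; first exact: num_real.
by move=> K MK x Dx; apply: (le_trans (hM x Dx)); exact: ltW.
Qed.

(** * Weak and strong duality of the discrete problem *)

Section duality.
Context {R : realType} {n : nat} {Omega : set 'rV[R]_n.+1} {N : nat}.
Context {tri : 'I_N -> 'M[R]_(n.+2, n.+1)} {m : nat}.
Context {V : set (broken R n N m)} {f : broken R n N m -> R} {phi dphi : R -> R}.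
Hypotheses (hOmega : lipschitz_domain Omega) (htri : triangulation Omega tri).
Hypotheses (hV : discrete_space Omega tri V) (hf : functional_on V f).
Hypothesis (H : nfunction phi dphi).
Notation leb := (Defs.leb R n.+1).
Notation primal := (primal Omega tri f phi).
Notation dual := (dual Omega phi).
Notation equilibrated := (equilibrated Omega tri V f).

Let oO : open Omega := dom_open hOmega.
Let bO : bounded_set Omega := dom_bounded hOmega.

Let mO : measurable Omega.
Proof. exact: open_measurable_row. Qed.

Let muO : (leb Omega < +oo)%E.
Proof. exact: leb_bounded. Qed.

Definition gap (v : broken R n N m) (tau : 'rV[R]_n.+1 -> 'M[R]_(m, n.+1)) x :=
  phi (frob (gradh tri v x)) + cj phi (frob (tau x)) - mxdot (tau x) (gradh tri v x).

Let bm_gradhV v : V v -> forall a b, bm Omega (fun x => gradh tri v x a b).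
Proof.
have [_ [k Vk] _] := discrete_space_norm htri oO bO hV.
by move=> /Vk Pv a b; exact: (bm_gradh htri bO a b Pv).
Qed.

Let bm_phi_gradh v : V v -> bm Omega (fun x => phi (frob (gradh tri v x))).
Proof.
move=> Vv; have [C [_ hC]] := bm_mxb (bm_gradhV Vv).
by apply: (bm_phi_frob H _ hC) => a b; have [] := bm_gradhV Vv a b.
Qed.

Lemma primalE v : V v -> primal v =
  (\int[leb]_(x in Omega) phi (frob (gradh tri v x)) - f v)%:E.
Proof.
by move=> Vv; rewrite /Defs.primal -(EFin_bm_Rintegral mO muO (bm_phi_gradh Vv)).
Qed.

Lemma dualE (tau : _ -> 'M[R]_(m, n.+1)) :
  dual tau = (\int[leb]_(x in Omega) (cj phi (frob (tau x)))%:E)%E.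
Proof.
by apply: eq_integral => x _; rewrite (conjugate_EFin H)// frob_ge0.
Qed.

Let mxm_L1 (tau : _ -> 'M[R]_(m, n.+1)) :
  (forall a b, L1 Omega (fun x => tau x a b)) -> mxm Omega tau.
Proof. by move=> it a b; apply/measurable_EFinP; exact: measurable_int (it a b). Qed.

Let measurable_cj (tau : _ -> 'M[R]_(m, n.+1)) : (forall a b, L1 Omega (fun x => tau x a b)) ->
  measurable_fun Omega (fun x => cj phi (frob (tau x))).
Proof.
move=> it; apply: (measurable_nondecreasing_comp (measurable_frob (mxm_L1 it))).
  by move=> x; exact: frob_ge0.
by move=> t r t0 tr; exact: (cj_homo H).
Qed.

Let integrable_stress_gradh v tau : V v -> equilibrated tau ->
  leb.-integrable Omega (fun x => (mxdot (tau x) (gradh tri v x))%:E).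
Proof. by move=> Vv [it _]; apply: integrable_mxdot => //; exact: bm_gradhV. Qed.

Let integrable_cj tau : equilibrated tau -> (dual tau < +oo)%E ->
  leb.-integrable Omega (fun x => (cj phi (frob (tau x)))%:E).
Proof.
move=> [it _] fin; apply/integrableP; split.
  by apply/measurable_EFinP; exact: measurable_cj.
rewrite dualE in fin; rewrite (le_lt_trans _ fin)//.
rewrite (@eq_integral _ _ _ leb Omega (fun x => (cj phi (frob (tau x)))%:E))// => x _.
by rewrite gee0_abs// lee_fin (cj_ge0 H)// frob_ge0.
Qed.

(** Finite dual energy makes the conjugate term integrable, so the integral splits; by equilibrium
    the mixed term is [f v], the load term of [primal]. *)
Lemma gap_integral v tau : V v -> equilibrated tau -> (dual tau < +oo)%E ->
  leb.-integrable Omega (fun x => (gap v tau x)%:E) /\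
  (\int[leb]_(x in Omega) (gap v tau x)%:E = primal v + dual tau)%E.
Proof.
move=> Vv etau fin; have [_ /(_ v Vv) fv] := etau.
have i1 := bm_integrable mO muO (bm_phi_gradh Vv).
have i2 := integrable_cj etau fin.
have i3 := integrable_stress_gradh Vv etau.
have i12 := integrableD mO i1 i2.
have e : (fun x => (gap v tau x)%:E) = (fun x => (EFin \o (fun x => phi (frob (gradh tri v x)))) x +
  (cj phi (frob (tau x)))%:E - (mxdot (tau x) (gradh tri v x))%:E)%E.
  by apply/funext => x; rewrite /gap EFinB EFinD.
rewrite e; split; first exact: (integrableB mO i12 i3).
rewrite (integralB mO i12 i3) (integralD mO i1 i2) -dualE.
have -> : (\int[leb]_(x in Omega) (mxdot (tau x) (gradh tri v x))%:E)%E = (f v)%:E.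
  rewrite -fv /Rintegral fineK//; exact: integrable_fin_num.
by rewrite /Defs.primal addeAC.
Qed.

Let gap_ge0 v tau x : 0 <= gap v tau x.
Proof. exact: (fenchel_young H). Qed.

Lemma weak_duality v tau : V v -> equilibrated tau -> (- primal v <= dual tau)%E.
Proof.
move=> Vv etau; have [fin|] := ltP (dual tau) +oo%E; last exact: le_trans (leey _).
have [_ E] := gap_integral Vv etau fin.
have : (0 <= primal v + dual tau)%E.
  by rewrite -E; apply: integral_ge0 => x _; rewrite lee_fin.
rewrite (primalE Vv); case: (dual tau) => [r| |].
- by rewrite -EFinD -EFinN !lee_fin; lra.
- by move=> _; exact: leey.
- by rewrite addeNy leeNy_eq.
Qed.

Lemma optimality v tau : V v -> equilibrated tau -> dual tau = (- primal v)%E ->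
  {ae leb, forall x, Omega x -> gap v tau x = 0}.
Proof.
move=> Vv etau E; have pE := primalE Vv.
have fin : (dual tau < +oo)%E by rewrite E pE ltry.
have [ig Eg] := gap_integral Vv etau fin.
have mg : measurable_fun Omega (fun x => (gap v tau x)%:E) by exact: measurable_int ig.
have : (\int[leb]_(x in Omega) `|(gap v tau x)%:E| = 0)%E.
  under eq_integral do rewrite gee0_abs ?lee_fin//.
  by rewrite Eg E pE subee.
move=> /(ae_eq_integral_abs leb mO mg); apply: filterS => x h Ox.
by have [] := h Ox.
Qed.

(** The dual energy is not known to be finite beforehand, so [gap_integral] does not apply. Zero gap
    instead writes the conjugate term as a difference of two integrable functions. *)
Lemma optimality_dual v tau : V v -> equilibrated tau ->
  {ae leb, forall x, Omega x -> gap v tau x = 0} -> dual tau = (- primal v)%E.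
Proof.
move=> Vv etau g0; have [it /(_ v Vv) fv] := etau.
have i1 := bm_integrable mO muO (bm_phi_gradh Vv).
have i3 := integrable_stress_gradh Vv etau.
rewrite dualE.
pose g x := ((mxdot (tau x) (gradh tri v x))%:E -
   (EFin \o (fun x => phi (frob (gradh tri v x)))) x)%E.
have -> : (\int[leb]_(x in Omega) (cj phi (frob (tau x)))%:E = \int[leb]_(x in Omega) g x)%E.
  apply: (ae_eq_integral g) => //.
  - by apply/measurable_EFinP; exact: measurable_cj.
  - exact: measurable_int (integrableB mO i3 i1).
  - apply: filterS g0 => x h Ox; rewrite /g /= -EFinB; congr (_%:E).
    by move: (h Ox); rewrite /gap; lra.
rewrite /g.
rewrite (integralB mO i3 i1) primalE//.
have -> : (\int[leb]_(x in Omega) (mxdot (tau x) (gradh tri v x))%:E)%E = (f v)%:E.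
  rewrite -fv /Rintegral fineK//; exact: integrable_fin_num.
by rewrite -(EFin_bm_Rintegral mO muO (bm_phi_gradh Vv)) -EFinB -EFinN opprB.
Qed.

Lemma functional_sum r (e : 'I_r -> broken R n N m) (s : seq 'I_r) (l : 'rV[R]_r) :
  (forall j, V (e j)) ->
  V (\sum_(j <- s) l ord0 j *: e j) /\
  f (\sum_(j <- s) l ord0 j *: e j) = \sum_(j <- s) l ord0 j * f (e j).
Proof.
have [[V0 Vl] _ _] := discrete_space_norm htri oO bO hV.
move=> Ve; elim: s => [|j s [IHV IHf]].
  rewrite !big_nil; split=> //; have := hf 1 V0 V0.
  by rewrite scale1r addr0 mul1r => /eqP; rewrite -subr_eq0 opprD addNKr oppr_eq0 => /eqP.
by rewrite !big_cons; split; [exact: Vl|rewrite hf// IHf].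
Qed.

Lemma gradh_sum r (e : 'I_r -> broken R n N m) (l : 'rV[R]_r) x :
  (forall j, V (e j)) ->
  gradh tri (\sum_j l ord0 j *: e j) x = comb (fun j => gradh tri (e j)) l x.
Proof.
have [_ [k Vk] _] := discrete_space_norm htri oO bO hV.
have [P0 Pl] := @Pk_subspace R n N k m.
move=> Ve; suff h (s : seq 'I_r) : Pk k (\sum_(j <- s) l ord0 j *: e j) /\
    gradh tri (\sum_(j <- s) l ord0 j *: e j) x = \sum_(j <- s) l ord0 j *: gradh tri (e j) x.
  by have [] := h (index_enum _).
elim: s => [|j s [IHP IHg]].
  rewrite !big_nil; split=> //; apply/matrixP => a b; rewrite !mxE /piecewise.
  by case: pickP => // i _; exact: derive_cst.
rewrite !big_cons; split; first by apply: Pl => //; exact/Vk/Ve.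
by rewrite (gradh_lin _ _ (Vk _ (Ve j)) IHP) IHg.
Qed.

(** A basis of [V] carries the problem to coefficient vectors, where [penergy_minimizer] and
    [stress_exists] apply; the load identities for the basis functions extend to [V] by
    linearity. *)
Lemma strong_duality : exists u sigma, [/\ V u, equilibrated sigma,
  (forall v, V v -> (primal u <= primal v)%E) & dual sigma = (- primal u)%E].
Proof.
have [sV [k Vk] nV] := discrete_space_norm htri oO bO hV.
have [r [e [Ve ie Vspan]]] := Pk_basis sV Vk.
pose S (l : 'rV[R]_r) : broken R n N m := \sum_j l ord0 j *: e j.
have VS l : V (S l) by have [] := functional_sum (index_enum _) l Ve.
have fS l : f (S l) = mxdot l (\row_j f (e j)).
  have [_ ->] := functional_sum (index_enum _) l Ve.
  by rewrite mxdot_row; apply: eq_bigr => j _; rewrite mxE.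
have gS l x : gradh tri (S l) x = comb (fun j => gradh tri (e j)) l x.
  exact: gradh_sum.
pose G j := gradh tri (e j).
have mG j : mxm Omega (G j) by move=> a b; have [] := bm_gradhV (Ve j) a b.
have /choice[C hC] : forall j, exists C, 0 <= C /\ mxb Omega (G j) C.
  by move=> j; apply: bm_mxb; exact: bm_gradhV.
pose B := \sum_j C j.
have B0 : 0 <= B by apply: sumr_ge0 => j _; case: (hC j).
have bG j : mxb Omega (G j) B.
  move=> x Ox; rewrite (le_trans ((hC j).2 x Ox))// /B (bigD1 j)//= lerDl.
  by apply: sumr_ge0 => i _; case: (hC i).
have pS l : primal (S l) = (penergy leb Omega phi G l - mxdot l (\row_j f (e j)))%:E.
  rewrite primalE// fS; congr ((_ - _)%:E).
  by apply: eq_Rintegral => x _; rewrite gS.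
have indep (l : 'rV[R]_r) : {ae leb, forall x, Omega x -> comb G l x = 0} -> l = 0.
  move=> h; apply: ie; apply: (nV (S l) (VS l)).
  by apply: filterS h => x h Ox; rewrite gS h.
have [u umin] := penergy_minimizer mO muO H (\row_j f (e j)) mG B0 bG indep.
have [s [ms is_ fs sub]] := stress_exists mO muO H mG B0 bG umin.
have es : equilibrated s.
  split=> // v /Vspan[l ->]; rewrite -/(S l) fS mxdot_row.
  have iG j : leb.-integrable Omega (fun x => (mxdot (s x) (G j x))%:E).
    by apply: integrable_mxdot => //; exact: bm_gradhV.
  rewrite /Rintegral.
  under eq_integral => x _.
    rewrite gS /comb mxdot_sumr -sumEFin.
    under eq_bigr do rewrite mxdotZr EFinM.
    over.
  have iZ j : leb.-integrable Omega (fun x => (l ord0 j)%:E * (mxdot (s x) (G j x))%:E)%E.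
    exact: (integrableZl mO _ (iG j)).
  rewrite (integral_sum mO iZ).
  rewrite (eq_bigr (fun j => (l ord0 j * (\row_j f (e j)) ord0 j)%:E)) => [|j _].
    by rewrite sumEFin.
  rewrite (integralZl mO (iG j)) -(fs j) /Rintegral.
  by rewrite EFinM fineK//; exact: (integrable_fin_num mO (iG j)).
exists (S u), s; split=> //.
  by move=> v /Vspan[l ->]; rewrite -/(S l) !pS lee_fin.
apply: optimality_dual => //; apply: filterS sub => x h Ox.
by apply: (fenchel_young_subgradient H) => A'; rewrite gS; exact: h.
Qed.

End duality.

(** The formulas with [dphi] and [dconjugate] are asserted where these right-continuous functions
    are also left-continuous. At a jump they give just one element of a subdifferential, and the
    actual minimizers may realize another; the last two clauses state the relations with a suitable
    element, almost everywhere. *)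
Theorem theorem3p1 (R : realType) (n : nat) (Omega : set 'rV[R]_n.+1)
    (N : nat) (tri : 'I_N -> 'M[R]_(n.+2, n.+1))
    (m : nat) (V : set (broken R n N m)) (f : broken R n N m -> R)
    (phi dphi : R -> R)
    (hOmega : lipschitz_domain Omega)
    (htri : triangulation Omega tri)
    (hV : discrete_space Omega tri V)
    (hf : functional_on V f)
    (hphi : nfunction phi dphi) :
  [/\ exists u, argmin V (primal Omega tri f phi) u,
      exists sigma, argmin (equilibrated Omega tri V f) (dual Omega phi) sigma &
      forall u sigma,
        argmin V (primal Omega tri f phi) u ->
        argmin (equilibrated Omega tri V f) (dual Omega phi) sigma ->
        [/\ primal Omega tri f phi u = (- dual Omega phi sigma)%E,
            {ae leb R n.+1, forall x, Omega x ->
               leftcont dphi (frob (gradh tri u x)) ->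
               sigma x = (dphi (frob (gradh tri u x)) / frob (gradh tri u x))
                           *: gradh tri u x},
            {ae leb R n.+1, forall x, Omega x ->
               leftcont (dconjugate dphi) (frob (sigma x)) ->
               gradh tri u x = (dconjugate dphi (frob (sigma x)) / frob (sigma x))
                                 *: sigma x},
            {ae leb R n.+1, forall x, Omega x ->
               exists2 s, subgradient (EFin \o phi) (frob (gradh tri u x)) s &
               sigma x = (s / frob (gradh tri u x)) *: gradh tri u x} &
            {ae leb R n.+1, forall x, Omega x ->
               exists2 r, subgradient (conjugate phi) (frob (sigma x)) r &
               gradh tri u x = (r / frob (sigma x)) *: sigma x}]].
Proof.
have [u0 [s0 [Vu0 es0 umin E0]]] := strong_duality hOmega htri hV hf hphi.
have smin tau : equilibrated Omega tri V f tau -> (dual Omega phi s0 <= dual Omega phi tau)%E.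
  by move=> etau; rewrite E0; exact: (weak_duality hOmega htri hV hphi Vu0 etau).
split; [by exists u0; split|by exists s0; split|].
move=> u sigma [Vu uargmin] [es sargmin].
have pu : primal Omega tri f phi u = primal Omega tri f phi u0.
  by apply/eqP; rewrite eq_le uargmin// umin.
have ds : dual Omega phi sigma = dual Omega phi s0.
  by apply/eqP; rewrite eq_le sargmin// smin.
have E : dual Omega phi sigma = (- primal Omega tri f phi u)%E by rewrite ds E0 pu.
have g0 := optimality hOmega htri hV hphi Vu es E.
split.
- by rewrite E oppeK.
- apply: filterS g0 => x h Ox lc; have [Y par] := fenchel_young_eq hphi (h Ox).
  rewrite -(young_eq_dphi hphi (frob_ge0 _) (frob_ge0 _) Y lc).
  apply: parallel_scale => // a0.
  exact: (young_eq_0l hphi (frob_ge0 _) (frob_ge0 _) Y a0).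
- apply: filterS g0 => x h Ox lc; have [Y par] := fenchel_young_eq hphi (h Ox).
  rewrite -(young_eq_dconjugate hphi (frob_ge0 _) (frob_ge0 _) Y lc).
  apply: parallel_scale => // a0.
  exact: (young_eq_0r hphi (frob_ge0 _) (frob_ge0 _) Y a0).
- apply: filterS g0 => x h Ox; have [Y par] := fenchel_young_eq hphi (h Ox).
  exists (frob (sigma x)).
    exact: (young_eq_subgradient hphi (frob_ge0 _) Y).
  apply: parallel_scale => // a0.
  exact: (young_eq_0l hphi (frob_ge0 _) (frob_ge0 _) Y a0).
- apply: filterS g0 => x h Ox; have [Y par] := fenchel_young_eq hphi (h Ox).
  exists (frob (gradh tri u x)).
    exact: (young_eq_subgradient_cj hphi (frob_ge0 _) (frob_ge0 _) Y).
  apply: parallel_scale => // a0.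
  exact: (young_eq_0r hphi (frob_ge0 _) (frob_ge0 _) Y a0).
Qed.
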